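(* There exist a constant $c>0$ and a natural number $n_0$ such that for every natural number $n\ge n_0$ there is a generalised configuration with $n$ points in which, for each pseudoline of the configuration, the number of points of the configuration on one side of the pseudoline and the number of points on its other side differ by at least $c\log\log n$.
   Context: A pseudoline arrangement is a collection of two-way unbounded simple curves in the plane (each being the image of a proper injective continuous map $\mathbb{R}\to\mathbb{R}^2$, so that its complement has exactly two components, its two sides), any two of which meet in at most one point. The members of the arrangement are called pseudolines. A generalised configuration is a finite set of points in the plane together with a pseudoline arrangement such that each pseudoline contains at least two of the points and there is a pseudoline of the arrangement through any pair of the points. Points lying on a pseudoline are counted on neither side of it. *)

(* Defs.v *)
From HB Require Import structures.
From mathcomp Require Import all_boot all_order all_algebra finmap.
From mathcomp Require Import all_classical all_reals all_analysis.
Import numFieldNormedType.Exports.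

Set Implicit Arguments.
Unset Strict Implicit.
Unset Printing Implicit Defensive.

Import Order.TTheory GRing.Theory Num.Theory.
Local Open Scope classical_set_scope.
Local Open Scope ring_scope.

Definition proper_map (T U : topologicalType) (f : T -> U) : Prop :=
  forall K : set U, compact K -> compact (f @^-1` K).

Definition pseudoline (R : realType) (L : set (R * R)) : Prop :=
  exists f : R -> R * R,
    [/\ continuous f, injective f, proper_map f & L = range f].

Definition pseudoline_arrangement (R : realType) (A : set (set (R * R))) : Prop :=
  (forall L, A L -> pseudoline L) /\
  (forall L1 L2, A L1 -> A L2 -> L1 <> L2 -> is_subset1 (L1 `&` L2)).

Definition generalised_configuration (R : realType) (P : {fset R * R})
    (A : set (set (R * R))) : Prop :=
  [/\ pseudoline_arrangement A,
      forall L, A L -> exists p q, [/\ p \in P, q \in P, p <> q, L p & L q] &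
      forall p q, p \in P -> q \in P -> p <> q ->
        exists L, [/\ A L, L p & L q]].

Definition components (T : topologicalType) (X : set T) : set (set T) :=
  [set connected_component X x | x in X].

(* Existence of the two sides of a pseudoline is the Jordan curve theorem for
   properly embedded lines; here it is part of the relation, so a statement of
   the form [exists S1 S2, sides L S1 S2 /\ _] is never vacuous. *)
Definition sides (R : realType) (L S1 S2 : set (R * R)) : Prop :=
  S1 <> S2 /\ components (~` L) = [set S1; S2].

Definition num_points (R : realType) (P : {fset R * R}) (S : set (R * R)) : nat :=
  #|` [fset p in P | p \in S]%fset |.

(* Main.v *)
Require Import Defs.
From HB Require Import structures.
From mathcomp Require Import all_boot all_order all_algebra finmap.
From mathcomp Require Import all_classical all_reals all_analysis.
From mathcomp Require Import zify ring lra.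
Import numFieldNormedType.Exports.

Set Implicit Arguments.
Unset Strict Implicit.
Unset Printing Implicit Defensive.

Import Order.TTheory GRing.Theory Num.Theory.

(** A configuration is encoded by an allowable sequence: a list of distinct numbers in which
    one repeatedly reverses an increasing run, [u R v -> u (rev R) v].  If the sorted list is
    turned into its reverse, every pair is reversed by exactly one move, and the moves are
    realised by graphs of piecewise linear functions, the graph of a move passing through the
    points of [R] and having those of [u] and [v] on its two sides.  So it suffices to reverse,
    by moves with [size u] and [size v] at least [k] apart, every sorted list of length
    [n >= 2 ^ 2 ^ O(k)].

    The list is cut in the middle.  Inversions at distance at least [k] from the cut are free;
    elements only cross the cut inside a run with [k.+1] surplus elements on one of its sides.
    In a round, [p] small elements [x] and [p] large elements [y] are exchanged through the cut
    at a cost [kap = 2 ^ O(k)] of auxiliary elements that does not depend on [p].  A schedule of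
    about [2 ^ j] rounds, defined by recursion on [j], brings [j * 2 ^ j.-1] of the [x] to the
    right half in increasing order.  For [j] larger than a constant times [kap ^ 4] this
    increasing reserve outgrows [kap ^ 2] times the number of rounds, which is what is needed to
    pay for moving all misplaced elements back to their half; then both halves can be sorted. *)

(** * Moves and free rearrangements *)

(** A reversed run is decreasing and none of its pairs can be reversed again, so every crossing
    consumes increasing material, and the only material is the [x] and [y] themselves. A round costs
    the same however many pairs it exchanges, so misplaced elements cost [kap] per increasing layer,
    not per element; and the layers stay linear in the number of rounds because a round returns,
    besides at most [kap] helpers, at most one element of each earlier operation. A round reverses
    the lists it exchanges. To land [x] in increasing order a burst exchanges pairs singly, each at
    the price of [kap] elements of one long increasing list. That list is saved up one element per
    round (accumulator), and its remainder is given back one element per round (thread). As the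
    pairs of a round are free, one round serves all levels of the recursion at once: with [p] equal
    to the depth [J], each of the [J] levels contributes [2 ^ J.-1] ordered [x], while the number of
    rounds is only [2 ^ J] times a factor depending on [kap]. This gain of a factor [J] beats any
    fixed power of [kap]. *)

Lemma allrel_sub (T : eqType) (r : rel T) (A B A' B' : seq T) :
  allrel r A B -> {subset A' <= A} -> {subset B' <= B} -> allrel r A' B'.
Proof.
move=> /allrelP h sA sB; apply/allrelP => x y xA yB.
by apply: h; [apply: sA|apply: sB].
Qed.

Section Moves.
Variables (T : eqType) (lt : rel T).
Hypotheses (lt_tr : transitive lt).
Variable k : nat.

Local Notation "A <<< B" := (allrel lt A B) (at level 70).

(** The weak order generated by adjacent swaps: what could be reached if every two-element move were
    legal. *)
Inductive invert : seq T -> seq T -> Prop :=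
| invert_refl s : invert s s
| invert_trans s t u : invert s t -> invert t u -> invert s u
| invert_swap s a b t : lt a b -> invert (s ++ a :: b :: t) (s ++ b :: a :: t).

Lemma invert_ctx u v s t : invert s t -> invert (u ++ s ++ v) (u ++ t ++ v).
Proof.
elim=> {s t} [s|s t w _ IH1 _ IH2|s a b t ab]; first exact: invert_refl.
  exact: invert_trans IH1 IH2.
have E x y : u ++ (s ++ x :: y :: t) ++ v = (u ++ s) ++ x :: y :: (t ++ v).
  by rewrite -!catA.
by rewrite !E; apply: invert_swap.
Qed.

Lemma invert_catl u s t : invert s t -> invert (u ++ s) (u ++ t).
Proof. by move=> /(invert_ctx u [::]); rewrite !cats0. Qed.

Lemma invert_catr v s t : invert s t -> invert (s ++ v) (t ++ v).
Proof. by move=> /(invert_ctx [::] v). Qed.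

Lemma invert_cat s t s' t' : invert s s' -> invert t t' -> invert (s ++ t) (s' ++ t').
Proof. by move=> h1 h2; apply: invert_trans (invert_catr _ h1) (invert_catl _ h2). Qed.

Lemma invert_perm s t : invert s t -> perm_eq s t.
Proof.
elim=> {s t} [s|s t w _ IH1 _ IH2|s a b t ab] //; first exact: perm_trans IH1 IH2.
by rewrite perm_cat2l; apply/permP => p /=; lia.
Qed.

Lemma invert_pass1 a B : [:: a] <<< B -> invert (a :: B) (B ++ [:: a]).
Proof.
elim: B => [|b B IH] h; first exact: invert_refl.
move: h; rewrite allrel_consr => /andP[h1 h2].
have ab : lt a b by move: h1; rewrite /= andbT.
apply: invert_trans (invert_swap [::] B ab) _ => /=.
by apply: (@invert_catl [:: b] (a :: B) (B ++ [:: a])); apply: IH.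
Qed.

Lemma invert_pass A B : A <<< B -> invert (A ++ B) (B ++ A).
Proof.
elim: A => [|a A IH] /= h; first by rewrite cats0; apply: invert_refl.
move: h; rewrite allrel_consl => /andP[h1 h2].
apply: invert_trans (invert_catl [:: a] (IH h2)) _ => /=.
have /invert_pass1 /(invert_catr A) : [:: a] <<< B by rewrite allrel_consl h1 allrel0l.
by rewrite -catA.
Qed.

Lemma invert_rev s : sorted lt s -> invert s (rev s).
Proof.
elim: s => [|a s IH] h; first exact: invert_refl.
have hs : sorted lt s by apply: path_sorted h.
apply: invert_trans (invert_catl [:: a] (IH hs)) _ => /=.
rewrite rev_cons -cats1; apply: invert_pass1.
rewrite allrel_consl allrel0l andbT all_rev.
by move: h; rewrite /= (path_sortedE lt_tr) => /andP[].
Qed.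

Definition step (s t : seq T) : Prop :=
  exists u R v, [/\ s = u ++ R ++ v, t = u ++ rev R ++ v, sorted lt R, 2 <= size R
    & (k + size u <= size v) || (k + size v <= size u)].

Inductive reach : seq T -> seq T -> Prop :=
| reach_refl s : reach s s
| reach_step s t u : step s t -> reach t u -> reach s u.

Lemma reach_trans s t u : reach s t -> reach t u -> reach s u.
Proof. by elim=> {s t} // s t w st _ IH /IH; apply: reach_step. Qed.

Lemma reach1 s t : step s t -> reach s t.
Proof. by move=> h; apply: reach_step h _; apply: reach_refl. Qed.

Lemma reach_perm s t : reach s t -> perm_eq s t.
Proof.
elim=> {s t} // s t w [u [R [v [-> -> _ _ _]]]] _ IH.
by apply: perm_trans IH; rewrite perm_cat2l perm_cat2r perm_sym perm_rev.
Qed.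

Definition balanced (l r : seq T) := (size l <= (size r).+1) && (size r <= (size l).+1).

(** With balanced halves, a two-element run lying before [F] has at least [2 * size F] more elements
    after it than before it, so each adjacent swap in [a] is a legal move. *)
Lemma freeL a a' F r : invert a a' -> k <= size F -> balanced (a ++ F) r ->
  reach (a ++ F ++ r) (a' ++ F ++ r).
Proof.
move=> + kF; elim=> {a a'} [s|s t w w1 IH1 _ IH2|s a b t ab] hb.
- exact: reach_refl.
- apply: reach_trans (IH1 hb) (IH2 _).
  by move: hb; rewrite /balanced !size_cat (perm_size (invert_perm w1)).
- apply: reach1; exists s, [:: a; b], (t ++ F ++ r); split=> //=.
  + by rewrite -catA.
  + by rewrite -catA.
  + by rewrite ab.
  + move: hb; rewrite /balanced !size_cat /=; lia.
Qed.

Lemma freeR a a' F l : invert a a' -> k <= size F -> balanced l (F ++ a) ->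
  reach (l ++ F ++ a) (l ++ F ++ a').
Proof.
move=> + kF; elim=> {a a'} [s|s t w w1 IH1 _ IH2|s a b t ab] hb.
- exact: reach_refl.
- apply: reach_trans (IH1 hb) (IH2 _).
  by move: hb; rewrite /balanced !size_cat (perm_size (invert_perm w1)).
- apply: reach1; exists (l ++ F ++ s), [:: a; b], t; split=> //=.
  + by rewrite -!catA.
  + by rewrite -!catA.
  + by rewrite ab.
  + move: hb; rewrite /balanced !size_cat /=; lia.
Qed.

End Moves.

Lemma split_end (T : Type) (s : seq T) n : n <= size s ->
  exists a b, s = a ++ b /\ size b = n.
Proof.
move=> h; exists (take (size s - n) s), (drop (size s - n) s).
by rewrite cat_take_drop size_drop subKn.
Qed.

Lemma split_start (T : Type) (s : seq T) n : n <= size s ->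
  exists a b, s = a ++ b /\ size a = n.
Proof.
move=> h; exists (take n s), (drop n s).
by rewrite cat_take_drop size_takel.
Qed.

Lemma allrel_perml (T : eqType) (r : rel T) (A A' B : seq T) :
  perm_eq A A' -> allrel r A B = allrel r A' B.
Proof. by move=> h; rewrite /allrel (perm_all _ h). Qed.

Lemma allrel_permr (T : eqType) (r : rel T) (A B B' : seq T) :
  perm_eq B B' -> allrel r A B = allrel r A B'.
Proof. by move=> h; rewrite !(allrelC r A) (allrel_perml _ _ h). Qed.

Ltac clr := repeat match goal with
  | H : is_true (allrel _ _ _) |- _ => clear H
  | H : is_true (pairwise _ _) |- _ => clear H end.

Ltac liac := clr; repeat match goal with H : is_true (perm_eq _ _) |- _ => clear H end; lia.

Ltac sz := clr; repeat match goal with H : is_true (perm_eq _ _) |- _ =>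
   move/perm_size: H => H end; rewrite ?size_cat ?size_rev;
   repeat match goal with H : context [size (_ ++ _)] |- _ => rewrite size_cat in H
     | H : context [size (rev _)] |- _ => rewrite size_rev in H end; simpl in *; lia.

Ltac pm := clr; let a := fresh in apply/permP => a;
  repeat match goal with H : is_true (perm_eq _ _) |- _ =>
   move/permP/(_ a): H => H end; rewrite ?count_cat ?count_rev;
   repeat match goal with H : context [count _ (_ ++ _)] |- _ => rewrite count_cat in H
     | H : context [count _ (rev _)] |- _ => rewrite count_rev in H end; simpl in *; lia.

Ltac atoms := repeat match goal with
  | H : is_true (_ && _) |- _ => case/andP: H => ? ?
  | H : is_true (allrel _ (_ ++ _) _) |- _ => rewrite allrel_catl in H
  | H : is_true (allrel _ _ (_ ++ _)) |- _ => rewrite allrel_catr in H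
  | H : is_true (allrel _ (rev _) _) |- _ => rewrite allrel_revl in H
  | H : is_true (allrel _ _ (rev _)) |- _ => rewrite allrel_revr in H
  | H : is_true (pairwise _ (_ ++ _)) |- _ => rewrite pairwise_cat in H
  | H : is_true (allrel _ [::] _) |- _ => clear H
  | H : is_true (allrel _ _ [::]) |- _ => clear H
 end.

Ltac ar := rewrite ?(pairwise_cat, allrel_catl, allrel_catr, allrel_revl, allrel_revr, allrel0l, allrel0r);
  repeat first [solve [trivial] | apply/andP; split]; try done.

Ltac perml H := match type of H with is_true (perm_eq ?C _) =>
  repeat match goal with h : is_true (allrel ?lt C ?B) |- _ =>
    let h' := fresh in have h' := h; rewrite (allrel_perml _ _ H) in h'; move: h;
     move: h'  end; intros;
  repeat match goal with h : is_true (allrel ?lt ?B C) |- _ =>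
    let h' := fresh in have h' := h; rewrite (allrel_permr _ _ H) in h'; move: h;
     move: h'  end; intros; atoms end.

Section Halves.
Variables (T : eqType) (lt : rel T).
Hypotheses (lt_tr : transitive lt) (lt_irr : irreflexive lt).

Local Notation "A <<< B" := (is_true (allrel lt A B)) (at level 70).
Local Notation inc := (pairwise lt).
Local Notation invert := (invert lt).

Lemma allrel_trans A B C : 0 < size B -> A <<< B -> B <<< C -> A <<< C.
Proof.
case: B => // b B _ /allrelP h1 /allrelP h2; apply/allrelP => x y xA yC.
by apply: (@lt_tr b); [apply: h1|apply: h2]; rewrite ?inE ?eqxx.
Qed.

Lemma inc1 A : size A = 1 -> inc A.
Proof. by case: A => [|a []]. Qed.

(** The maximum of [s] passes freely to the front, and the rest follows by induction: the decreasing
    list is the top of the weak order. *)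
Lemma invert_sort_to s C : perm_eq s C -> inc C -> invert s (rev C).
Proof.
elim/last_ind: C s => [|C c IH] s.
  by move=> /perm_nilP -> _; apply: invert_refl.
move=> p; rewrite -cats1 => iC; atoms.
have cs : c \in s by rewrite (perm_mem p) mem_rcons inE eqxx.
case/splitPr: cs p => s1 s2 p.
have p' : perm_eq C (s1 ++ s2).
  by rewrite -cats1 in p; pm.
perml p'.
apply: (@invert_trans _ _ _ ([:: c] ++ s1 ++ s2)); last first.
  by rewrite rev_cat; apply: invert_catl; apply: IH; rewrite 1?perm_sym.
by rewrite catA -[_ ++ c :: _]/(s1 ++ [:: c] ++ s2) catA; apply/invert_catr/invert_pass.
Qed.

(** Used on the leftovers [X] of an increasing supply [C]: they are put in decreasing order, so that
    the statements below can describe them by an increasing [E]. *)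
Lemma invert_sort C P X : inc C -> perm_eq C (P ++ X) ->
  exists E, [/\ inc E, perm_eq X E & invert X (rev E)].
Proof.
move=> iC p; have uC : uniq C := pairwise_uniq lt_irr iC.
have: uniq (P ++ X) by rewrite -(perm_uniq p).
rewrite cat_uniq => /and3P[_ _ uX].
pose E := [seq x <- C | x \in X].
have pE : perm_eq X E.
  apply: uniq_perm; rewrite ?filter_uniq // => x.
  rewrite mem_filter (perm_mem p) mem_cat.
  by case: (x \in X); rewrite ?orbT ?andbT.
have iE : inc E by apply: pairwise_filter.
by exists E; split=> //; apply: invert_sort_to.
Qed.

Variable k : nat.
Local Notation reach := (reach lt k).

(* A state is written [l | r], with the cut between [l] and [r]. *)
Definition reach2 (l r l' r' : seq T) : Prop :=
  [/\ size l' = size l, size r' = size r & balanced l r -> reach (l ++ r) (l' ++ r')].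

Lemma reach2_refl l r : reach2 l r l r.
Proof. by split=> // _; apply: reach_refl. Qed.

Lemma reach2_trans l r l1 r1 l2 r2 : reach2 l r l1 r1 -> reach2 l1 r1 l2 r2 -> reach2 l r l2 r2.
Proof.
move=> [a b c] [a' b' c']; split; rewrite ?a' ?b' // => h.
by apply: reach_trans (c h) (c' _); rewrite /balanced a b.
Qed.

Lemma reach2_freeL a a' F r : invert a a' -> k <= size F -> reach2 (a ++ F) r (a' ++ F) r.
Proof.
move=> w kF; have /perm_size e := invert_perm w.
split=> //; rewrite ?size_cat ?e // => h.
rewrite -!catA; apply: (freeL w kF); first exact: h.
Qed.

Lemma reach2_freeR a a' F l : invert a a' -> k <= size F -> reach2 l (F ++ a) l (F ++ a').
Proof.
move=> w kF; have /perm_size e := invert_perm w.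
split=> //; rewrite ?size_cat ?e // => h.
exact: (freeR w kF).
Qed.

(** The two sides of the run differ by at least [size A + 2 * size F - 1]; the [- 1] is the
    tolerance in [balanced] and makes the inequality strict. *)
Lemma reach2_moveL l A F r : inc A -> 2 <= size A -> k < size A + 2 * size F ->
  reach2 (l ++ A ++ F) r (l ++ rev A ++ F) r.
Proof.
move=> iA A2 kA; split=> [|//|]; first by sz.
rewrite /balanced => h; apply: reach1; exists l, A, (F ++ r); rewrite -!catA.
rewrite sorted_pairwise //; split=> //.
by sz.
Qed.

Lemma reach2_moveR l A F r : inc A -> 2 <= size A -> k < size A + 2 * size F ->
  reach2 l (F ++ A ++ r) l (F ++ rev A ++ r).
Proof.
move=> iA A2 kA; split=> [//||]; first by sz.
rewrite /balanced => h; apply: reach1; exists (l ++ F), A, r; rewrite -!catA.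
rewrite sorted_pairwise //; split=> //.
by sz.
Qed.

Hypothesis k_gt0 : 0 < k.

(** Only the surplus counts, since [l] and [r] differ in size by that of [A] and [B], up to one. The
    reversal exchanges as many elements as the shorter part has, and the surplus stays in its
    half. *)
Lemma reach2_cross l A B A' B' r : inc (A ++ B) -> rev (A ++ B) = A' ++ B' ->
  size A' = size A -> (k + size B < size A) || (k + size A < size B) ->
  reach2 (l ++ A) (B ++ r) (l ++ A') (B' ++ r).
Proof.
move=> iA e sA kA.
have sB : size B' = size B.
  by have := congr1 size e; rewrite size_rev !size_cat sA; lia.
split; rewrite ?size_cat ?sA ?sB //.
rewrite /balanced => h; apply: reach1; exists l, (A ++ B), r.
rewrite -!catA e -!catA sorted_pairwise //; split=> //; by sz.
Qed.

End Halves.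

Lemma rev1 (T : Type) (s : seq T) : size s = 1 -> rev s = s.
Proof. by case: s => [|? []]. Qed.

Ltac revs H := repeat match goal with E : rev ?x = ?x |- _ => rewrite !E in H end.
Ltac norm H := rewrite ?rev_cat ?revK -?catA ?cats0 ?cat0s in H; revs H.
Ltac ng := rewrite ?rev_cat ?revK -?catA ?cats0 ?cat0s;
  repeat match goal with E : rev ?x = ?x |- _ => rewrite !E end.
Ltac side := first [by ar | by sz | idtac].
Ltac nx h := norm h; ng; eapply reach2_trans; [eapply h; clear h; side | clear h].
Ltac fin h := norm h; ng; eapply h; clear h; side.

(** * Bringing and exchanging elements near the cut *)

Section LMoves.
Variables (T : eqType) (lt : rel T).
Hypotheses (lt_tr : transitive lt) (lt_irr : irreflexive lt).
Variable k : nat.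
Hypothesis k_gt0 : 0 < k.

Local Notation "A <<< B" := (is_true (allrel lt A B)) (at level 70).
Local Notation inc := (pairwise lt).
Local Notation invert := (invert lt).
Local Notation reach2 := (reach2 lt k).

Fixpoint bring_size d := if d is d'.+1 then 2 * bring_size d' + k + 2 else 0.

(* Each level of the recursion freezes one more element between the rearranged part and the
   cut; as soon as [k] elements are frozen, everything before them moves freely. *)
Lemma bringL_gen d : forall D C S F a r, inc C -> D <<< C -> C <<< S -> D <<< S ->
  k <= size F + d -> bring_size d <= size C ->
  reach2 (a ++ D ++ C ++ S ++ F) r (a ++ S ++ rev C ++ D ++ F) r.
Proof.
elim: d => [|d IH] D C S F a r iC DC CS DS kF sC.
  have w : invert (a ++ D ++ C ++ S) (a ++ S ++ rev C ++ D).
    apply: invert_catl; apply: invert_trans (invert_catl D (invert_pass CS)) _.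
    rewrite !catA; apply: invert_trans (invert_catr C (invert_pass DS)) _.
    rewrite -!catA; apply: invert_catl.
    apply: invert_trans (invert_pass DC) _; apply: invert_catr; apply: invert_rev => //.
    by rewrite sorted_pairwise.
  have := @reach2_freeL _ lt k _ _ F r w; rewrite -!catA; apply; liac.
have core D0 e C0 s S0 : size e = 1 -> size s = 1 -> inc C0 ->
   D0 ++ e <<< C0 -> C0 <<< S0 ++ s -> D0 ++ e <<< S0 ++ s ->
   2 * bring_size d + k <= size C0 ->
   reach2 (a ++ (D0 ++ e) ++ C0 ++ (S0 ++ s) ++ F) r
      (a ++ (S0 ++ s) ++ rev C0 ++ (D0 ++ e) ++ F) r.
  move=> {D C S iC DC CS DS sC} e1 s1 iC DC CS DS sC.
  have [C' [Cc [eC sCc]]] : exists A B, C0 = A ++ B /\ size B = bring_size d.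
    by apply: split_end; liac.
  have [C2 [C1 [eC' sC1]]] : exists A B, C' = A ++ B /\ size B = k.
    by apply: split_end; move: (congr1 size eC); rewrite size_cat; liac.
  subst C' C0; move: (inc1 lt e1) (inc1 lt s1) => ie is_.
  atoms.
  have sC2 : bring_size d <= size C2 by sz.
  rewrite -?catA.
  have re := rev1 e1; have rs := rev1 s1.
  (* First [s] is frozen and all but [s] is rearranged. Then [e ++ C1 ++ s], of length [k + 2], is
     long enough to be reversed as one run whatever [F] is; this puts [e] in the place of [s], and
     the rearrangement is completed with [e] frozen. *)
  have h1 := IH (D0 ++ e ++ C2 ++ C1) Cc S0 (s ++ F) a r; nx h1.
  have h2 := @reach2_freeL _ lt k (a ++ S0 ++ rev Cc ++ D0 ++ e ++ C2)
    (a ++ S0 ++ rev Cc ++ D0 ++ C2 ++ e) (C1 ++ s ++ F) r; nx h2.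
    by do 4! apply: invert_catl; apply: invert_pass.
  have h3 := @reach2_moveL _ _ lt_tr k (a ++ S0 ++ rev Cc ++ D0 ++ C2) (e ++ C1 ++ s) F r; nx h3.
  have h4 := IH D0 C2 (s ++ rev C1) (e ++ F) (a ++ S0 ++ rev Cc) r; nx h4.
  have h5 := @reach2_freeL _ lt k (a ++ S0 ++ rev Cc ++ s) (a ++ S0 ++ s ++ rev Cc)
    (rev C1 ++ rev C2 ++ D0 ++ e ++ F) r; fin h5.
  by do 2! apply: invert_catl; apply: invert_pass; ar.
have core1 D0 e C0 S0 : size e = 1 -> inc C0 -> D0 ++ e <<< C0 -> C0 <<< S0 ->
   D0 ++ e <<< S0 -> 2 * bring_size d + k + 1 <= size C0 ->
   reach2 (a ++ (D0 ++ e) ++ C0 ++ S0 ++ F) r (a ++ S0 ++ rev C0 ++ (D0 ++ e) ++ F) r.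
  (* An empty [S], and below an empty [D], borrows an extreme element of [C]; these two elements are
     the [+ 2] of [bring_size]. *)
  move=> e1 iC0 DC0 CS0 DS0 sC0; case: (posnP (size S0)) => [/size0nil E|].
    have [C' [s [eC s1]]] : exists A B, C0 = A ++ B /\ size B = 1.
      by apply: split_end; liac.
    subst C0 S0; have rs := rev1 s1.
    atoms; have h := core D0 e C' s [::].
    by rewrite cat0s; fin h.
  move=> /split_end [S' [s [eS s1]]]; subst S0.
  by apply: core => //; liac.
case: (posnP (size D)) => [/size0nil E|].
  have [e [C' [eC e1]]] : exists A B, C = A ++ B /\ size A = 1.
    by apply: split_start; rewrite /= in sC; liac.
  subst C D; have re := rev1 e1.
  atoms; have h := core1 [::] e C' S.
  by rewrite cat0s; fin h.
move=> /split_end [D' [e [eD e1]]]; subst D.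
by apply: core1 => //; rewrite /= in sC; liac.
Qed.

Local Notation B := (bring_size k).

Lemma bringL D C S a r : inc C -> D <<< C -> C <<< S -> D <<< S -> B <= size C ->
  reach2 (a ++ D ++ C ++ S) r (a ++ S ++ rev C ++ D) r.
Proof.
move=> iC DC CS DS sC; have := @bringL_gen k D C S [::] a r.
by rewrite !cats0; apply.
Qed.

(** [U] is arbitrary because it will also be a reversed list, such as [rev Q'] below. That [P]
    arrives increasing is essential: it can take part in the next run. *)
Definition exchangeL m c : Prop := forall a C S U b, c <= size C -> size U = m ->
  inc C -> C <<< U -> C <<< S ->
  exists P E, [/\ inc P, size P = m, inc E, perm_eq C (P ++ E) &
    reach2 (a ++ C ++ S) (U ++ b) (a ++ S ++ U ++ rev E) (P ++ b)].

Lemma exchangeL0 : exchangeL 0 B.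
Proof.
move=> a C S U b sC /size0nil -> iC CU CS.
exists [::], C; split=> //.
have h := @bringL [::] C S a b; rewrite ?cats0 ?cat0s in h *; exact: h.
Qed.

(* The elements [Q] crossing in the run [Q ++ K ++ P1 ++ u] must be exchanged back in turn, as
   in a binary counter, so the cost doubles; from [m = k] on ([exchangeL_big]) the
   exchanged elements themselves serve as surplus and each step has constant cost. *)
Lemma exchangeL_small m c : exchangeL m c -> exchangeL m.+1 (2 * c + B + 2 * m + 2 * k + 2).
Proof.
move=> IH a C S U b sC /[dup] sU + iC CU CS.
have /split_end[U0 [u [eU u1]]] : 1 <= size U by liac.
(* The supply is cut as [C3 ++ Q ++ K ++ C4 ++ C1]: [C1] pays for exchanging [U0], [C4] brings
   [Q ++ K] to the cut, [K] is the surplus of the crossing run, and [C3] pays for sending [Q'] back.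
   Of [Q] only its least element [q] stays on the right. *)
have /split_end[X1 [C1 [e1 s1]]] : c <= size C by liac.
have /split_end[X2 [C4 [e2 s4]]] : B <= size X1 by subst C; sz.
have /split_end[X3 [K [e3 sK]]] : k.+1 <= size X2 by subst C X1; sz.
have /split_end[C3 [Q [e4 sQ]]] : m.+1 <= size X3 by subst C X1 X2; sz.
have /split_start[q [Q' [e5 q1]]] : 1 <= size Q by liac.
subst C X1 X2 X3 Q U; rewrite size_cat in sU; have sU0 : size U0 = m by liac.
have sC3 : c + m + k <= size C3 by sz.
have ru := rev1 u1; have rq := rev1 q1; have iu := inc1 lt u1; atoms.
have [P1 [E1 [iP1 sP1 iE1 p1 h1]]] :
    exists P1 E1, [/\ inc P1, size P1 = m, inc E1, perm_eq C1 (P1 ++ E1) &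
    reach2 ((a ++ C3 ++ q ++ Q' ++ K ++ C4) ++ C1 ++ S) (U0 ++ u ++ b)
       ((a ++ C3 ++ q ++ Q' ++ K ++ C4) ++ S ++ U0 ++ rev E1) (P1 ++ u ++ b)].
  by apply: IH => //; first [liac|ar].
perml p1.
have [P2 [E2 [iP2 sP2 iE2 p2 h4]]] : exists P2 E2, [/\ inc P2, size P2 = m, inc E2,
    perm_eq C3 (P2 ++ E2) &
    reach2 (a ++ C3 ++ (S ++ U0 ++ rev E1 ++ rev C4 ++ u ++ rev P1 ++ rev K)) (rev Q' ++ q ++ b)
       (a ++ (S ++ U0 ++ rev E1 ++ rev C4 ++ u ++ rev P1 ++ rev K) ++ rev Q' ++ rev E2) (P2 ++ q ++ b)].
  by apply: IH => //; [liac|sz|ar|ar].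
perml p2.
have [E' [iE' pE' wE']] : exists E, [/\ inc E, perm_eq (rev E1 ++ rev C4 ++ rev P1 ++ rev K ++ rev Q') E &
    invert (rev E1 ++ rev C4 ++ rev P1 ++ rev K ++ rev Q') (rev E)].
  apply: (@invert_sort _ _ lt_irr (C3 ++ q ++ Q' ++ K ++ C4 ++ C1) (C3 ++ q)); first by ar.
  by pm.
exists (P2 ++ q), (E2 ++ E').
have E2E' : E2 <<< E'.
  by rewrite -(allrel_permr _ _ pE'); ar.
split; [by ar|by sz|by ar|by pm|].
nx h1.
have h2 := @bringL (q ++ Q' ++ K) C4 (S ++ U0 ++ rev E1) (a ++ C3) (P1 ++ u ++ b); nx h2.
have h3 := @reach2_cross _ _ lt_tr k k_gt0 (a ++ C3 ++ S ++ U0 ++ rev E1 ++ rev C4) (q ++ Q' ++ K) (P1 ++ u)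
  (u ++ rev P1 ++ rev K) (rev Q' ++ q) b; nx h3.
nx h4.
have h5 := @reach2_freeL _ lt k (a ++ S ++ U0 ++ rev E1 ++ rev C4 ++ u ++ rev P1 ++ rev K ++ rev Q')
  (a ++ S ++ U0 ++ u ++ rev E') (rev E2) (P2 ++ q ++ b); fin h5.
do 3! apply: invert_catl; apply: invert_trans _ (invert_catl u wE').
have h6 : invert ((rev E1 ++ rev C4) ++ u) (u ++ rev E1 ++ rev C4) by apply: invert_pass; ar.
have h7 := invert_catr (rev P1 ++ rev K ++ rev Q') h6; rewrite -!catA in h7; exact: h7.
Qed.

Lemma exchangeL_big m c c' : exchangeL m c -> exchangeL k c' -> k <= m ->
  exchangeL m.+1 (c + c' + 2 * k).
Proof.
move=> IH IHk km a C S U b sC /[dup] sU + iC CU CS.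
have /split_end[U0 [u [eU u1]]] : 1 <= size U by lia.
have /split_end[C2 [C1 [e1 s1]]] : c <= size C by lia.
subst C U; rewrite size_cat in sU; have sU0 : size U0 = m by lia.
have sC2 : c' + 2 * k <= size C2 by sz.
have ru := rev1 u1; have iu := inc1 lt u1; atoms.
have [P1 [E1 [iP1 sP1 iE1 p1 h1]]] :
    exists P1 E1, [/\ inc P1, size P1 = m, inc E1, perm_eq C1 (P1 ++ E1) &
    reach2 ((a ++ C2) ++ C1 ++ S) (U0 ++ u ++ b)
       ((a ++ C2) ++ S ++ U0 ++ rev E1) (P1 ++ u ++ b)].
  by apply: IH => //; first [liac|ar].
have /split_start[Pa [Pb [e2 sPa]]] : k <= size P1 by liac.
have /split_start[p [P' [e3 sp]]] : 1 <= size Pa by liac.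
subst P1 Pa; perml p1; have rp := rev1 sp.
have [P2 [E2 [iP2 sP2 iE2 p2 h4]]] : exists P2 E2, [/\ inc P2, size P2 = k, inc E2,
    perm_eq C2 (P2 ++ E2) &
    reach2 (a ++ C2 ++ (S ++ U0 ++ rev E1)) ((u ++ rev P') ++ p ++ Pb ++ b)
       (a ++ (S ++ U0 ++ rev E1) ++ (u ++ rev P') ++ rev E2) (P2 ++ p ++ Pb ++ b)].
  by apply: IHk => //; [liac|sz|ar|ar].
perml p2.
have [E' [iE' pE' wE']] : exists E, [/\ inc E, perm_eq (rev E1 ++ rev P') E &
    invert (rev E1 ++ rev P') (rev E)].
  apply: (@invert_sort _ _ lt_irr (C2 ++ C1) (C2 ++ p ++ Pb)); first by ar.
  by pm.
exists (P2 ++ p ++ Pb), (E2 ++ E').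
have E2E' : E2 <<< E'.
  by rewrite -(allrel_permr _ _ pE'); ar.
split; [by ar|by sz|by ar|by pm|].
nx h1.
have h2 := @reach2_freeR _ lt k (Pb ++ u ++ b) (u ++ Pb ++ b) (p ++ P') (a ++ C2 ++ S ++ U0 ++ rev E1).
nx h2.
  by have := @invert_catr _ lt b _ _ (@invert_pass _ lt Pb u _); rewrite -!catA; apply; ar.
(* This run has [k + 1] elements and starts at the cut, which is just enough without frozen
   elements; it lies in the right half, so nothing crosses. *)
have h3 := @reach2_moveR _ _ lt_tr k (a ++ C2 ++ S ++ U0 ++ rev E1) (p ++ P' ++ u) [::] (Pb ++ b).
nx h3.
nx h4.
have h5 := @reach2_freeL _ lt k (a ++ S ++ U0 ++ rev E1 ++ u ++ rev P')
  (a ++ S ++ U0 ++ u ++ rev E') (rev E2) (P2 ++ p ++ Pb ++ b); fin h5.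
do 3! apply: invert_catl; apply: invert_trans _ (invert_catl u wE').
by have := @invert_catr _ lt (rev P') _ _ (@invert_pass _ lt (rev E1) u _); rewrite -!catA; apply; ar.
Qed.

Fixpoint exch_small m := if m is m'.+1 then
  2 * exch_small m' + B + 2 * m' + 2 * k + 2 else B.

Definition exch_size m := exch_small k + m * (exch_small k + 2 * k).

Lemma exchangeL_sub m c c' : c <= c' -> exchangeL m c -> exchangeL m c'.
Proof. by move=> h H a C S U b sC; apply: H; apply: leq_trans h sC. Qed.

Lemma exchangeL_exists m : exchangeL m (exch_size m).
Proof.
have small j : j <= k -> exchangeL j (exch_small j).
  elim: j => [|j IH] jk; first exact: exchangeL0.
  by apply: exchangeL_small; apply: IH; lia.
have mono i j : i <= j -> exch_small i <= exch_small j.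
  elim: j => [|j IH]; first by rewrite leqn0 => /eqP ->.
  rewrite leq_eqVlt => /orP[/eqP -> //|]; rewrite ltnS => /IH /=; lia.
have [mk|/ltnW km] := leqP m k.
  apply: exchangeL_sub (small m mk); have := mono _ _ mk; rewrite /exch_size; lia.
rewrite -(subnKC km); elim: (m - k) => [|j IH].
  rewrite addn0; apply: exchangeL_sub (small k _) => //; rewrite /exch_size; lia.
rewrite addnS; apply: exchangeL_sub (exchangeL_big IH (small k _) _); rewrite ?leq_addr //.
rewrite /exch_size mulSn; lia.
Qed.
End LMoves.

(** * Mirror symmetry between the two halves *)

Definition flip_rel (T : Type) (r : rel T) : rel T := fun x y => r y x.

Lemma allrel_flip (T : Type) (r : rel T) A B : allrel (flip_rel r) A B = allrel r B A.
Proof. by rewrite allrelC. Qed.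

Lemma pairwise_flip (T : Type) (r : rel T) s : pairwise (flip_rel r) s = pairwise r (rev s).
Proof.
elim: s => // a s IH; rewrite rev_cons -cats1 pairwise_cat /= IH allrel_revl.
by rewrite allrel1r andbT.
Qed.

Lemma flip_trans (T : Type) (r : rel T) : transitive r -> transitive (flip_rel r).
Proof. by move=> h y x z; rewrite /flip_rel => a b; apply: h b a. Qed.

Lemma step_flip (T : eqType) (lt : rel T) k s t : transitive lt ->
  step (flip_rel lt) k s t -> step lt k (rev s) (rev t).
Proof.
move=> lt_tr [u [R [v [-> -> sR sR2 h]]]]; exists (rev v), (rev R), (rev u).
split; rewrite ?rev_cat ?catA ?size_rev //; last by rewrite orbC.
by rewrite rev_sorted.
Qed.

Lemma reach_flip (T : eqType) (lt : rel T) k s t : transitive lt ->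
  reach (flip_rel lt) k s t -> reach lt k (rev s) (rev t).
Proof.
move=> lt_tr; elim=> {s t} [s|s t u /(step_flip lt_tr) st _ IH]; first exact: reach_refl.
exact: reach_step st IH.
Qed.

Lemma reach2_flip (T : eqType) (lt : rel T) k l r l' r' : transitive lt ->
  reach2 (flip_rel lt) k l r l' r' -> reach2 lt k (rev r) (rev l) (rev r') (rev l').
Proof.
move=> lt_tr [e1 e2 h]; split; rewrite ?size_rev // -!rev_cat => hb.
apply: reach_flip => //; apply: h.
by move: hb; rewrite /balanced !size_rev andbC.
Qed.

(** * Rounds and bursts *)

Section Rounds.
Variables (T : eqType) (lt : rel T).
Hypotheses (lt_tr : transitive lt) (lt_irr : irreflexive lt).
Variable k : nat.
Hypothesis k_gt0 : 0 < k.

Local Notation "A <<< B" := (is_true (allrel lt A B)) (at level 70).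
Local Notation inc := (pairwise lt).
Local Notation invert := (invert lt).
Local Notation reach2 := (reach2 lt k).
Local Notation B := (bring_size k k).

Lemma bringR D C S a l : inc C -> C <<< D -> S <<< C -> S <<< D -> B <= size C ->
  reach2 l (S ++ C ++ D ++ a) l (D ++ rev C ++ S ++ a).
Proof.
move=> iC DC CS DS sC.
have h := @bringL _ _ (flip_trans lt_tr) k k_gt0 (rev D) (rev C) (rev S) (rev a) (rev l).
have := reach2_flip lt_tr (h _ _ _ _ _); rewrite !(revK, rev_cat) -!catA.
by apply; rewrite ?(pairwise_flip lt) ?(allrel_flip lt) ?revK ?size_rev //; ar.
Qed.

(** Two pieces of size [B + k]: in a round the first brings [W] to the cut and the second takes the
    arrived [X] away from it. Each needs [B] elements for [bringR] and [k] to be frozen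
    meanwhile. *)
Definition buf := 2 * (B + k).
(** The summands pay for renewing the buffer, for bringing [X] to the cut, and for the surplus of
    the crossing run. *)
Definition round_size := exch_size k buf + B + k.+1.
Local Notation b := buf.

Lemma invert_passr A C D : A <<< C -> invert (A ++ C ++ D) (C ++ A ++ D).
Proof. by move=> h; rewrite !catA; apply/invert_catr/invert_pass. Qed.

Lemma exchangeL_round a C S U be : exch_size k b <= size C -> size U = b ->
  inc C -> C <<< U -> C <<< S ->
  exists P1 P2 E, [/\ inc (P1 ++ P2), size P1 = B + k /\ size P2 = B + k, inc E,
    perm_eq C (P1 ++ P2 ++ E) &
    reach2 (a ++ C ++ S) (U ++ be) (a ++ S ++ U ++ rev E) (P1 ++ P2 ++ be)].
Proof.
move=> sC sU iC CU CS.
have [P [E [iP sP iE p h]]] := exchangeL_exists lt_tr lt_irr k_gt0 a be sC sU iC CU CS.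
have /split_start[P1 [P2 [e sP1]]] : B + k <= size P by rewrite sP /buf; liac.
subst P; exists P1, P2, E; split=> //; rewrite ?catA -?catA // in p h *.
by split=> //; move: sP; rewrite size_cat sP1 /buf; liac.
Qed.

(* The cost [round_size] does not depend on the length of [X] and [W], which cross the cut in
   the single run [X ++ K ++ W]. *)
Lemma roundL a X C S U W be : size U = b -> size X = size W -> round_size <= size C ->
  inc X -> inc C -> inc W -> X <<< C -> C <<< U -> C <<< W -> C <<< S ->
  exists P E, [/\ inc P, size P = b, inc E, perm_eq C (P ++ E) &
    reach2 (a ++ X ++ C ++ S) (U ++ W ++ be)
       (a ++ S ++ U ++ rev W ++ rev E) (rev P ++ rev X ++ be)].
Proof.
move=> sU sXW sC iX iC iW XC CU CW CS.
have C0 : 0 < size C by rewrite /round_size in sC; liac.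
have XW := allrel_trans lt_tr C0 XC CW.
have XS := allrel_trans lt_tr C0 XC CS.
have XU := allrel_trans lt_tr C0 XC CU.
have /split_end[Cl [Ch [eC sCh]]] : exch_size k b <= size C by rewrite /round_size in sC; liac.
have /split_start[K [C' [eC' sK]]] : k.+1 <= size Cl.
  by subst C; rewrite /round_size in sC; sz.
subst C Cl; have sC' : B <= size C' by rewrite /round_size in sC; sz.
atoms.
have [P1 [P2 [E1 [iP [sP1 sP2] iE1 p1 h1]]]] :
  exists P1 P2 E, [/\ inc (P1 ++ P2), size P1 = B + k /\ size P2 = B + k, inc E,
    perm_eq Ch (P1 ++ P2 ++ E) &
    reach2 ((a ++ X ++ K ++ C') ++ Ch ++ S) (U ++ W ++ be)
       ((a ++ X ++ K ++ C') ++ S ++ U ++ rev E) (P1 ++ P2 ++ W ++ be)].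
  by apply: exchangeL_round => //; rewrite sCh.
perml p1; clear sC.
have [E' [iE' pE' wE']] : exists E, [/\ inc E, perm_eq (rev E1 ++ rev C') E &
    invert (rev E1 ++ rev C') (rev E)].
  apply: (@invert_sort _ _ lt_irr (K ++ C' ++ Ch) (K ++ P1 ++ P2)); first by ar.
  by pm.
exists (P1 ++ P2), (K ++ E').
have KE' : K <<< E' by rewrite -(allrel_permr _ _ pE'); ar.
split; [by ar|by rewrite size_cat sP1 sP2 /buf; liac|by ar|by pm|].
nx h1.
have h2 := @reach2_freeR _ lt k (P2 ++ W ++ be) (W ++ P2 ++ be) P1 (a ++ X ++ K ++ C' ++ S ++ U ++ rev E1).
nx h2.
  by apply: invert_passr; ar.
have h3 := @bringR W P1 [::] (P2 ++ be) (a ++ X ++ K ++ C' ++ S ++ U ++ rev E1).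
nx h3.
have h4 := @bringL _ _ lt_tr k k_gt0 (X ++ K) C' (S ++ U ++ rev E1) a (W ++ rev P1 ++ P2 ++ be).
nx h4.
have h5 := @reach2_cross _ _ lt_tr k k_gt0 (a ++ S ++ U ++ rev E1 ++ rev C') (X ++ K) W (rev W ++ rev K) (rev X)
   (rev P1 ++ P2 ++ be).
nx h5.
have h6 := @bringR [::] P2 (rev X ++ rev P1) be (a ++ S ++ U ++ rev E1 ++ rev C' ++ rev W ++ rev K).
nx h6.
have h7 := @reach2_freeR _ lt k (rev X ++ rev P1 ++ be) (rev P1 ++ rev X ++ be) (rev P2)
   (a ++ S ++ U ++ rev E1 ++ rev C' ++ rev W ++ rev K).
nx h7.
  by apply: invert_passr; ar.
have h8 := @reach2_freeL _ lt k (a ++ S ++ U ++ rev E1 ++ rev C' ++ rev W)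
   (a ++ S ++ U ++ rev W ++ rev E') (rev K) (rev P2 ++ rev P1 ++ rev X ++ be).
fin h8.
do 3! apply: invert_catl; apply: invert_trans _ (invert_catl (rev W) wE').
by rewrite catA; apply: invert_pass; ar.
Qed.

(** The last element of [X] and the first of [W] are exchanged by a round with one pair, and so on;
    hence [X] and [W] may be in any order and keep it, but the cost is now proportional to [V]. *)
Lemma burstL V : forall a X C S U W be, size U = b -> size X = V -> size W = V ->
  round_size * V.+1 <= size C ->
  inc C -> X <<< C -> C <<< U -> C <<< W -> C <<< S ->
  exists P E, [/\ inc P, size P = b, inc E, perm_eq C (P ++ E) &
    reach2 (a ++ X ++ C ++ S) (U ++ W ++ be)
       (a ++ S ++ U ++ W ++ rev E) (rev P ++ X ++ be)].
Proof.
elim: V => [|V IH] a X C S U W be sU sX sW sC iC XC CU CW CS.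
  have := roundL a be sU (_ : size X = size W) (_ : round_size <= size C).
  move: sX sW => /size0nil -> /size0nil ->.
  by apply=> //; rewrite ?allrel0r ?allrel0l // -(muln1 round_size).
have /split_end[X' [x [eX x1]]] : 1 <= size X by liac.
have /split_start[w [W' [eW w1]]] : 1 <= size W by liac.
have /split_end[C1 [C2 [eC sC2]]] : round_size <= size C by rewrite mulnS in sC; liac.
subst X C W.
have sC1 : round_size * V.+1 <= size C1 by rewrite size_cat sC2 mulnS in sC; liac.
have sX' : size X' = V by sz.
have sW' : size W' = V by sz.
have C20 : 0 < size C2 by rewrite sC2 /round_size; liac.
have rx := rev1 x1; have rw := rev1 w1; have ix := inc1 lt x1; have iw := inc1 lt w1.
atoms.
have xW' : x <<< W' by apply: allrel_trans C20 _ _.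
have [P1 [E1 [iP1 sP1 iE1 p1 h1]]] :
  exists P E, [/\ inc P, size P = b, inc E, perm_eq C2 (P ++ E) &
    reach2 ((a ++ X' ++ C1) ++ x ++ C2 ++ S) (U ++ w ++ W' ++ be)
       ((a ++ X' ++ C1) ++ S ++ U ++ rev w ++ rev E) (rev P ++ rev x ++ W' ++ be)].
  by apply: roundL => //; rewrite ?x1 ?w1 ?sC2.
perml p1.
have [P2 [E2 [iP2 sP2 iE2 p2 h4]]] :
  exists P E, [/\ inc P, size P = b, inc E, perm_eq C1 (P ++ E) &
    reach2 (a ++ X' ++ C1 ++ (S ++ U ++ w ++ rev E1)) (rev P1 ++ W' ++ x ++ be)
       (a ++ (S ++ U ++ w ++ rev E1) ++ rev P1 ++ W' ++ rev E) (rev P ++ X' ++ x ++ be)].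
  by apply: IH => //; rewrite ?size_rev //; ar.
perml p2.
have sE2 : k <= size E2.
  have := perm_size p2; rewrite size_cat sP2 => e; rewrite e in sC1.
  rewrite mulnS /round_size /exch_size in sC1.
  have : b <= b * (exch_small k k + 2 * k) by rewrite leq_pmulr //; liac.
  by liac.
have [E' [iE' pE' wE']] : exists E, [/\ inc E, perm_eq (rev E1 ++ rev P1) E &
    invert (rev E1 ++ rev P1) (rev E)].
  apply: (@invert_sort _ _ lt_irr C2 [::]); first by ar.
  by pm.
exists P2, (E2 ++ E').
have KE' : E2 <<< E' by rewrite -(allrel_permr _ _ pE'); ar.
split; [by []|by []|by ar|by pm|].
have h0 := @reach2_freeL _ lt k (a ++ X' ++ x ++ C1) (a ++ X' ++ C1 ++ x) (C2 ++ S)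
  (U ++ w ++ W' ++ be).
nx h0.
- by do 2! apply: invert_catl; apply: invert_pass.
- by rewrite size_cat sC2 /round_size; liac.
nx h1.
have h3 := @reach2_freeR _ lt k (x ++ W' ++ be) (W' ++ x ++ be) (rev P1)
  (a ++ X' ++ C1 ++ S ++ U ++ w ++ rev E1).
nx h3.
- by apply: invert_passr.
- by rewrite size_rev sP1 /buf; liac.
nx h4.
have h5 := @reach2_freeL _ lt k (a ++ S ++ U ++ w ++ rev E1 ++ rev P1 ++ W')
   (a ++ S ++ U ++ w ++ W' ++ rev E') (rev E2) (rev P2 ++ X' ++ x ++ be).
fin h5.
do 4! apply: invert_catl; apply: invert_trans _ (invert_catl W' wE').
by rewrite catA; apply: invert_pass; ar.
Qed.

End Rounds.

Section RoundsR.
Variables (T : eqType) (lt : rel T).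
Hypotheses (lt_tr : transitive lt) (lt_irr : irreflexive lt).
Variable k : nat.
Hypothesis k_gt0 : 0 < k.

Local Notation "A <<< B" := (is_true (allrel lt A B)) (at level 70).
Local Notation inc := (pairwise lt).
Local Notation reach2 := (reach2 lt k).
Local Notation b := (buf k).
Let fl_tr := flip_trans lt_tr.

Let fl_irr : irreflexive (flip_rel lt).
Proof. by move=> x; apply: lt_irr. Qed.

Lemma perm_rev_cat (A C D : seq T) : perm_eq (rev C) (A ++ D) -> perm_eq C (rev A ++ rev D).
Proof. by move=> p; pm. Qed.

Ltac flip_side := rewrite ?(pairwise_flip lt) ?(allrel_flip lt) ?allrel_rev2 ?revK ?size_rev //.

Lemma exchangeR m a C S U be : exch_size k m <= size C -> size U = m ->
  inc C -> U <<< C -> S <<< C ->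
  exists P E, [/\ inc P, size P = m, inc E, perm_eq C (P ++ E) &
    reach2 (be ++ U) (S ++ C ++ a) (be ++ P) (rev E ++ U ++ S ++ a)].
Proof.
move=> sC sU iC CU CS.
have := @exchangeL_exists _ _ fl_tr fl_irr k k_gt0 m (rev a) (rev C) (rev S) (rev U) (rev be).
case; try by flip_side.
move=> P [E [iP sP iE p h]].
exists (rev P), (rev E); rewrite -!(pairwise_flip lt) size_rev revK; split=> //.
  exact: perm_rev_cat.
by have := reach2_flip lt_tr h; rewrite !(rev_cat, revK) -!catA.
Qed.

Lemma roundR a Y C S U W be : size U = b -> size Y = size W -> round_size k <= size C ->
  inc Y -> inc C -> inc W -> C <<< Y -> U <<< C -> W <<< C -> S <<< C ->
  exists P E, [/\ inc P, size P = b, inc E, perm_eq C (P ++ E) &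
    reach2 (be ++ W ++ U) (S ++ C ++ Y ++ a)
       (be ++ rev Y ++ rev P) (rev E ++ rev W ++ U ++ S ++ a)].
Proof.
move=> sU sYW sC iY iC iW XC CU CW CS.
have := @roundL _ _ fl_tr fl_irr k k_gt0 (rev a) (rev Y) (rev C)
  (rev S) (rev U) (rev W) (rev be).
case; try by flip_side.
move=> P [E [iP sP iE p h]].
exists (rev P), (rev E); rewrite -!(pairwise_flip lt) size_rev !revK; split=> //.
  exact: perm_rev_cat.
by have := reach2_flip lt_tr h; rewrite !(rev_cat, revK) -!catA.
Qed.

Lemma burstR V a Y C S U W be : size U = b -> size Y = V -> size W = V ->
  round_size k * V.+1 <= size C ->
  inc C -> C <<< Y -> U <<< C -> W <<< C -> S <<< C ->
  exists P E, [/\ inc P, size P = b, inc E, perm_eq C (P ++ E) &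
    reach2 (be ++ W ++ U) (S ++ C ++ Y ++ a)
       (be ++ Y ++ rev P) (rev E ++ W ++ U ++ S ++ a)].
Proof.
move=> sU sY sW sC iC XC CU CW CS.
have := @burstL _ _ fl_tr fl_irr k k_gt0 V (rev a) (rev Y) (rev C)
  (rev S) (rev U) (rev W) (rev be).
case; try by flip_side.
move=> P [E [iP sP iE p h]].
exists (rev P), (rev E); rewrite -!(pairwise_flip lt) size_rev !revK; split=> //.
  exact: perm_rev_cat.
by have := reach2_flip lt_tr h; rewrite !(rev_cat, revK) -!catA.
Qed.

End RoundsR.

(** * The recursive schedule *)

Local Notation "A <<< B" := (is_true (allrel ltn A B)) (at level 70).

(** Bounds are written as comparisons with singletons so that they split along concatenations like
    all other relations; [[:: n.-1] <<< C] is the lower bound [n]. *)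
Lemma lt_sep n A C : 0 < n -> A <<< [:: n] -> [:: n.-1] <<< C -> A <<< C.
Proof.
move=> n0 /allrelP h1 /allrelP h2; apply/allrelP => x y xA yC.
have := h1 x n xA; rewrite inE eqxx => /(_ isT) {}h1.
have := h2 n.-1 y; rewrite inE eqxx => /(_ isT yC) {}h2; liac.
Qed.

Lemma allrel_lew n n' A : n <= n' -> A <<< [:: n] -> A <<< [:: n'].
Proof.
move=> nn /allrelP h; apply/allrelP => x y xA; rewrite inE => /eqP ->.
by apply: leq_trans nn; apply: h; rewrite ?inE.
Qed.

Lemma allrel_gew n n' A : n' <= n -> [:: n] <<< A -> [:: n'] <<< A.
Proof.
move=> nn /allrelP h; apply/allrelP => x y; rewrite inE => /eqP -> yA.
by apply: leq_ltn_trans nn _; apply: h; rewrite ?inE.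
Qed.

Lemma inc_iota m n : pairwise ltn (iota m n).
Proof. by rewrite -sorted_pairwise; [apply: iota_ltn_sorted|apply: ltn_trans]. Qed.

Lemma iota_lo m n : 0 < m -> [:: m.-1] <<< iota m n.
Proof. by move=> m0; rewrite allrel1l; apply/allP => x; rewrite mem_iota; liac. Qed.

Lemma iota_hi m n m' : m + n <= m' -> iota m n <<< [:: m'].
Proof. by move=> h; rewrite allrel1r; apply/allP => x; rewrite mem_iota; liac. Qed.

Lemma iota_iota m n n' : iota m n <<< iota (m + n) n'.
Proof. by apply/allrelP => x y; rewrite !mem_iota; liac. Qed.

Section Engine.
Variables (k M p : nat).
Hypothesis k_gt0 : 0 < k.
Local Notation inc := (pairwise ltn).
Local Notation invert := (invert ltn).
Local Notation reach2 := (reach2 ltn k).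
Local Notation B := (bring_size k k).
Local Notation b := (buf k).
Local Notation kap := (round_size k).
Lemma buf_le : 2 * b + B + k.+1 <= kap.
Proof.
rewrite /round_size /exch_size.
have : b * 2 <= b * (exch_small k k + 2 * k) by rewrite leq_mul2l; liac.
by move: (b * (_ + _)) => x; liac.
Qed.

Hypothesis M_big : kap + p + B + b + 2 ^ p <= M.

(* The [tau]-th operation introduces numbers [v] with [v %/ M = tau]; the numbers below [M] are
   the [x]. *)
Definition alt : rel nat := fun x y => x %/ M < y %/ M.
Definition isX : pred nat := fun v => v < M.

Lemma M_gt0 : 0 < M. Proof. by move: M_big; rewrite /round_size; liac. Qed.

Lemma alt_lt x y : alt x y -> x < y.
Proof. by rewrite /alt; apply: contraTltn => h; rewrite -leqNgt leq_div2r. Qed.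

Lemma allrel_alt A C : allrel alt A C -> A <<< C.
Proof. by move=> /allrelP h; apply/allrelP => x y xA yC; apply/alt_lt/h. Qed.

Lemma alt_sep t A C : 0 < t -> A <<< [:: M * t] -> [:: (M * t).-1] <<< C -> allrel alt A C.
Proof.
have M0 := M_gt0; move=> t0 /allrelP h1 /allrelP h2; apply/allrelP => x y xA yC.
have := h1 x (M * t) xA; rewrite inE eqxx => /(_ isT) {}h1.
have := h2 (M * t).-1 y; rewrite inE eqxx => /(_ isT yC) {}h2.
rewrite /alt; apply: (@leq_trans t).
  by rewrite ltn_divLR // mulnC.
by rewrite leq_divRL // mulnC; nia.
Qed.

(* A level [(true, s)] is a thread: [s] is decreasing and each round removes its last element.
   A level [(false, s)] is an accumulator: [s] is increasing and each round appends to it. *)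
Definition level := (bool * seq nat)%type.
Definition flat (Ls : seq level) : seq nat := flatten (map snd Ls).
(** What lies behind a thread comes from later operations. Hence elements popped from different
    threads in one round belong to different operations, and they form an increasing list. *)
Fixpoint lev_ok (Ls : seq level) : bool := if Ls is L :: Ls' then
  (if L.1 then inc (rev L.2) && allrel alt L.2 (flat Ls') else inc L.2) && lev_ok Ls'
  else true.
Definition lshape (Ls : seq level) := [seq (L.1, size L.2) | L <- Ls].

Definition pop_shape (c : bool * nat) := (c.1, if c.1 then c.2 - 1 else c.2).
Definition upd n (c : bool * nat) := (c.1, if c.1 then c.2 - n else c.2 + n).

Lemma flat_cons L Ls : flat (L :: Ls) = L.2 ++ flat Ls. Proof. by []. Qed.

Lemma pop_levels Ls : lev_ok Ls -> exists Ls1 Wp,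
  [/\ invert (flat Ls) (flat Ls1 ++ Wp), lshape Ls1 = map pop_shape (lshape Ls),
      size Wp <= size Ls, pairwise alt Wp & lev_ok Ls1].
Proof.
elim: Ls => [|[t c] Ls IH] /=; first by exists [::], [::]; split=> //; apply: invert_refl.
move=> /andP[hL /IH [Ls1 [Wp [w sh sW aW ok]]]] {IH}.
have pw := invert_perm w; rewrite flat_cons [(t, c).2]/=.
case: t hL => [/andP[ic al]|ic]; last first.
  exists ((false, c) :: Ls1), Wp; split=> //=; rewrite ?ic ?sh //.
    by rewrite flat_cons -catA; apply: invert_catl.
  by apply: leq_trans sW _.
case: (posnP (size c)) => [/size0nil E|].
  subst c; exists ((true, [::]) :: Ls1), Wp; split=> //=; rewrite ?sh //.
  by apply: leq_trans sW _.
move=> /split_end[c' [e [eC e1]]]; subst c.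
rewrite (allrel_permr _ _ pw) in al.
exists ((true, c') :: Ls1), (e ++ Wp).
move: ic; rewrite rev_cat; move=> ic; atoms.
split=> //=.
- rewrite flat_cons -!catA; apply: invert_catl; apply: invert_trans (invert_catl e w) _.
  by rewrite !catA; apply/invert_catr/invert_pass/allrel_alt.
- by rewrite sh /= size_cat e1 /pop_shape /= addn1 subn1.
- by rewrite size_cat e1.
- by ar; case: (e) e1 => [|? []].
- by ar.
Qed.

Definition nacc (Ls : seq level) := count (fun L => ~~ L.1) Ls.

Lemma push_levels t Ls Y : 0 < t -> lev_ok Ls -> inc Y -> size Y = nacc Ls ->
  flat Ls <<< [:: M * t] -> [:: (M * t).-1] <<< Y -> exists Ls',
  [/\ invert (flat Ls ++ rev Y) (flat Ls'), lev_ok Ls' &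
   lshape Ls' = [seq (c.1, if c.1 then c.2 else c.2.+1) | c <- lshape Ls]].
Proof.
move=> t0; have Mt0 : 0 < M * t by rewrite muln_gt0 M_gt0.
elim: Ls Y => [|[th c] Ls IH] Y /=.
  by move=> _ _ /size0nil -> _ _; exists [::]; split=> //; apply: invert_refl.
move=> /andP[hL ok] iY sY; rewrite flat_cons allrel_catl => /andP[/= ct Lt] tY.
case: th hL sY => [/andP[ic al]|ic] sY.
  rewrite add0n in sY; have [Ls' [w ok' sh]] := IH Y ok iY sY Lt tY.
  exists ((true, c) :: Ls'); split=> //=; last by rewrite sh.
    by rewrite flat_cons -catA; apply: invert_catl.
  rewrite ic ok' -(allrel_permr _ _ (invert_perm w)); ar.
  exact: alt_sep ct tY.
have /split_end[Y' [y [eY y1]]] : 1 <= size Y by rewrite sY.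
subst Y; atoms; have ry := rev1 y1.
have sY' : size Y' = nacc Ls by move: sY; rewrite size_cat y1 /nacc; liac.
have [Ls' [w ok' sh]] := IH Y' ok ltac:(by []) sY' Lt ltac:(by []).
exists ((false, c ++ y) :: Ls'); split=> //=.
- rewrite flat_cons rev_cat ry -!catA; apply: invert_catl.
  apply: invert_trans (invert_catl y w); rewrite !catA; apply/invert_catr/invert_pass.
  by apply: (lt_sep Mt0).
- by rewrite ok' andbT; ar; apply: (lt_sep Mt0).
- by rewrite sh size_cat y1 addn1.
Qed.

(** Each operation prepends one or two blocks to [Z]. The bound per block and per operation,
    independent of [p], is what keeps the number of increasing layers of [Z] small. *)
Definition zblocks t (Z : seq nat) : Prop := exists bs, [/\ Z = flatten bs, size bs = t &
  forall blk, blk \in bs -> forall al, 0 < al -> count (fun v => v %/ M == al) blk <= kap.+1].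

Definition xpart xi (Z : seq nat) : Prop := exists Xi rest,
  [/\ invert (seq.filter isX Z) (Xi ++ rest), inc Xi & xi <= size Xi].

(** [X] are the [x] not yet used, [D0] the [y] discarded on the left, [U] the buffer at the cut, [Z]
    what has been sent right, [fr] the fresh [y]. The next operation is number [tau], [t] counts the
    blocks, and [s] and [xi] bound from below the remaining [x] and the increasing reserve. *)
Definition engine_state tau t xi s sh (l r fr : seq nat) : Prop := exists X D0 Ls U Z,
  [/\ l = X ++ D0 ++ flat Ls ++ U /\ r = Z ++ fr,
   [/\ size U = b, s <= size X, inc X & lshape Ls = sh],
   lev_ok Ls,
   [/\ X <<< D0 ++ flat Ls ++ U ++ Z, D0 ++ flat Ls ++ U ++ Z <<< [:: M * tau],
       X <<< [:: M] & [:: M.-1] <<< D0 ++ flat Ls ++ U] &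
   zblocks t Z /\ xpart xi Z].

Lemma count_alt W al : pairwise alt W -> count (fun v => v %/ M == al) W <= 1.
Proof.
elim: W => //= w W IH /andP[aw /IH c1].
case: eqP => [e|_] //; rewrite -[1]addn0 leq_add2l leqn0 -leqn0 leqNgt -has_count.
by apply/hasPn => x /(allP aw); rewrite /alt e; liac.
Qed.

Lemma count_X X al : X <<< [:: M] -> 0 < al -> count (fun v => v %/ M == al) X = 0.
Proof.
rewrite allrel1r => /allP h al0; apply/eqP; rewrite -leqn0 leqNgt -has_count.
by apply/hasPn => x /h xM; rewrite divn_small // neq_ltn al0.
Qed.

Lemma filterX X : X <<< [:: M] -> seq.filter isX X = X.
Proof. by rewrite allrel1r => h; apply/all_filterP. Qed.

Lemma filterY Y : [:: M.-1] <<< Y -> seq.filter isX Y = [::].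
Proof.
rewrite allrel1l => /allP h; apply/eqP; rewrite -(negbK (_ == _)) -has_filter.
by apply/hasPn => x /h; rewrite /isX; have := M_gt0; liac.
Qed.

Lemma size_lshape Ls : size (lshape Ls) = size Ls. Proof. by rewrite size_map. Qed.

Lemma zblocks_cons t blk Z : zblocks t Z ->
  (forall al, 0 < al -> count (fun v => v %/ M == al) blk <= kap.+1) ->
  zblocks t.+1 (blk ++ Z).
Proof.
move=> [bs [-> <- h]] hb; exists (blk :: bs); split=> // c.
by rewrite inE => /predU1P[-> //|]; apply: h.
Qed.

(** One round with [p] pairs: the popped thread elements, topped up with [x], leave for the right;
    of the [p] arriving [y] each accumulator gets one and the others are discarded into [D0]. *)
Lemma unit_op tau t xi s sh l r fr : 0 < tau -> size sh <= p ->
  engine_state tau t xi (s + p) sh l r (iota (M * tau) (kap + p) ++ fr) ->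
  exists l' r', reach2 l r l' r' /\ engine_state tau.+1 t.+1 xi s (map (upd 1) sh) l' r' fr.
Proof.
move=> t0 shp [X [D0 [Ls [U [Z [[-> ->] [sU sX iX eL] ok [Xo hi XM lo] [zb xp]]]]]]].
have Mt0 : 0 < M * tau by rewrite muln_gt0 M_gt0.
have MMt : M <= M * tau by rewrite leq_pmulr.
have [Ls1 [Wp [w1 sh1 sWp aWp ok1]]] := pop_levels ok.
have pw1 := invert_perm w1; rewrite -eL size_lshape in shp.
have /split_end[X' [Xp [eX sXp]]] : p - size Wp <= size X by liac.
subst X; atoms.
rewrite iotaD; set C := iota _ kap; set Y := iota _ p.
have sC : size C = kap by rewrite size_iota.
have sY : size Y = p by rewrite size_iota.
have iC : inc C by apply: inc_iota.
have iY : inc Y by apply: inc_iota.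
have CY : C <<< Y by apply: iota_iota.
have loC : [:: (M * tau).-1] <<< C ++ Y by rewrite -iotaD; apply: iota_lo.
have hiC : C ++ Y <<< [:: M * tau.+1].
  by rewrite -iotaD; apply: iota_hi; rewrite mulnS; liac.
have iWp : inc Wp by apply: sub_pairwise aWp; apply: alt_lt.
perml pw1.
have hiX : X' ++ Xp <<< [:: M * tau] by apply: allrel_lew MMt _; ar.
have AC : X' ++ Xp ++ D0 ++ flat Ls1 ++ Wp ++ U ++ Z <<< C ++ Y.
  by atoms; apply: (lt_sep Mt0); ar.
atoms.
clearbody C Y.
have sYW : size Y = size (Xp ++ Wp) by rewrite size_cat sXp sY; liac.
have := @roundR nat ltn ltn_trans ltnn k k_gt0 fr Y C Z U (Xp ++ Wp) (X' ++ D0 ++ flat Ls1).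
case=> //; try by [ar | rewrite ?sC].
move=> P [E [iP sP iE pC h2]].
perml pC.
have nY : nacc Ls1 <= size Y.
  by rewrite sY; apply: leq_trans (count_size _ _) _; rewrite -size_lshape sh1 size_map size_lshape.
have /split_start[Ya [Yd [eY sYa]]] := nY.
subst Y; atoms.
have [Ls2 [w2 ok2 sh2]] : exists Ls', [/\ invert (flat Ls1 ++ rev Ya) (flat Ls'), lev_ok Ls' &
   lshape Ls' = [seq (c.1, if c.1 then c.2 else c.2.+1) | c <- lshape Ls1]].
  by apply: (push_levels t0).
have pL : perm_eq (flat Ls1 ++ rev Ya) (flat Ls2) := invert_perm w2.
exists (X' ++ (D0 ++ rev Yd) ++ flat Ls2 ++ rev P), ((rev E ++ rev (Xp ++ Wp) ++ U ++ Z) ++ fr).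
split.
  have h1 := @reach2_freeL _ ltn k (X' ++ Xp ++ D0 ++ flat Ls) (X' ++ D0 ++ flat Ls1 ++ Xp ++ Wp) U
    (Z ++ C ++ Ya ++ Yd ++ fr).
  nx h1.
  - have w3 := invert_catl (Xp ++ D0) w1; rewrite -!catA in w3.
    apply: invert_catl; apply: invert_trans w3 _.
    have w4 := @invert_passr _ ltn Xp (D0 ++ flat Ls1) Wp; rewrite -!catA in w4.
    by apply: w4; ar.
  - by rewrite sU /buf; liac.
  nx h2.
  have h3 := @reach2_freeL _ ltn k (X' ++ D0 ++ flat Ls1 ++ rev Yd ++ rev Ya)
    (X' ++ D0 ++ rev Yd ++ flat Ls2) (rev P).
  norm h3; ng; apply: h3; last by rewrite size_rev sP /buf; liac.
  do 2! apply: invert_catl; apply: invert_trans (invert_catl (rev Yd) w2).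
  by apply: invert_passr; ar.
exists X', (D0 ++ rev Yd), Ls2, (rev P), (rev E ++ rev (Xp ++ Wp) ++ U ++ Z).
split=> //.
- split=> //; first by rewrite size_rev.
    by move: sX; rewrite size_cat sXp; liac.
  rewrite sh2 sh1 -eL -!map_comp; apply: eq_map => -[[] n] //=.
  by rewrite /upd /pop_shape /= addn1.
- have hs : M * tau <= M * tau.+1 by rewrite leq_mul2l leqnSn orbT.
  have hs' : D0 ++ Xp ++ flat Ls1 ++ Wp ++ U ++ Z <<< [:: M * tau.+1].
    by apply: allrel_lew hs _; ar.
  have lo' : [:: M.-1] <<< P ++ E ++ Ya ++ Yd.
    by apply: (@allrel_gew (M * tau).-1); [liac|ar].
  atoms; split; rewrite ?allrel_catl ?allrel_catr -?(allrel_permr _ _ pL) -?(allrel_perml _ _ pL);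
    by ar.
have lo' : [:: M.-1] <<< P ++ E ++ Ya ++ Yd.
  by apply: (@allrel_gew (M * tau).-1); [liac|ar].
atoms; split.
  (* [E] and [U] have together [kap] elements, [Wp] has at most one of each operation, and the [x]
     in [Xp] are not counted. *)
  have := zblocks_cons (blk := rev E ++ rev (Xp ++ Wp) ++ U) zb _; rewrite -!catA.
  apply=> al al0; rewrite !(count_cat, count_rev, rev_cat) (count_X (X := Xp)) //.
  have c1 := count_alt al aWp; have c2 := count_size (fun v => v %/ M == al) E.
  have c3 := count_size (fun v => v %/ M == al) U.
  have := perm_size pC; rewrite size_cat sP sC => c4.
  move: c1 c2 c3 c4; rewrite sU.
  by move: (count _ Wp) (count _ E) (count _ U) (size E) => x y z w; liac.
case: xp => Xi [rest [w iXi xXi]]; exists Xi, (rev Xp ++ rest); split=> //.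
rewrite rev_cat !filter_cat !filter_rev (filterX (X := Xp)) // (filterY (Y := E)) // (filterY (Y := Wp)) // (filterY (Y := U)) //=.
apply: invert_trans (invert_catl (rev Xp) w) _; rewrite !catA; apply/invert_catr/invert_pass.
rewrite allrel_revl; have pX := invert_perm w.
apply: (allrel_sub (A := Xp) (B := Z)) => // v vXi.
have : v \in seq.filter isX Z by rewrite (perm_mem pX) mem_cat vXi.
by rewrite mem_filter => /andP[].
Qed.

Lemma lshape_rcons Ls sh c : lshape Ls = sh ++ [:: c] -> exists Ls0 C,
  [/\ Ls = Ls0 ++ [:: (c.1, C)], size C = c.2 & lshape Ls0 = sh].
Proof.
case/lastP: Ls => [|Ls [t C]]; first by case: sh.
rewrite /lshape map_rcons cats1 => /rcons_inj[e1 <-].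
by exists Ls, C; rewrite cats1.
Qed.

Lemma flat_cat Ls Ls' : flat (Ls ++ Ls') = flat Ls ++ flat Ls'.
Proof. by rewrite /flat map_cat flatten_cat. Qed.

Lemma flat1 L : flat [:: L] = L.2. Proof. by rewrite /flat /= cats0. Qed.

Lemma lev_ok_last Ls C T : lev_ok (Ls ++ [:: (false, C)]) -> {subset T <= C} ->
  inc (rev T) -> lev_ok (Ls ++ [:: (true, T)]).
Proof.
move=> + TC iT; elim: Ls => [|L Ls IH] /=; first by rewrite iT allrel0r.
move=> /andP[+ /IH ->]; rewrite andbT; case: L.1 => // /andP[-> /=].
rewrite !flat_cat !flat1 !allrel_catr => /andP[-> /=] h.
exact: allrel_sub h _ TC.
Qed.

(** [burstL] needs the elements between [C] and the cut to lie above [C], but the buffer left by a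
    unit operation lies below what that operation appended to the accumulators. So operation [tau]
    first replaces the buffer by fresh elements, and operation [tau.+1] is the burst. *)
Lemma burst_op tau t xi s sh n V l r fr : 0 < tau -> B + b + V <= M ->
  kap * V.+1 <= n -> engine_state tau t xi (s + V) (sh ++ [:: (false, n)]) l r
    (iota (M * tau) kap ++ iota (M * tau.+1) (B + (b + V)) ++ fr) ->
  exists l' r', reach2 l r l' r' /\
    engine_state tau.+2 t.+2 (xi + V) s (sh ++ [:: (true, n - 2 * b)]) l' r' fr.
Proof.
move=> t0 MV nV [X [D0 [Ls [U [Z [[-> ->] [sU sX iX eL] ok [Xo hi XM lo] [zb xp]]]]]]].
have [Ls0 [C [e sC sh0]]] := lshape_rcons eL; rewrite /= in sC; subst Ls.
rewrite flat_cat flat1 [(_, _).2]/= in Xo hi lo *.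
have Mt0 : 0 < M * tau by rewrite muln_gt0 M_gt0.
have Mt1 : 0 < M * tau.+1 by rewrite muln_gt0 M_gt0.
have MMt : M <= M * tau by rewrite leq_pmulr.
have Mk : kap <= M by move: M_big; liac.
have kapb := buf_le.
have nk : kap <= n by apply: leq_trans nV; rewrite leq_pmulr.
have /split_end[X' [Xv [eX sXv]]] : V <= size X by liac.
have hiX : X <<< [:: M * tau] by apply: allrel_lew MMt _.
rewrite (iotaD _ B) (iotaD _ b); set Cf := iota _ kap; set C0 := iota _ B; set Ub := iota _ b; set Wv := iota _ V.
have [sCf sC0 sUb sWv] : [/\ size Cf = kap, size C0 = B, size Ub = b & size Wv = V].
  by rewrite !size_iota.
have iCf : inc Cf by apply: inc_iota.
have iN : inc (C0 ++ Ub ++ Wv) by rewrite -!iotaD; apply: inc_iota.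
have loC : [:: (M * tau).-1] <<< Cf by apply: iota_lo.
have hiC : Cf <<< [:: M * tau.+1] by apply: iota_hi; rewrite mulnS; liac.
have loN : [:: (M * tau.+1).-1] <<< C0 ++ Ub ++ Wv by rewrite -!iotaD; apply: iota_lo.
have hiN : C0 ++ Ub ++ Wv <<< [:: M * tau.+2].
  by rewrite -!iotaD; apply: iota_hi; rewrite (mulnS _ tau.+1); liac.
clearbody Cf C0 Ub Wv.
have AC : X ++ D0 ++ flat Ls0 ++ C ++ U ++ Z <<< Cf.
  by atoms; apply: (lt_sep Mt0); ar.
have Mtt : M * tau <= M * tau.+1 by rewrite leq_mul2l leqnSn orbT.
have Mttt : M * tau.+1 <= M * tau.+2 by rewrite leq_mul2l leqnSn orbT.
have hA : X ++ D0 ++ flat Ls0 ++ C ++ U ++ Z <<< [:: M * tau.+1].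
  by apply: (allrel_lew Mtt); atoms; ar.
have hA' : X ++ D0 ++ flat Ls0 ++ C ++ U ++ Z ++ Cf <<< [:: M * tau.+2].
  by apply: (allrel_lew Mttt); atoms; ar.
have AN : X ++ D0 ++ flat Ls0 ++ C ++ U ++ Z ++ Cf <<< C0 ++ Ub ++ Wv.
  by apply: (lt_sep Mt1) => //; atoms; ar.
have iC : inc C.
  by move: ok; elim: (Ls0) => [|L Ls IH] /= /andP[] // iC _.
subst X; atoms.
have lo' : [:: M.-1] <<< Cf ++ C0 ++ Ub ++ Wv.
  rewrite allrel_catr; apply/andP; split.
    by apply: (@allrel_gew (M * tau).-1) => //; liac.
  by apply: (@allrel_gew (M * tau.+1).-1); [liac|ar].
atoms.
have := @roundR nat ltn ltn_trans ltnn k k_gt0 (C0 ++ Ub ++ Wv ++ fr) [::] Cf Z U [::]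
  (X' ++ Xv ++ D0 ++ flat Ls0 ++ C).
case=> //; rewrite ?sCf ?allrel0l ?allrel0r //.
move=> Pf [E [iP sP iE pC h1]].
perml pC.
have [P2 [E2 [iP2 sP2 iE2 p2 h4]]] :
  exists P E0 : seq nat, [/\ inc P, size P = b, inc E0, perm_eq C (P ++ E0) &
  reach2 ((X' ++ D0 ++ flat Ls0) ++ Xv ++ C ++ rev Pf) (Ub ++ Wv ++ rev C0 ++ rev E ++ U ++ Z ++ fr)
       ((X' ++ D0 ++ flat Ls0) ++ rev Pf ++ Ub ++ Wv ++ rev E0) (rev P ++ Xv ++ rev C0 ++ rev E ++ U ++ Z ++ fr)].
  by apply: (burstL ltn_trans ltnn) => //; rewrite ?sXv ?sC; ar.
perml p2; rewrite (_ : rev [::] = [::]) // in h1.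
have sE2 : size E2 = n - b by rewrite -sC (perm_size p2) size_cat sP2 addKn.
(* [b] elements of the accumulator went right in [P2]; the [b] least of the others, which lie next
   to the cut, become the buffer. The thread keeps [n - 2 * b]. *)
have /split_start[Ur [Tr [eE sUr]]] : b <= size E2 by rewrite sE2; liac.
subst E2; rewrite !rev_cat in h4; atoms.
set l' := X' ++ (D0 ++ rev Pf ++ Ub ++ Wv) ++ flat (Ls0 ++ [:: (true, rev Tr)]) ++ rev Ur.
set Z' := (rev P2 ++ Xv ++ rev C0) ++ (rev E ++ U) ++ Z.
exists l', (Z' ++ fr); split.
  rewrite /l' /Z' flat_cat flat1 [(_, _).2]/= -!catA.
  nx h1.
  have h2 := @bringR nat ltn ltn_trans k k_gt0 (Ub ++ Wv) C0 (rev E ++ U ++ Z) fr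
    (X' ++ Xv ++ D0 ++ flat Ls0 ++ C ++ rev Pf).
  nx h2.
  have h3 := @reach2_freeL _ ltn k (X' ++ Xv ++ D0 ++ flat Ls0) (X' ++ D0 ++ flat Ls0 ++ Xv) (C ++ rev Pf)
    (Ub ++ Wv ++ rev C0 ++ rev E ++ U ++ Z ++ fr).
  nx h3.
  - apply: invert_catl; have w4 := @invert_pass _ ltn Xv (D0 ++ flat Ls0); rewrite -!catA in w4.
    by apply: w4; ar.
  nx h4.
  have h5 := @reach2_freeL _ ltn k (X' ++ D0 ++ flat Ls0 ++ rev Pf ++ Ub ++ Wv)
    (X' ++ D0 ++ rev Pf ++ Ub ++ Wv ++ flat Ls0) (rev Tr ++ rev Ur)
    (rev P2 ++ Xv ++ rev C0 ++ rev E ++ U ++ Z ++ fr).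
  fin h5.
  - do 2! apply: invert_catl; have w4 := @invert_pass _ ltn (flat Ls0) (rev Pf ++ Ub ++ Wv).
    by rewrite -!catA in w4; apply: w4; ar.
exists X', (D0 ++ rev Pf ++ Ub ++ Wv), (Ls0 ++ [:: (true, rev Tr)]), (rev Ur), Z'.
have sTr : size Tr = n - 2 * b by rewrite mul2n -addnn subnDA -sE2 size_cat sUr addKn.
split=> //.
- split=> //; first by rewrite size_rev.
    by move: sX; rewrite size_cat sXv; liac.
  by rewrite /lshape map_cat /= size_rev sTr; congr (_ ++ _).
- apply: (lev_ok_last ok); rewrite ?revK // => v.
  by rewrite (perm_mem p2) !mem_cat mem_rev => ->; rewrite !orbT.
- rewrite /Z' flat_cat flat1 [(_, _).2]/=; split; ar.
have lP2 : [:: M.-1] <<< P2 by [].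
split.
  apply: zblocks_cons; last first.
    move=> al al0; rewrite !(count_cat, count_rev) (count_X (X := Xv)) //.
    have := count_size (fun v => v %/ M == al) P2; rewrite sP2.
    have := count_size (fun v => v %/ M == al) C0; rewrite sC0.
    move: kapb; move: (count _ P2) (count _ C0) => x y; clear; lia.
  apply: zblocks_cons => // al al0; rewrite !(count_cat, count_rev).
  have := count_size (fun v => v %/ M == al) E.
  have := count_size (fun v => v %/ M == al) U; rewrite sU.
  have := perm_size pC; rewrite size_cat sP sCf.
  move: (count _ E) (count _ U) (size E) => x y z; clear; lia.
case: xp => Xi [rest [w iXi xXi]]; exists (Xv ++ Xi), rest; split.
- rewrite /Z' !filter_cat !filter_rev (filterX (X := Xv)) // (filterY (Y := P2)) //.
  rewrite (filterY (Y := C0)) // (filterY (Y := E)) // (filterY (Y := U)) // /= -!catA.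
  exact: invert_catl w.
- ar; have pX := invert_perm w.
  apply: (allrel_sub (A := Xv) (B := Z)) => // v vXi.
  have : v \in seq.filter isX Z by rewrite (perm_mem pX) mem_cat vXi.
  by rewrite mem_filter => /andP[].
- by rewrite size_cat sXv (addnC xi) leq_add2l.
Qed.

Fixpoint segments tau (lens : seq nat) := if lens is n :: lens' then
  iota (M * tau) n ++ segments tau.+1 lens' else [::].

Lemma segments_cat tau l1 l2 : segments tau (l1 ++ l2) = segments tau l1 ++ segments (tau + size l1) l2.
Proof.
elim: l1 tau => [|n l1 IH] tau /=; first by rewrite addn0.
by rewrite IH -catA addnS.
Qed.

(* The schedule of depth [j.+1] is: depth [j] while filling a new accumulator, a flush that
   renews the buffer, a burst turning the accumulator into a thread and carrying [2 ^ j] of the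
   [x] to the right, and depth [j] again, which empties the thread. *)
Fixpoint lens j := if j is j'.+1 then
  lens j' ++ [:: kap; B + (b + 2 ^ j')] ++ lens j' else nseq (2 * kap) (kap + p).

Fixpoint x_cost j := if j is j'.+1 then x_cost j' + (2 ^ j' + x_cost j') else 2 * kap * p.
Fixpoint chain_size j := if j is j'.+1 then chain_size j' + 2 ^ j' + chain_size j' else 0.
Definition unit_count j := 2 * kap * 2 ^ j.

Lemma upd_upd m n c : upd m (upd n c) = upd (n + m) c.
Proof. by case: c => [] [] x; rewrite /upd /= ?subnDA ?addnA. Qed.

Lemma engine_open tau t xi s sh l r fr : engine_state tau t xi s sh l r fr ->
  engine_state tau t xi s (sh ++ [:: (false, 0)]) l r fr.
Proof.
move=> [X [D0 [Ls [U [Z [[-> ->] [sU sX iX eL] ok [Xo hi XM lo] zx]]]]]].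
exists X, D0, (Ls ++ [:: (false, [::])]), U, Z.
have fE : flat (Ls ++ [:: (false, [::])]) = flat Ls by rewrite flat_cat flat1 cats0.
rewrite fE; split=> //; first by rewrite /lshape map_cat -eL.
elim: Ls ok {eL Xo hi lo} fE => [|L Ls IH] //= /andP[h /IH {}IH] _.
have fE : flat (Ls ++ [:: (false, [::])]) = flat Ls by rewrite flat_cat flat1 cats0.
by rewrite fE h IH.
Qed.

Lemma engine_close tau t xi s sh l r fr : engine_state tau t xi s (sh ++ [:: (true, 0)]) l r fr ->
  engine_state tau t xi s sh l r fr.
Proof.
move=> [X [D0 [Ls [U [Z [[-> ->] [sU sX iX eL] ok [Xo hi XM lo] zx]]]]]].
have [Ls0 [C [e /size0nil eC sh0]]] := lshape_rcons eL; subst Ls C.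
exists X, D0, Ls0, U, Z.
have fE Ls : flat (Ls ++ [:: (true, [::])]) = flat Ls by rewrite flat_cat flat1 cats0.
rewrite fE in Xo hi lo *; split=> //.
elim: Ls0 ok {eL Xo hi lo sh0} => [|L Ls IH] //= /andP[h /IH ->].
by rewrite fE in h; rewrite h.
Qed.

Lemma engine j : forall tau t xi s sh l r fr, 0 < tau -> size sh + j <= p ->
  engine_state tau t xi (s + x_cost j) sh l r (segments tau (lens j) ++ fr) ->
  exists l' r', reach2 l r l' r' /\ engine_state (tau + size (lens j)) (t + size (lens j))
    (xi + chain_size j) s (map (upd (unit_count j)) sh) l' r' fr.
Proof.
elim: j => [|j IH] tau t xi s sh l r fr t0 shp.
  rewrite /= /unit_count muln1 size_nseq addn0.
  elim: (2 * kap) tau t s sh l r t0 shp => [|n IHn] tau t s sh l r t0 shp /=.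
    rewrite mul0n !addn0 => g; exists l, r; split; first exact: reach2_refl.
    by rewrite (_ : map _ _ = sh) // -[RHS]map_id; apply: eq_map => -[[] c]; rewrite /upd /= ?subn0 ?addn0.
  rewrite mulSn (addnC p) addnA -catA => /(unit_op t0 _) [|l1 [r1 [h1 g1]]]; first by rewrite addn0 in shp.
  have [||l2 [r2 [h2 g2]]] := IHn _ _ _ _ _ _ _ _ g1; [by []|by rewrite size_map|].
  exists l2, r2; split; first exact: reach2_trans h1 h2.
  rewrite !addnS -!addSn; rewrite -map_comp in g2.
  by rewrite (eq_map (g := upd n.+1)) in g2 => // c /=; rewrite upd_upd add1n.
set n := size (lens j).
have -> : segments tau (lens j.+1) ++ fr = segments tau (lens j) ++ iota (M * (tau + n)) kap ++
    iota (M * (tau + n).+1) (B + (b + 2 ^ j)) ++ segments (tau + n).+2 (lens j) ++ fr.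
  rewrite [lens _.+1]/= -[kap :: _]/([:: kap; B + (b + 2 ^ j)] ++ lens j).
  by rewrite segments_cat segments_cat /= cats0 -!catA -/n addn2.
have -> : size (lens j.+1) = n + 2 + n by rewrite [lens _.+1]/= size_cat /= -/n; lia.
have -> : s + x_cost j.+1 = s + x_cost j + 2 ^ j + x_cost j by rewrite /=; lia.
move=> /engine_open g0.
have [|l1 [r1 [h1 g1]]] := IH _ _ _ _ _ _ _ _ t0 _ g0.
  by rewrite size_cat /=; lia.
rewrite map_cat [map _ [:: _]]/= [upd _ (false, 0)]/upd /= add0n -/n in g1.
(* The factor [2] in the [2 * kap] rounds of depth [0] is chosen for this: it covers the [+ 1] in
   the price of a burst. *)
have cnd : kap * (2 ^ j).+1 <= unit_count j.
  rewrite /unit_count (mulnC 2) -mulnA leq_mul2l; have : 0 < 2 ^ j by rewrite expn_gt0.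
  by case: (2 ^ j) => // x _; lia.
have MV : B + b + 2 ^ j <= M.
  apply: leq_trans M_big; have : 2 ^ j <= 2 ^ p by rewrite leq_exp2l //; lia.
  by rewrite /buf; lia.
have [|l2 [r2 [h2 g2]]] := burst_op _ MV cnd g1; first by rewrite addn_gt0 t0.
have [||l3 [r3 [h3 g3]]] := IH _ _ _ _ _ _ _ _ _ _ g2; first by [].
  by rewrite size_cat size_map /=; lia.
exists l3, r3; split; first exact: reach2_trans h1 (reach2_trans h2 h3).
rewrite map_cat [map _ [:: _]]/= [upd _ (true, _)]/upd /= in g3.
(* Truncated subtraction: the second half of the schedule has more rounds than the thread has
   elements, and an empty thread pops nothing. *)
have e0 : unit_count j - 2 * b - unit_count j = 0 by lia.
rewrite e0 -map_comp in g3; move/engine_close: g3.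
have e1 : map (upd (unit_count j) \o upd (unit_count j)) sh = map (upd (unit_count j.+1)) sh.
  apply: eq_map => c /=; rewrite upd_upd; congr (upd _ _).
  by rewrite /unit_count expnS; lia.
rewrite e1; congr (engine_state _ _ _ _ _ _ _ _); rewrite /= -?/n; lia.
Qed.

End Engine.

(** * Clearing and sorting the two halves *)

Section Finish.
Variables (k : nat).
Hypothesis k_gt0 : 0 < k.
Local Notation inc := (pairwise ltn).
Local Notation invert := (invert ltn).
Local Notation reach2 := (reach2 ltn k).
Local Notation reach := (reach ltn k).
Local Notation B := (bring_size k k).
Local Notation b := (buf k).
Local Notation kap := (round_size k).

Lemma allrel_lt (A C : seq nat) x y : A <<< C -> x \in A -> y \in C -> x < y.
Proof. by move=> /allrelP; apply. Qed.

Lemma invert_partition (P : pred nat) s :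
  pairwise (fun e e' => ~~ P e && P e' ==> (e < e')) s ->
  invert s (seq.filter P s ++ seq.filter (predC P) s).
Proof.
elim: s => [|e s IH] /=; first by move=> _; apply: invert_refl.
move=> /andP[h /IH w]; have w1 := invert_catl [:: e] w; case: ifP => Pe //=.
apply: invert_trans w1 _; rewrite -cat1s -[e :: seq.filter _ _]cat1s !catA.
apply/invert_catr/invert_pass; rewrite allrel1l all_filter.
by apply: sub_all h => x; rewrite Pe.
Qed.

(** A rank that grows strictly from an element to any later smaller one is constant only along
    increasing lists, so its level sets are the layers. An element of higher rank is smaller than
    every later one of lower rank and may pass it. *)
Lemma layer_sort (f : nat -> nat) R s :
  pairwise (fun e e' => ((e' < e) ==> (f e < f e')) && (e != e')) s ->
  all (fun e => f e < R) s -> exists Ws, [/\ size Ws = R, all inc Ws & invert s (flatten Ws)].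
Proof.
elim: R s => [|R IH] s h fR.
  exists [::]; split=> //; by case: s fR {h} => //= _; apply: invert_refl.
have w : invert s (seq.filter (fun e => f e < R) s ++ seq.filter (predC (fun e => f e < R)) s).
  apply: invert_partition; apply: sub_pairwise h => e e' /=; lia.
have [||Ws [sW iW w']] := IH [seq e <- s | f e < R].
- exact: pairwise_filter.
- by apply/allP => x; rewrite mem_filter => /andP[].
exists (Ws ++ [:: seq.filter (predC (fun e => f e < R)) s]); split.
- by rewrite size_cat sW addn1.
- rewrite all_cat iW /= andbT.
  have h' := pairwise_filter (predC (fun e => f e < R)) h.
  apply: (sub_in_pairwise (P := fun e => f e == R)) h'.
    by move=> e e'; rewrite !unfold_in /= => /eqP -> /eqP ->; lia.
  by apply/allP => x; rewrite mem_filter /= => /andP[h1 /(allP fR)]; lia.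
- rewrite flatten_cat /= cats0; apply: invert_trans w _; exact: invert_catr.
Qed.

Lemma inc_sort s : uniq s -> inc (sort leq s).
Proof.
move=> u; rewrite -sorted_pairwise; last exact: ltn_trans.
by rewrite ltn_sorted_uniq_leq sort_uniq u sort_sorted //; apply: leq_total.
Qed.

Lemma invert_sortn s : uniq s -> invert s (rev (sort leq s)).
Proof.
move=> u; apply: invert_sort_to (inc_sort u).
by rewrite perm_sym perm_sort.
Qed.

Section Layers.
Variable M : nat.
Hypothesis M_gt0 : 0 < M.

(* [f e] counts, up to the factor [K], the operations after the one that introduced [e] and the
   blocks before the one containing [e]: both can only grow from [e] to a later smaller [e']. *)
Lemma layer_rank A K bs : uniq (flatten bs) -> all (fun e => e %/ M <= A) (flatten bs) ->
  (forall blk, blk \in bs -> forall al, 0 < al -> count (fun v => v %/ M == al) blk <= K) ->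
  exists f, (forall e, e \in flatten bs -> M <= e ->
      K * (A - e %/ M) <= f e < K * (A - e %/ M + size bs)) /\
    pairwise (fun e e' => (e' < e) ==> (f e < f e')) (seq.filter (predC (isX M)) (flatten bs)).
Proof.
elim: bs => [|blk bs IH]; first by move=> _ _ _; exists id.
rewrite [flatten _]/= cat_uniq all_cat => /and3P[ub /hasPn nb us] /andP[Ab As] hc.
have [c h|f [f1 f2]] := IH us As; first by apply: hc; rewrite inE h orbT.
have hb := hc blk (mem_head _ _).
(* This breaks ties inside one block and one operation. It stays below [K] because [e] does not
   count itself. *)
pose cnt e := count (fun v => (v %/ M == e %/ M) && (e < v)) blk.
exists (fun e => if e \in blk then K * (A - e %/ M) + cnt e else K + f e).
have aM e : M <= e -> 0 < e %/ M by move=> h; rewrite divn_gt0.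
have cK e : e \in blk -> M <= e -> cnt e < K.
  move=> eb eM; apply: leq_trans (hb _ (aM _ eM)).
  rewrite /cnt -(cat_take_drop (index e blk) blk) (drop_nth 0) ?index_mem //.
  rewrite nth_index // !count_cat /= ltnn eqxx andbF add0n addnCA add1n ltnS leq_add //;
  by apply: sub_count => v /andP[].
have bnd e : e \in blk ++ flatten bs -> M <= e ->
   K * (A - e %/ M) <= (if e \in blk then K * (A - e %/ M) + cnt e else K + f e) <
   K * (A - e %/ M + (size bs).+1).
  rewrite mem_cat; case: ifP => eb /= es eM.
    by rewrite leq_addr /= mulnDr ltn_add2l; apply: leq_trans (cK _ eb eM) _; rewrite leq_pmulr.
  have /andP[h1 h2] := f1 _ es eM.
  rewrite (leq_trans h1 (leq_addl _ _)) /= addnS mulnS ltn_add2l.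
  exact: h2.
split; first by move=> e; apply: bnd.
rewrite filter_cat pairwise_cat; apply/and3P; split.
- apply/allrelP => e e'; rewrite !mem_filter /= /isX -!leqNgt => /andP[eM eb] /andP[eM' es].
  have -> : e' \in blk = false by apply/negbTE/nb.
  rewrite eb; apply/implyP => ee; have /andP[h1 _] := f1 _ es eM'.
  apply: (@leq_trans (K * (A - e %/ M) + K)); first by rewrite ltn_add2l cK.
  rewrite addnC leq_add2l; apply: leq_trans _ h1.
  by rewrite leq_mul2l leq_sub2l ?orbT // leq_div2r // ltnW.
- have pT (s : seq nat) : pairwise (fun _ _ => true) s.
    by elim: s => //= x s ->; rewrite all_predT.
  apply: (sub_in_pairwise (P := mem (seq.filter (predC (isX M)) blk)) _ _ (pT _)).
  + move=> e e'; rewrite !mem_filter /= /isX -!leqNgt.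
    move=> /andP[eM eb] /andP[eM' eb'] _; rewrite eb eb'; apply/implyP => ee.
    have := leq_div2r M (ltnW ee); rewrite leq_eqVlt => /orP[/eqP e1|lt1].
      rewrite e1 ltn_add2l /cnt e1.
      rewrite -(cat_take_drop (index e blk) blk) (drop_nth 0) ?index_mem //.
      rewrite nth_index // !count_cat /= ltnn ee eqxx /= add0n add1n addnS ltnS.
      by apply: leq_add; apply: sub_count => v /andP[-> /(ltn_trans ee)].
    have eA := allP Ab _ eb; have c := cK _ eb eM.
    apply: (@leq_trans (K * (A - e %/ M) + K)); first by rewrite ltn_add2l.
    by apply: leq_trans (leq_addr _ _); rewrite -mulnSr leq_mul2l; apply/orP; right; move: lt1 eA; clear; lia.
  + by apply/allP.
- apply: (sub_in_pairwise (P := mem (flatten bs))) f2.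
  + move=> e e' es es' /= h; apply/implyP => /(implyP h).
    by rewrite (negbTE (nb _ es)) (negbTE (nb _ es')) ltn_add2l.
  + by apply/allP => e; rewrite mem_filter => /andP[].
Qed.

Lemma layers tau t Z : zblocks k M t Z -> uniq Z -> Z <<< [:: M * tau] ->
  exists Ws, [/\ size Ws = kap.+1 * (tau + t), all inc Ws &
    invert (seq.filter (predC (isX M)) Z) (flatten Ws)].
Proof.
move=> [bs [-> sbs hb]] u hi.
have Atau : all (fun e => e %/ M <= tau) (flatten bs).
  apply/allP => e es; apply: ltnW; rewrite ltn_divLR // mulnC.
  by move/allrelP: hi; apply; rewrite ?inE.
have [f [f1 f2]] := layer_rank u Atau hb.
apply: (@layer_sort f).
  by rewrite pairwise_relI f2 -uniq_pairwise filter_uniq.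
apply/allP => e; rewrite mem_filter /= /isX -leqNgt => /andP[eM es].
have /andP[_ h] := f1 _ es eM; apply: leq_trans h _.
by rewrite leq_mul2l sbs leq_add2r leq_subr orbT.
Qed.
End Layers.

(* Each increasing layer of misplaced [y] is removed from the right half by one round. *)
Lemma clear_rounds Ws : forall W X S U be, inc W -> all inc Ws -> size U = b -> inc X ->
  X <<< S ++ U ++ W ++ flatten Ws ->
  kap * (size Ws).+1 + size (W ++ flatten Ws) <= size X ->
  exists X' Xt Sd E U' Xd,
   [/\ X = X' ++ Xt /\ size Xt = kap * (size Ws).+1 + size (W ++ flatten Ws),
     reach2 (X ++ S) (U ++ W ++ flatten Ws ++ be) (X' ++ Sd ++ rev E) (U' ++ Xd ++ be),
     perm_eq (Xt ++ S ++ U ++ W ++ flatten Ws) (Sd ++ E ++ U' ++ Xd),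
     size Xd = size (W ++ flatten Ws) /\ size U' = b
     & (inc E /\ size E = kap - b) /\ {subset E ++ U' ++ Xd <= Xt}].
Proof.
elim: Ws => [|W2 Ws IH] W X S U be iW iWs sU iX XS sX.
  have /split_end[X1 [C [eX sC]]] : kap <= size X by move: sX; rewrite muln1 /=; liac.
  have /split_end[X2 [Xq [eX1 sXq]]] : size W <= size X1.
    by move: sX; rewrite eX !size_cat sC muln1 /=; liac.
  subst X X1; rewrite cats0 in XS *; atoms.
  have := @roundL nat ltn ltn_trans ltnn k k_gt0 X2 Xq C S U W be.
  case=> //; rewrite ?sC //; try by ar.
  move=> P [E [iP sP iE p h]].
  exists X2, (Xq ++ C), (S ++ U ++ rev W), E, (rev P), (rev Xq).
  split.
  - by split; rewrite ?catA // size_cat sC sXq muln1 /=; liac.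
  - by norm h; ng.
  - by pm.
  - by rewrite !size_rev sP.
  - split; first by split=> //; rewrite -sC (perm_size p) size_cat sP addKn.
    move=> v; rewrite !mem_cat !mem_rev (perm_mem p) mem_cat.
    by case: (v \in E); case: (v \in P); case: (v \in Xq).
rewrite /= in iWs sX XS *; case/andP: iWs => iW2 iWs.
have /split_end[X1 [C [eX sC]]] : kap <= size X by move: sX; rewrite mulnS; liac.
have /split_end[X2 [Xq [eX1 sXq]]] : size W <= size X1.
  by move: sX; rewrite mulnS eX !size_cat sC; liac.
subst X X1; atoms.
have [P [E [iP sP iE p h1]]] : exists P E : seq nat, [/\ inc P, size P = b, inc E,
   perm_eq C (P ++ E) & reach2 (X2 ++ Xq ++ C ++ S) (U ++ W ++ W2 ++ flatten Ws ++ be)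
     (X2 ++ S ++ U ++ rev W ++ rev E) (rev P ++ rev Xq ++ W2 ++ flatten Ws ++ be)].
  by apply: (roundL ltn_trans ltnn) => //; rewrite ?sC //; ar.
perml p.
have [||||||X' [Xt [Sd [E' [U' [Xd [[eX sXt] h3 pe [sXd sU'] [iE' sub]]]]]]]] :=
  IH W2 X2 (S ++ U ++ rev W ++ rev E) (rev P) (rev Xq ++ be).
- by [].
- by [].
- by rewrite size_rev.
- by [].
- by ar.
- by move: sX; rewrite !size_cat !mulnS sC sXq; liac.
exists X', (Xt ++ Xq ++ C), Sd, E', U', (Xd ++ rev Xq).
split.
- split; first by rewrite eX -!catA.
  by move: sXt; rewrite !size_cat sC sXq !mulnS; liac.
- nx h1.
  have h2 := @reach2_freeR _ ltn k (rev Xq ++ W2 ++ flatten Ws ++ be) (W2 ++ flatten Ws ++ rev Xq ++ be)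
    (rev P) (X2 ++ S ++ U ++ rev W ++ rev E).
  nx h2.
  + have w := @invert_passr _ ltn (rev Xq) (W2 ++ flatten Ws) be; rewrite -!catA in w.
    by apply: w; ar.
  + by rewrite size_rev sP /buf; liac.
  by norm h3; ng.
- by pm.
- by move: sXd; rewrite !size_cat size_rev sXq; liac.
- split=> // v; rewrite !mem_cat mem_rev => h.
  have := sub v; rewrite !mem_cat => sv.
  case/orP: h => [h|/orP[h|/orP[h|->]]]; rewrite ?orbT //; rewrite sv ?h ?orbT //.
Qed.

(* The run [X ++ P ++ C4 ++ Fr] exchanges all remaining [x] of the left half with all remaining
   [y] of the right half. *)
Lemma finish_sort X Sy Y P Q C3 C4 C5 X8 rest Fr :
  size P = b -> B <= size Y -> k <= size Q -> k <= size Sy -> size Fr = size X + b ->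
  B <= size C3 -> size C4 = k.+1 -> B <= size C5 -> k <= size X8 ->
  uniq Sy -> uniq (X ++ P ++ Q ++ C3 ++ C4 ++ C5 ++ X8 ++ rest) ->
  inc X -> inc P -> inc (C3 ++ C4 ++ C5 ++ X8) -> inc (Y ++ Fr) -> X <<< P ->
  X ++ P ++ Q <<< C3 ++ C4 ++ C5 ++ X8 -> Sy <<< Y ++ Fr ->
  X ++ P ++ Q ++ C3 ++ C4 ++ C5 ++ X8 ++ rest <<< Sy ++ Y ++ Fr ->
  exists G lf rf, [/\ inc G, lf ++ rf = rev G &
    reach2 (X ++ Sy ++ Y ++ P) (Q ++ C3 ++ C4 ++ C5 ++ X8 ++ rest ++ Fr) lf rf].
Proof.
move=> sP sY sQ sSy sFr sC3 sC4 sC5 sX8 uSy uX iX iP iC iY XP AC SyY Ay.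
have uT : uniq (X8 ++ rest) by move: uX; do 6 (rewrite cat_uniq; case/and3P => _ _).
set F := rev C4 ++ rev P ++ rev X ++ rev C3 ++ Q.
have FD : F ++ C5 <<< X8 by rewrite /F; atoms; ar.
have [T2 [Dk [eT sDk]]] : exists A B, sort leq (X8 ++ rest) = A ++ B /\ size B = k.
  by apply: split_end; rewrite size_sort size_cat (leq_trans sX8) ?leq_addr.
have iT := inc_sort uT; rewrite eT in iT.
have pT : perm_eq (X8 ++ rest) (T2 ++ Dk) by rewrite -eT perm_sym perm_sort.
(* If some [d] in [Dk] were at most an element of [F ++ C5], all of [X8] would lie above [d]; but
   fewer than [k] elements exceed a member of the top [k]. *)
have FDk : F ++ C5 <<< Dk.
  apply/allrelP => x d xF dD; change (x < d); rewrite ltnNge; apply/negP => dx.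
  have : count (fun v => d < v) (X8 ++ rest) < k.
    rewrite (permP pT) count_cat -sDk (_ : count _ T2 = 0).
      rewrite add0n -(count_predC (fun v => d < v) Dk) -[X in X < _]addn0 ltn_add2l.
      by rewrite -has_count; apply/hasP; exists d; rewrite //= ltnn.
    apply/eqP; rewrite -leqn0 leqNgt -has_count; apply/hasPn => v vT.
    by atoms; rewrite -leqNgt ltnW // (@allrel_lt T2 Dk).
  rewrite ltnNge count_cat => /negP; apply; apply: leq_trans (leq_addr _ _).
  apply: leq_trans sX8 _; rewrite -(eqP (_ : count (fun v => d < v) X8 == size X8)) //.
  by rewrite -all_count; apply/allP => v vX; apply: leq_ltn_trans dx (allrel_lt FD xF vX).
have [D1 [S1 [eS sD1]]] : exists A B, sort leq Sy = A ++ B /\ size A = k.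
  by apply: split_start; rewrite size_sort.
have wS := invert_sortn uSy; have iS := inc_sort uSy; rewrite eS in wS iS.
have pS := invert_perm wS.
perml pS.
have wT := invert_sortn uT; rewrite eT in wT.
pose Z := sort leq (C5 ++ F ++ T2).
have pF : perm_eq (C5 ++ F ++ T2 ++ Dk) (F ++ C5 ++ X8 ++ rest).
  by clear -pT; pm.
have uZ : uniq (C5 ++ F ++ T2).
  have : uniq (C5 ++ F ++ T2 ++ Dk).
    rewrite (perm_uniq pF) (perm_uniq (_ : perm_eq _ (X ++ P ++ Q ++ C3 ++ C4 ++ C5 ++ X8 ++ rest))) //.
    by rewrite /F; clear; pm.
  by rewrite !catA cat_uniq => /andP[].
have wZ := invert_sortn uZ; have iZ := inc_sort uZ.
have ZF : perm_eq (C5 ++ F ++ T2) (sort leq (C5 ++ F ++ T2)) by rewrite perm_sym perm_sort.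
exists (sort leq (C5 ++ F ++ T2) ++ Dk ++ D1 ++ S1 ++ Y ++ Fr).
exists (rev Fr ++ rev Y ++ rev S1 ++ rev D1), (rev Dk ++ rev (sort leq (C5 ++ F ++ T2))).
have hT : T2 ++ Dk <<< Sy ++ Y ++ Fr.
  by rewrite -(allrel_perml _ _ pT); atoms; ar.
have hS : X ++ P ++ Q ++ C3 ++ C4 ++ C5 ++ X8 ++ rest ++ T2 ++ Dk <<< D1 ++ S1.
  rewrite -allrel_revr -(allrel_permr _ _ pS); atoms; ar.
have hS' : D1 ++ S1 <<< Y ++ Fr by rewrite -allrel_revl -(allrel_perml _ _ pS); ar.
clear pS wZ uZ pF uX Z; unfold F in *; clear F; atoms.
have hZ : sort leq (C5 ++ (rev C4 ++ rev P ++ rev X ++ rev C3 ++ Q) ++ T2) <<<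
    Dk ++ D1 ++ S1 ++ Y ++ Fr.
  by rewrite -(allrel_perml _ _ ZF); atoms; ar.
split.
- by atoms; ar.
- by rewrite !rev_cat -!catA.
rewrite !rev_cat in wS wT.
have h4 := @reach2_freeL _ ltn k (X ++ Sy ++ Y) (Sy ++ Y ++ X) P
  (Q ++ C3 ++ C4 ++ C5 ++ X8 ++ rest ++ Fr).
atoms; nx h4.
- by have w := @invert_pass _ ltn X (Sy ++ Y); rewrite -!catA in w; apply: w; ar.
- by rewrite sP /buf; liac.
have h5 := @reach2_freeR _ ltn k (C5 ++ X8 ++ rest ++ Fr) (Fr ++ C5 ++ X8 ++ rest) (Q ++ C3 ++ C4)
  (Sy ++ Y ++ X ++ P).
nx h5.
- by have w := @invert_pass _ ltn (C5 ++ X8 ++ rest) Fr; rewrite -!catA in w; apply: w; ar.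
have h6 := @bringR nat ltn ltn_trans k k_gt0 (C4 ++ Fr) C3 Q (C5 ++ X8 ++ rest) (Sy ++ Y ++ X ++ P).
nx h6.
have h7 := @reach2_cross nat ltn ltn_trans k k_gt0 (Sy ++ Y) (X ++ P) (C4 ++ Fr) (rev Fr)
  (rev C4 ++ rev P ++ rev X) (rev C3 ++ Q ++ C5 ++ X8 ++ rest).
nx h7.
have h8 := @reach2_freeL _ ltn k Sy (rev S1 ++ rev D1) (Y ++ rev Fr)
  (rev C4 ++ rev P ++ rev X ++ rev C3 ++ Q ++ C5 ++ X8 ++ rest).
nx h8.
- by rewrite size_cat size_rev sFr /buf; liac.
have h9 := @bringL nat ltn ltn_trans k k_gt0 (rev D1) Y (rev Fr) (rev S1)
  (rev C4 ++ rev P ++ rev X ++ rev C3 ++ Q ++ C5 ++ X8 ++ rest).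
nx h9.
have h10 := @reach2_freeL _ ltn k (rev S1 ++ rev Fr ++ rev Y) (rev Fr ++ rev Y ++ rev S1) (rev D1)
  (rev C4 ++ rev P ++ rev X ++ rev C3 ++ Q ++ C5 ++ X8 ++ rest).
nx h10.
- by have w := @invert_pass _ ltn (rev S1) (rev Fr ++ rev Y); rewrite -!catA in w; apply: w; ar.
have h11 := @reach2_freeR _ ltn k (X8 ++ rest) (rev Dk ++ rev T2)
  (rev C4 ++ rev P ++ rev X ++ rev C3 ++ Q ++ C5) (rev Fr ++ rev Y ++ rev S1 ++ rev D1).
nx h11.
have h12 := @bringR nat ltn ltn_trans k k_gt0 (rev Dk) C5 (rev C4 ++ rev P ++ rev X ++ rev C3 ++ Q)
  (rev T2) (rev Fr ++ rev Y ++ rev S1 ++ rev D1).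
nx h12.
have h13 := @reach2_freeR _ ltn k (rev C5 ++ rev C4 ++ rev P ++ rev X ++ rev C3 ++ Q ++ rev T2)
  (rev (sort leq (C5 ++ (rev C4 ++ rev P ++ rev X ++ rev C3 ++ Q) ++ T2))) (rev Dk) (rev Fr ++ rev Y ++ rev S1 ++ rev D1).
norm h13; ng; apply: h13; last by rewrite size_rev sDk.
rewrite -?catA in iZ ZF; apply: invert_sort_to iZ; apply: perm_trans ZF.
by clear; pm.
Qed.

(** The [x] in [W] are in no useful order, so they must leave by a burst. This is where the reserve
    [Xi] is spent: [kap * (size W).+1] of its elements pay for the burst, the others for the final
    crossing. *)
Lemma finish X Sy W U S Xi rest fr :
  size U = b -> B <= size W -> size X + b + size W = size fr ->
  kap * (size W).+1 + exch_size k b + B + k.+1 + B + k <= size Xi -> k <= size Sy ->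
  uniq Sy -> uniq (X ++ W ++ U ++ S ++ Xi ++ rest) ->
  inc X -> inc Xi -> inc fr -> X ++ W ++ U ++ S <<< Xi ->
  X ++ W ++ U ++ S ++ Xi ++ rest <<< Sy ++ fr -> Sy <<< fr -> k <= size S ->
  exists G lf rf, [/\ inc G, lf ++ rf = rev G &
    reach2 (X ++ Sy ++ W ++ U) (S ++ Xi ++ rest ++ fr) lf rf].
Proof.
move=> sU sWB sfr sXi sSy uSy uX iX iXi ifr AXi Xy Syf sS.
have /split_start[C1 [Xa [e1 sC1]]] : kap * (size W).+1 <= size Xi by liac.
have /split_start[C2 [Xb [e2 sC2]]] : exch_size k b <= size Xa by subst Xi; sz.
have /split_start[C3 [Xc [e3 sC3]]] : B <= size Xb by subst Xi Xa; sz.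
have /split_start[C4 [Xd [e4 sC4]]] : k.+1 <= size Xc by subst Xi Xa Xb; sz.
have /split_start[C5 [X8 [e5 sC5]]] : B <= size Xd by subst Xi Xa Xb Xc; sz.
have /split_start[Y [Fr [e6 sY]]] : size W <= size fr by liac.
have sX8 : k <= size X8 by subst Xi Xa Xb Xc Xd; sz.
have sFr : size Fr = size X + b by move: sfr; rewrite e6 size_cat sY; liac.
clear sXi sfr; subst Xi Xa Xb Xc Xd fr; atoms.
have [P1 [E1 [iP1 sP1 iE1 p1 h2]]] : exists P E : seq nat, [/\ inc P, size P = b, inc E,
   perm_eq C1 (P ++ E) &
   reach2 ((X ++ Sy) ++ W ++ U) (S ++ C1 ++ Y ++ C2 ++ C3 ++ C4 ++ C5 ++ X8 ++ rest ++ Fr)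
     ((X ++ Sy) ++ Y ++ rev P) (rev E ++ W ++ U ++ S ++ C2 ++ C3 ++ C4 ++ C5 ++ X8 ++ rest ++ Fr)].
  by apply: (burstR ltn_trans ltnn k_gt0 (V := size W)) => //; rewrite ?sC1 //; ar.
perml p1.
have [P2 [E2 [iP2 sP2 iE2 p2 h3]]] : exists P E : seq nat, [/\ inc P, size P = b, inc E,
   perm_eq C2 (P ++ E) &
   reach2 ((X ++ Sy ++ Y) ++ rev P1) ((rev E1 ++ W ++ U ++ S) ++ C2 ++ C3 ++ C4 ++ C5 ++ X8 ++ rest ++ Fr)
     ((X ++ Sy ++ Y) ++ P)
     (rev E ++ rev P1 ++ (rev E1 ++ W ++ U ++ S) ++ C3 ++ C4 ++ C5 ++ X8 ++ rest ++ Fr)].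
  by apply: (exchangeR ltn_trans ltnn k_gt0) => //; rewrite ?size_rev ?sC2 //; ar.
perml p2.
have [|||||||||||||||||||G [lf [rf [iG eG h4]]]] := @finish_sort X Sy Y P2
  (rev E2 ++ rev P1 ++ rev E1 ++ W ++ U ++ S) C3 C4 C5 X8 rest Fr; rewrite ?sC3 ?sC5 ?sY //;
  try by [ar | rewrite !size_cat; liac].
- move: uX; congr is_true; apply: perm_uniq; move: p1 p2; clear=> p1 p2; pm.
exists G, lf, rf; split=> //.
have h1 := @reach2_freeR _ ltn k (C2 ++ C3 ++ C4 ++ C5 ++ X8 ++ rest ++ Y ++ Fr)
  (Y ++ C2 ++ C3 ++ C4 ++ C5 ++ X8 ++ rest ++ Fr) (S ++ C1) (X ++ Sy ++ W ++ U).
nx h1.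
- have w := @invert_passr _ ltn (C2 ++ C3 ++ C4 ++ C5 ++ X8 ++ rest) Y Fr.
  by rewrite -!catA in w; apply: w; ar.
nx h2.
nx h3.
by norm h4.
Qed.
End Finish.

(** * Assembly of the phases into a full reversal *)

Section Main.
Variables (k L J M cc rem : nat).
Hypothesis k_gt0 : 0 < k.
Local Notation inc := (pairwise ltn).
Local Notation invert := (invert ltn).
Local Notation reach2 := (reach2 ltn k).
Local Notation reach := (reach ltn k).
Local Notation B := (bring_size k k).
Local Notation b := (buf k).
Local Notation kap := (round_size k).
Hypothesis M_big : kap + J + B + b + 2 ^ J <= M.
Local Notation ops := (size (lens k J J)).
(** The layer count [kap.+1 * (tau + t)] at [tau = 3 + ops] and [t = 2 + ops], plus one empty layer,
    since the clearing phase expects a first layer. *)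
Definition nrounds := ((kap.+1 * (2 * ops + 5)).+1).
Local Notation ny := (kap + sumn (lens k J J)).
Hypotheses (LM : L < M) (cc1 : cc <= 1).
Hypothesis Ly : L = ny + (B + (b + rem)).
Hypothesis Lx : b + x_cost k J J + (kap * nrounds + (ny + B)) <= L.
Hypothesis chain_big : kap * (kap * nrounds) + 2 * kap <= chain_size J.

Lemma size_segments tau l : size (segments M tau l) = sumn l.
Proof. by elim: l tau => //= n l IH tau; rewrite size_cat size_iota IH. Qed.

Lemma segments_lo tau l : 0 < tau -> [:: (M * tau).-1] <<< segments M tau l.
Proof.
elim: l tau => [|n l IH] tau t0; rewrite ?allrel0r //= allrel_catr; apply/andP; split.
  by apply: iota_lo; rewrite muln_gt0 t0 (M_gt0 k_gt0 M_big).
by apply: (@allrel_gew (M * tau.+1).-1) (IH _ _) => //; rewrite mulnS; lia.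
Qed.

Lemma segments_hi tau l : all (fun n => n <= M) l -> segments M tau l <<< [:: M * (tau + size l)].
Proof.
elim: l tau => [|n l IH] tau //= /andP[nM /IH {}IH].
rewrite allrel_catl addnS -addSn IH andbT; apply: iota_hi.
by apply: (@leq_trans (M * tau.+1)); rewrite ?leq_mul2l ?leq_addr ?orbT // mulnS; lia.
Qed.

Lemma segments_inc tau l : 0 < tau -> all (fun n => n <= M) l -> inc (segments M tau l).
Proof.
elim: l tau => [|n l IH] tau //= t0 /andP[nM /IH {}IH].
rewrite pairwise_cat inc_iota IH // !andbT; apply: (@lt_sep (M * tau.+1)); last exact: segments_lo.
  by rewrite muln_gt0 (M_gt0 k_gt0 M_big).
by apply: iota_hi; rewrite mulnS; lia.
Qed.

Lemma lens_le j : j <= J -> all (fun n => n <= M) (lens k J j).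
Proof.
elim: j => [|j IH] jJ /=.
  by apply/allP => x /nseqP[-> _]; lia.
have := IH (ltnW jJ); rewrite all_cat /= => ->; rewrite /= andbT.
have : 2 ^ j <= 2 ^ J by rewrite leq_exp2l // ltnW.
move: (2 ^ j) (2 ^ J) M_big => x y; lia.
Qed.

Definition init_xs := iota 0 L.
Definition init_ys := iota (M * 1) kap ++ segments M 2 (lens k J J) ++ iota (M * (2 + ops)) (B + (b + rem)).

(** A round with empty [X] and [W] exchanges the [b] largest [x] for a first buffer of [y]. For odd
    length the middle number [L] starts in the right half; being below [M], it counts as an [x]. *)
Lemma engine_start : exists X U0, init_xs = X ++ U0 /\ exists l r,
  reach2 (X ++ U0) (iota L cc ++ init_ys) l r /\
  engine_state k M 2 1 0 (L - b) [::] l r (segments M 2 (lens k J J) ++ iota (M * (2 + ops)) (B + (b + rem))).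
Proof.
have M0 := M_gt0 k_gt0 M_big.
have M10 : 0 < M * 1 by rewrite muln1.
have /split_end[X [U0 [e sU0]]] : b <= size init_xs by rewrite size_iota; lia.
exists X, U0; split=> //.
have ix : inc init_xs by apply: inc_iota.
have xc : init_xs <<< iota L cc by apply: iota_iota.
have xM : init_xs <<< [:: M * 1] by apply: iota_hi; lia.
have cM : iota L cc <<< [:: M * 1] by apply: iota_hi; lia.
have sX : size X = L - b by move: (congr1 size e); rewrite size_cat size_iota; lia.
rewrite e in ix xc xM; rewrite /init_ys; set C := iota (M * 1) kap; set c := iota L cc.
have sC : size C = kap by rewrite size_iota.
have iC : inc C by apply: inc_iota.
have lC : [:: (M * 1).-1] <<< C by apply: iota_lo.
have hC : C <<< [:: M * 2] by apply: iota_hi; lia.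
have AC : X ++ U0 ++ c <<< C.
  by apply: (lt_sep M10 _ lC); rewrite -/c in cM; atoms; ar.
have hA : X ++ U0 ++ c <<< [:: M * 2].
  by apply: (@allrel_lew (M * 1)); [liac|rewrite -/c in cM; atoms; ar].
clearbody C; rewrite -/c in xc cM; clearbody c; rewrite !muln1 in lC xM cM; atoms.
have [P [E [iP sP iE p h]]] : exists P E : seq nat, [/\ inc P, size P = b, inc E,
  perm_eq C (P ++ E) & reach2 (X ++ [::] ++ U0) (c ++ C ++ [::] ++ segments M 2 (lens k J J) ++
    iota (M * (2 + ops)) (B + (b + rem)))
   (X ++ rev [::] ++ rev P) (rev E ++ rev [::] ++ U0 ++ c ++ segments M 2 (lens k J J) ++
    iota (M * (2 + ops)) (B + (b + rem)))].
  by apply: (roundR ltn_trans ltnn k_gt0); rewrite ?sC ?allrel0l ?allrel0r.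
perml p; rewrite !cat0s in h.
exists (X ++ rev P), ((rev E ++ U0 ++ c) ++ segments M 2 (lens k J J) ++
    iota (M * (2 + ops)) (B + (b + rem))); split; first by norm h; ng.
exists X, [::], [::], (rev P), (rev E ++ U0 ++ c); rewrite /flat /= ?cats0.
split=> //.
- by rewrite size_rev sX.
- by split; ar.
split.
  have -> : rev E ++ U0 ++ c = (rev E ++ U0 ++ c) ++ [::] by rewrite cats0.
  apply: zblocks_cons; first by exists [::].
  move=> al al0; rewrite !count_cat count_rev (count_X (X := U0)) // (count_X (X := c)) // !addn0.
  by apply: leq_trans (count_size _ _) _; have := perm_size p; rewrite size_cat sP sC => ->; rewrite -addSn leq_addl.
exists [::], (U0 ++ c); split=> //=.
rewrite !filter_cat filter_rev (filterY k_gt0 M_big (Y := E)) // !filterX //=.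
exact: invert_refl.
Qed.

Lemma count_lt A : A <<< [:: M] -> count (isX M) A = size A.
Proof. by rewrite allrel1r => h; apply/eqP; rewrite -all_count. Qed.

Lemma count_ge A : [:: M.-1] <<< A -> count (isX M) A = 0.
Proof. by move=> h; rewrite -size_filter (filterY k_gt0 M_big). Qed.

Lemma countC_lt A : A <<< [:: M] -> count (predC (isX M)) A = 0.
Proof. by move=> /count_lt h; have := count_predC (isX M) A; rewrite h; lia. Qed.

Lemma countC_ge A : [:: M.-1] <<< A -> count (predC (isX M)) A = size A.
Proof. by move=> /count_ge h; have := count_predC (isX M) A; rewrite h. Qed.

Lemma filter_lo A : [:: M.-1] <<< seq.filter (predC (isX M)) A.
Proof.
rewrite allrel1l; apply/allP => x; rewrite mem_filter /= /isX => /andP[h _].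
by have := M_gt0 k_gt0 M_big; lia.
Qed.

Lemma filter_hi A : seq.filter (isX M) A <<< [:: M].
Proof. by rewrite allrel1r; apply/allP => x; rewrite mem_filter => /andP[]. Qed.

Lemma invert_part s : invert s (seq.filter (predC (isX M)) s ++ seq.filter (isX M) s).
Proof.
have := @invert_partition (predC (isX M)) s.
rewrite (eq_filter (_ : predC (predC (isX M)) =1 isX M)); last by move=> x /=; rewrite negbK.
apply; elim: s => //= x s ->; rewrite andbT; apply/allP => y _.
by apply/implyP; rewrite /isX negbK => /andP[h1 h2]; lia.
Qed.

Lemma inc_init : inc (init_xs ++ iota L cc ++ init_ys).
Proof.
have l0 := lens_le (leqnn J).
rewrite /init_ys catA !pairwise_cat !inc_iota segments_inc // iota_iota !andbT /=.
have h1 := segments_lo (lens k J J) (isT : 0 < 2).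
have M0 := M_gt0 k_gt0 M_big.
have h3 : iota (M * 1) kap <<< [:: M * 2] by apply: iota_hi; liac.
have h4 : [:: (M * (2 + ops)).-1] <<< iota (M * (2 + ops)) (B + (b + rem)).
  by apply: iota_lo; rewrite muln_gt0 M0.
have M22 : M * 2 <= M * (2 + ops) by rewrite leq_mul2l leq_addr orbT.
have M20 : 0 < M * 2 by rewrite muln_gt0 M0.
rewrite !allrel_catr; apply/and3P; split; last 1 first.
- apply: (@lt_sep (M * (2 + ops))) h4; first by apply: leq_trans M22.
  exact: segments_hi.
- rewrite !allrel_catl; have hx : init_xs ++ iota L cc <<< [:: M * 1].
    by rewrite allrel_catl !iota_hi //; liac.
  have hx2 : init_xs ++ iota L cc <<< [:: M * 2] by apply: (@allrel_lew (M * 1)) => //; lia.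
  rewrite -!allrel_catl; apply/and3P; split.
  + by apply: (@lt_sep (M * 1)) => //; rewrite ?muln1 //; apply: iota_lo.
  + by apply: (@lt_sep (M * 2)).
  + apply: (@lt_sep (M * (2 + ops))) h4; first by apply: leq_trans M22.
    by apply: allrel_lew hx2.
- apply/andP; split; first by apply: (@lt_sep (M * 2)).
  apply: (@lt_sep (M * (2 + ops))) h4; first by apply: leq_trans M22.
  by apply: allrel_lew h3.
Qed.

Lemma main_reach : exists s, [/\ inc s, size s = L + cc + L & reach s (rev s)].
Proof.
have M0 := M_gt0 k_gt0 M_big.
have kb := buf_le k_gt0.
have kleb : k <= b by rewrite /buf; clear; lia.
have [X0 [U0 [e0 [l1 [r1 [h1 g1]]]]]] := engine_start.
set frF := iota (M * (2 + ops)) (B + (b + rem)) in g1.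
rewrite (_ : L - b = L - b - x_cost k J J + x_cost k J J) in g1; last by rewrite subnK //; lia.
have [|| l2 [r2 [h2 g2]]] := engine k_gt0 M_big _ _ g1; [by []|by rewrite add0n|].
case: g2 => X [D0 [Ls [U [Z [[el er] [sU sX iX eL] ok [Xo hi XM lo] [zb xp]]]]]].
have eLs : Ls = [::] by move: eL; case: (Ls).
subst Ls l2 r2; rewrite [flat [::]]/= in h2 Xo hi lo; rewrite ?cat0s in h2 Xo hi lo; clear eL ok.
rewrite -/frF in h2; rewrite (_ : 1 + ops = ops.+1) // in zb.
have rc0 : reach2 init_xs (iota L cc ++ init_ys) (X ++ D0 ++ U) (Z ++ frF) by rewrite e0; apply: reach2_trans h1 h2.
clear h1 h2 g1 e0 X0 U0 l1 r1.
have sys : size init_ys = L by rewrite /init_ys !size_cat !size_iota size_segments Ly; lia.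
have bal0 : balanced init_xs (iota L cc ++ init_ys).
  by rewrite /balanced size_cat !size_iota sys; lia.
have [sl sr /(_ bal0) rh] := rc0.
have pm := reach_perm rh; rewrite -!catA in pm.
have us : uniq (init_xs ++ iota L cc ++ init_ys) by apply: (pairwise_uniq ltnn inc_init).
have ysM : [:: M.-1] <<< init_ys.
  rewrite /init_ys muln1 !allrel_catr; apply/and3P; split.
  - by apply: iota_lo.
  - by apply: (@allrel_gew (M * 2).-1); [move: M0; clear; lia|exact: segments_lo].
  - by apply: (@allrel_gew (M * (2 + ops)).-1); [move: M0; clear; nia|apply: iota_lo; rewrite muln_gt0 M0].
have xsM : init_xs ++ iota L cc <<< [:: M] by rewrite allrel_catl !iota_hi //; move: LM cc1; clear; lia.
have cntL : count (predC (isX M)) (init_xs ++ iota L cc ++ init_ys) = L.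
  by rewrite catA count_cat countC_lt // countC_ge.
pose m1 := M * (2 + ops) + (B + b).
have Mt0 : 0 < M * (2 + ops) by rewrite muln_gt0 M0.
have m10 : 0 < m1 by rewrite /m1 addn_gt0 Mt0.
have MMt : M <= M * (2 + ops) by rewrite leq_pmulr.
have hiC : M * (2 + ops) + (B + b) <= M * (3 + ops).
  by rewrite (_ : 3 + ops = (2 + ops).+1) // mulnS addnC leq_add2r; move: M_big; clear; lia.
have [C0 [Ub [Y0 [eF [sC0 sUb sY0] [iC0 iUb iY0] [loN hiN loY] C0Ub]]]] :
  exists C0 Ub Y0, [/\ frF = C0 ++ Ub ++ Y0, [/\ size C0 = B, size Ub = b & size Y0 = rem],
   [/\ inc C0, inc Ub & inc Y0], [/\ [:: (M * (2 + ops)).-1] <<< C0 ++ Ub, C0 ++ Ub <<< [:: m1] &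
   [:: m1.-1] <<< Y0] & C0 <<< Ub].
  exists (iota (M * (2 + ops)) B), (iota (M * (2 + ops) + B) b), (iota m1 rem).
  split; rewrite ?size_iota //.
  - by rewrite /frF iotaD (iotaD _ b) /m1 addnA.
  - by split; apply: inc_iota.
  - by split; rewrite -?iotaD; [apply: iota_lo|apply: iota_hi|apply: iota_lo].
  - exact: iota_iota.
rewrite eF in pm rc0 sr rh; clear frF eF rh sr sl; rewrite (addnC 0) /= in sX xp.
have uT : uniq ((rev C0 ++ Z) ++ X ++ D0 ++ U ++ Ub ++ Y0).
  by move: us; congr is_true; apply: perm_uniq; move: pm; clear=> pm; pm.
set Z2 := rev C0 ++ Z in uT.
have uZ2 : uniq Z2 by move: uT; rewrite cat_uniq => /andP[].
have C0M : [:: M.-1] <<< C0 ++ Ub.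
  by apply: (@allrel_gew (M * (2 + ops)).-1) loN; move: MMt; clear; lia.
have Y0M : [:: M.-1] <<< Y0.
  by apply: (@allrel_gew m1.-1) loY; rewrite /m1; move: MMt; clear; lia.
have hiO : X ++ D0 ++ U ++ Z <<< [:: m1].
  apply: (@allrel_lew (M * (2 + ops))); first exact: leq_addr.
  rewrite allrel_catl hi andbT; exact: allrel_lew XM.
have loO : X ++ D0 ++ U ++ Z <<< C0 ++ Ub.
  apply: (lt_sep Mt0 _ loN); rewrite allrel_catl hi andbT; exact: allrel_lew XM.
atoms.
have hiZ2 : Z2 <<< [:: M * (3 + ops)] by apply: (allrel_lew hiC); rewrite /Z2 -/m1; ar.
have hiZ2' : Z2 <<< [:: m1] by rewrite /Z2; ar.
have zb2 : zblocks k M ops.+2 Z2.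
  apply: zblocks_cons zb _ => al al0; apply: leq_trans (count_size _ _) _.
  by rewrite size_rev sC0; move: kb; clear; lia.
have [Ws [sWs iWs wWs]] := layers k_gt0 M0 zb2 uZ2 hiZ2.
have fZ2 : seq.filter (isX M) Z2 = seq.filter (isX M) Z.
  by rewrite /Z2 filter_cat filter_rev (filterY k_gt0 M_big).
case: xp => Xi [rest [wXi iXi sXi]]; rewrite -fZ2 in wXi.
have pWs := invert_perm wWs; have pXi := invert_perm wXi.
have cy : size D0 + size U + count (predC (isX M)) Z + B + b + rem = L.
  rewrite -cntL (permP pm) !count_cat (countC_lt (A := X)) // (countC_ge (A := D0)) //.
  rewrite (countC_ge (A := U)) // (countC_ge (A := C0)) // (countC_ge (A := Ub)) //.
  by rewrite (countC_ge (A := Y0)) // sC0 sUb sY0 !addnA.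
have sfl : size (flatten Ws) = B + count (predC (isX M)) Z.
  by rewrite -(perm_size pWs) size_filter /Z2 count_cat count_rev (countC_ge (A := C0)) // sC0.
have loWs : [:: M.-1] <<< flatten Ws by rewrite -(allrel_permr _ _ pWs); apply: filter_lo.
have hiXi : Xi ++ rest <<< [:: M] by rewrite -(allrel_perml _ _ pXi); apply: filter_hi.
have subZ2 : {subset flatten Ws ++ Xi ++ rest <= Z2}.
  move=> v; rewrite mem_cat -(perm_mem pWs) -(perm_mem pXi) !mem_filter.
  by case/orP => /andP[].
have subZ : {subset Xi ++ rest <= Z}.
  by move=> v; rewrite -(perm_mem pXi) fZ2 mem_filter => /andP[].
have XZ2 : X <<< flatten Ws by apply: (allrel_sub (A := X) (B := Z2)) => //;
  [rewrite /Z2; ar|move=> v h; apply: subZ2; rewrite mem_cat h].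
have XXi : X <<< Xi ++ rest by apply: (allrel_sub (A := X) (B := Z)).
have [W [Ws' eW]] : exists W Ws', Ws ++ [:: [::]] = W :: Ws'.
  by case: (Ws) => [|W Ws'] /=; [exists [::], [::]|exists W, (Ws' ++ [:: [::]])].
have flW : W ++ flatten Ws' = flatten Ws.
  by rewrite -[W ++ _]/(flatten (W :: Ws')) -eW flatten_cat /= cats0.
have sWs' : (size Ws').+1 = nrounds.
  have := congr1 size eW; rewrite size_cat sWs /nrounds addn1 => -[] /= <-.
  by congr (_ * _).+1; clear; lia.
have /andP[iW iWs'] : all (pairwise ltn) (W :: Ws') by rewrite -eW all_cat iWs.
have scl : kap * (size Ws').+1 + size (W ++ flatten Ws') <= size X.
  rewrite flW sfl sWs'; move: sX Lx Ly cy; move: (kap * nrounds) (count _ Z) (x_cost _ _ _) (sumn _).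
  by clear; lia.
have XS : X <<< (D0 ++ U) ++ Ub ++ W ++ flatten Ws' by rewrite flW; ar.
have [X' [Xt [Sd [E [U' [Xd [[eX sXt] h1 pSd [sXd sU'] [[iE sE] sub]]]]]]]] :=
  clear_rounds k_gt0 (Xi ++ rest ++ Y0) iW iWs' sUb iX XS scl.
rewrite flW in pSd sXt sXd; rewrite sWs' in sXt.
have sXL : size X + size D0 + size U = L.
  by case: rc0 => + _ _; rewrite !size_cat size_iota addnA.
clear XS scl; subst X; atoms.
pose Sx := seq.filter (isX M) Sd; pose Sy := seq.filter (predC (isX M)) Sd.
have hiXt : Xt <<< [:: M] by [].
have subSx : {subset Sx <= Xt}.
  move=> v; rewrite mem_filter => /andP[vM vS].
  have : v \in Xt ++ (D0 ++ U) ++ Ub ++ flatten Ws by rewrite (perm_mem pSd) mem_cat vS.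
  rewrite mem_cat => /orP[//|h]; have lo3 : [:: M.-1] <<< (D0 ++ U) ++ Ub ++ flatten Ws by ar.
  by have := allrel_lt lo3 (mem_head _ _) h; move: vM M0; rewrite /isX; clear; lia.
have subSy : {subset Sy <= D0 ++ U ++ Ub ++ flatten Ws}.
  move=> v; rewrite mem_filter /= => /andP[vM vS].
  have : v \in Xt ++ (D0 ++ U) ++ Ub ++ flatten Ws by rewrite (perm_mem pSd) mem_cat vS.
  rewrite mem_cat => /orP[h|]; last by rewrite -catA.
  by have := allrel_lt hiXt h (mem_head _ _); move: vM; rewrite /isX; clear; lia.
have hiE : E ++ U' ++ Xd <<< [:: M] by apply: (allrel_sub hiXt).
have cx : size Xt = size Sx + size E + size U' + size Xd.
  have := permP pSd (isX M); rewrite !count_cat (count_lt hiXt).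
  rewrite (count_ge (A := D0)) // (count_ge (A := U)) // (count_ge (A := Ub)) //.
  rewrite (count_ge (A := flatten Ws)) // !addn0 => ->; rewrite -(size_filter _ Sd).
  by atoms; rewrite !count_lt // !addnA.
have csy : size D0 + size U + size Ub + size (flatten Ws) = size Sy.
  have := permP pSd (predC (isX M)); rewrite !count_cat (countC_lt hiXt) -(size_filter _ Sd).
  atoms; rewrite (countC_lt (A := E)) // (countC_lt (A := U')) // (countC_lt (A := Xd)) // !addn0.
  rewrite (countC_ge (A := D0)) // (countC_ge (A := U)) // (countC_ge (A := Ub)) //.
  by rewrite (countC_ge (A := flatten Ws)) // add0n !addnA.
have /split_end[Ea [U2 [eE sU2]]] : b <= size (rev E) by rewrite size_rev sE; move: kb; clear; lia.
have sEa : size Ea + b = kap - b by rewrite -sE -(size_rev E) eE size_cat sU2.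
have rc1 : reach2 init_xs (iota L cc ++ init_ys) (X' ++ Sy ++ (Sx ++ Ea) ++ U2) ((U' ++ Xd) ++ Xi ++ rest ++ Y0).
  rewrite -!catA in rc0 h1 *; apply: (reach2_trans rc0).
  have h2 := @bringR nat ltn ltn_trans k k_gt0 Ub C0 Z Y0 (X' ++ Xt ++ D0 ++ U).
  nx h2.
  have h3 := @reach2_freeR _ ltn k (rev C0 ++ Z ++ Y0) (flatten Ws ++ Xi ++ rest ++ Y0) Ub
    (X' ++ Xt ++ D0 ++ U).
  nx h3.
  - have w := invert_catr Y0 (invert_trans (invert_part Z2) (invert_cat wWs wXi)).
    by rewrite /Z2 -!catA in w.
  rewrite -flW -?catA; nx h1; rewrite eE -?catA.
  have h4 := @reach2_freeL _ ltn k (X' ++ Sd) (X' ++ Sy ++ Sx) (Ea ++ U2) (U' ++ Xd ++ Xi ++ rest ++ Y0).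
  norm h4; apply: h4; last by rewrite size_cat sU2; apply: leq_trans (leq_addl _ _).
  by apply: invert_catl; apply: invert_part.
have [sl1 _ /(_ bal0) rh1] := rc1.
have uF : uniq ((X' ++ Sy ++ (Sx ++ Ea) ++ U2) ++ (U' ++ Xd) ++ Xi ++ rest ++ Y0).
  by rewrite -(perm_uniq (reach_perm rh1)).
have uF1 : uniq Sy.
  by move: uF; rewrite -!catA cat_uniq => /and3P[_ _]; rewrite cat_uniq => /andP[].
have uF2 : uniq (X' ++ (Sx ++ Ea) ++ U2 ++ (U' ++ Xd) ++ Xi ++ rest).
  have : uniq ((X' ++ (Sx ++ Ea) ++ U2 ++ (U' ++ Xd) ++ Xi ++ rest) ++ Sy ++ Y0).
    by move: uF; congr is_true; apply: perm_uniq; clear; pm.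
  by rewrite cat_uniq => /andP[].
have sub2 : {subset (Sx ++ Ea) ++ U2 ++ U' ++ Xd <= Xt}.
  have subE : {subset Ea ++ U2 <= Xt}.
    by move=> v; rewrite -eE mem_rev => vE; apply: sub; rewrite mem_cat vE.
  move=> v; rewrite -catA mem_cat => /orP[/subSx //|]; rewrite catA mem_cat.
  by move=> /orP[/subE //|h]; apply: sub; rewrite mem_cat h orbT.
(* Each clearing round leaves about [kap] of the [x] behind in the left half. The burst in [finish]
   charges [kap] for each of these, whence the [kap * (kap * nrounds)] in [chain_big]. *)
have lw : size (Sx ++ Ea) + 2 * b = kap * nrounds.
  move: cx sXt sXd sU' sE sEa kb; rewrite size_cat; move: (size Sx) (size Ea) (kap * nrounds).
  by move: (size (flatten Ws)) => x y z w; clear; lia.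
have b0 : 0 < b by rewrite /buf muln_gt0 addn_gt0 k_gt0 orbT.
have hSy : Sy <<< [:: m1].
  apply: (allrel_sub (A := D0 ++ U ++ Ub ++ flatten Ws) (B := [:: m1])) => //; ar.
  by apply: (allrel_sub hiZ2') => // v h; apply: subZ2; rewrite mem_cat h.
have [G [lf [rf [iG eG h2]]]] : exists G lf rf, [/\ inc G, lf ++ rf = rev G &
  reach2 (X' ++ Sy ++ (Sx ++ Ea) ++ U2) ((U' ++ Xd) ++ Xi ++ rest ++ Y0) lf rf].
  apply: finish => //.
  - rewrite size_cat; apply: leq_trans (leq_addl _ _).
    by rewrite -(leq_add2r b) sEa; move: kb; clear; lia.
  - rewrite sY0; move: sXL; rewrite (size_cat X') => sXL.
    move: sXL lw cy sXt; rewrite sfl sU.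
    move: (kap * nrounds) (count _ Z) (size (Sx ++ Ea)) (size X') (size Xt) (size D0) => x y z t u v.
    by clear; lia.
  - apply: leq_trans (_ : chain_size J + 0 <= _) => //; rewrite addn0; apply: leq_trans chain_big.
    have h : kap * (size (Sx ++ Ea)).+1 <= kap * (kap * nrounds).
      by rewrite leq_mul2l -lw; move: b0; clear; lia.
    have h' : exch_size k b + B + k.+1 + (B + k) <= 2 * kap.
      rewrite mul2n -addnn; apply: leq_add; first exact: leqnn.
      by move: kb; clear; lia.
    by apply: leq_trans (leq_add h h'); rewrite !addnA.
  - rewrite -csy sUb -addnA addnC -addnA; apply: leq_trans (leq_addr _ _).
    by rewrite /buf; clear; lia.
  - have h : (Sx ++ Ea) ++ U2 ++ U' ++ Xd <<< Xi by apply: (allrel_sub (A := Xt) (B := Xi)).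
    by atoms; ar.
  - have h : (Sx ++ Ea) ++ U2 ++ U' ++ Xd <<< [:: M] by apply: (allrel_sub hiXt).
    apply: (lt_sep M0); first by atoms; ar.
    by rewrite allrel_catr filter_lo.
  - exact: lt_sep m10 hSy loY.
  - by rewrite size_cat sU'; apply: leq_trans (leq_addr _ _).
have [_ _ /(_ bal0)] := reach2_trans rc1 h2; rewrite eG => rG.
have pG := reach_perm rG; rewrite perm_sym perm_rev perm_sym in pG.
have eG' : init_xs ++ iota L cc ++ init_ys = G.
  apply: (irr_sorted_eq ltn_trans ltnn); rewrite ?pairwise_sorted ?inc_init //.
  by move=> v; rewrite (perm_mem pG).
exists (init_xs ++ iota L cc ++ init_ys); split; first exact: inc_init.
- by rewrite (size_cat init_xs) (size_cat (iota L cc)) sys !size_iota addnA.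
- by rewrite {2}eG'.
Qed.
End Main.

(** * Size bounds *)

Section Numerics.
Variable k : nat.
Hypothesis k_gt0 : 0 < k.
Local Notation B := (bring_size k k).
Local Notation b := (buf k).
Local Notation kap := (round_size k).

Lemma bring_size_le d : bring_size k d + (k + 2) = (k + 2) * 2 ^ d.
Proof. by elim: d => [|d IH] /=; rewrite ?muln1 // expnS; lia. Qed.

Lemma exch_small_le m : m <= k ->
  exch_small k m + (B + 4 * k + 2) <= 2 ^ m * (2 * B + 4 * k + 2).
Proof.
elim: m => [|m IH] mk /=; first by rewrite mul1n; lia.
have := IH (ltnW mk); rewrite expnS -mulnA; move: (_ * (_ + _)) => x; lia.
Qed.

(** With [x = 2 ^ k], [B] is of order [x ^ 2], the small exchange of order [x ^ 3] and their product
    of order [x ^ 5]; the constant [128 = 2 ^ 7] is absorbed by [x ^ 7]. *)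
Lemma round_size_le : kap.+1 <= 2 ^ (12 * k).
Proof.
rewrite mulnC expnM; set x := 2 ^ k.
have kx : k < x by apply: ltn_expl.
have hB : B <= 2 * x ^ 2.
  have := bring_size_le k; rewrite -/x => h.
  have : (k + 2) * x <= 2 * x * x by rewrite leq_mul2r; lia.
  by rewrite -mulnn mulnA; move: h; set u := (k + 2) * x; lia.
have x2 : 2 <= x by rewrite /x -{1}(expn1 2) leq_exp2l.
have xx : 2 * x <= x ^ 2 by rewrite expnS expn1 leq_mul2r x2 orbT.
have x23 : 2 * x ^ 2 <= x ^ 3 by rewrite (expnS x 2) leq_mul2r x2 orbT.
have hs : exch_small k k <= 10 * x ^ 3.
  have := exch_small_le (leqnn k); rewrite -/x => h.
  have : x * (2 * B + 4 * k + 2) <= x * (10 * x ^ 2) by rewrite leq_mul2l; apply/orP; right; lia.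
  by rewrite mulnCA -expnS; lia.
have hb : b <= 6 * x ^ 2 by rewrite /buf; lia.
have hm : b * (exch_small k k + 2 * k) <= 6 * x ^ 2 * (11 * x ^ 3).
  by apply: leq_mul => //; lia.
have e5 : 6 * x ^ 2 * (11 * x ^ 3) = 66 * x ^ 5 by rewrite mulnACA -expnD.
have x5 : x ^ 3 <= x ^ 5 by rewrite leq_exp2l.
have h : kap.+1 <= 128 * x ^ 5.
  by rewrite /round_size /exch_size; lia.
apply: leq_trans h _; rewrite -(subnKC (_ : 5 <= 12)) // addnC expnD leq_mul2r.
by rewrite [128](_ : _ = 2 ^ 7) // leq_exp2r // x2 orbT.
Qed.

(** With [q = kap.+1], the demand on the reserve is at most [(6 + 2) * q ^ 4 * 2 ^ J] and the
    reserve is [J * 2 ^ J / 2]; equality gives the factor [16]. *)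
Definition depth := 16 * kap.+1 ^ 4.
Local Notation J := depth.

Lemma depth_le : J <= 2 ^ (52 * k).
Proof.
rewrite /depth (_ : 52 * k = 4 * k + 12 * k * 4); last by lia.
rewrite expnD leq_mul //; last by rewrite expnM leq_exp2r // round_size_le.
by rewrite [16](_ : _ = 2 ^ 4) // leq_exp2l //; lia.
Qed.

Lemma chain_size2 j : 2 * chain_size j = j * 2 ^ j.
Proof. by elim: j => // j IH /=; rewrite expnS mulSn; lia. Qed.

Lemma size_lens p j : size (lens k p j) + 2 = (2 * kap + 2) * 2 ^ j.
Proof.
elim: j => [|j IH] /=; first by rewrite size_nseq muln1.
by rewrite size_cat /= expnS; lia.
Qed.

Lemma lens_max p j n : n \in lens k p j -> n <= kap + p + (B + b) + 2 ^ j.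
Proof.
elim: j n => [|j IH] n /=; first by move=> /nseqP[-> _]; lia.
have h : 2 ^ j <= 2 ^ j.+1 by rewrite leq_exp2l.
rewrite mem_cat !inE => /orP[/IH|/or3P[/eqP->|/eqP->|/IH]]; lia.
Qed.

Lemma sumn_le s m : (forall n, n \in s -> n <= m) -> sumn s <= size s * m.
Proof.
elim: s => //= a s IH h; rewrite mulSn leq_add ?h ?mem_head // IH // => n ns.
by apply: h; rewrite inE ns orbT.
Qed.

Lemma x_cost_le p j : x_cost k p j <= 2 ^ j * (2 * kap * p + j).
Proof.
elim: j => [|j IH] /=; first by rewrite mul1n addn0.
rewrite expnS -(mulnA 2 (2 ^ j)) addnS mulnS; move: (2 ^ j * _) IH => x; lia.
Qed.

Lemma nrounds_le : nrounds k J <= 6 * kap.+1 ^ 2 * 2 ^ J.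
Proof.
rewrite /nrounds; have := size_lens J J; set T := size _; set Y := 2 ^ J.
have Y0 : 0 < Y by rewrite expn_gt0.
move=> h; have -> : 2 * T + 5 = 4 * (kap.+1 * Y) + 1 by lia.
set q := kap.+1; have q0 : 0 < q by [].
rewrite mulnDr muln1 (_ : q * (4 * (q * Y)) = 4 * q ^ 2 * Y); last by rewrite expnS expn1; lia.
have : q <= q ^ 2 * Y by rewrite expnS expn1 -mulnA leq_pmulr // muln_gt0 q0.
have : 0 < q ^ 2 * Y by rewrite muln_gt0 expn_gt0 q0.
rewrite -!mulnA; move: (q ^ 2 * Y) => z; lia.
Qed.

Lemma chain_size_large : kap * (kap * nrounds k J) + 2 * kap <= chain_size J.
Proof.
rewrite -(leq_pmul2l (_ : 0 < 2)) // chain_size2 {2}/depth.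
set Y := 2 ^ J; set q := kap.+1; have Y0 : 0 < Y by rewrite expn_gt0.
have q0 : 0 < q by [].
have h1 : kap * (kap * nrounds k J) <= q * (q * (6 * q ^ 2 * Y)).
  by rewrite !leq_mul // nrounds_le.
have e : q * (q * (6 * q ^ 2 * Y)) = 6 * (q ^ 4 * Y).
  by rewrite (_ : q ^ 4 = q * (q * q ^ 2)) -?expnS //; lia.
have h2 : kap <= q ^ 4 * Y.
  by apply: (@leq_trans q) => //; rewrite expnS -mulnA leq_pmulr // muln_gt0 expn_gt0 q0.
by rewrite -[16 * _ * _]mulnA; move: (q ^ 4 * Y) e h1 h2 => z -> ; lia.
Qed.

Lemma size_bound :
  b + x_cost k J J + (kap * nrounds k J + (kap + sumn (lens k J J) + B)) + (B + b) <= 32 * (2 ^ J) ^ 4.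
Proof.
set Y := 2 ^ J; have kb := buf_le k_gt0.
have JY : J <= Y by apply: ltnW; apply: ltn_expl.
have qJ : kap.+1 <= J.
  by rewrite /depth expnS mulnA mulnAC leq_pmull // muln_gt0 expn_gt0.
have qY : kap.+1 <= Y by apply: leq_trans JY.
have Y0 : 0 < Y by rewrite expn_gt0.
have Y12 : Y <= Y ^ 2 by rewrite expnS expn1 leq_pmulr.
have Y23 : Y ^ 2 <= Y ^ 3 by rewrite leq_exp2l //; lia.
have Y34 : Y ^ 3 <= Y ^ 4 by rewrite leq_exp2l //; lia.
have hu : x_cost k J J <= Y * (2 * Y * Y + Y).
  by apply: leq_trans (x_cost_le J J) _; rewrite leq_mul // leq_add // !leq_mul // ltnW.
have eu : Y * (2 * Y * Y + Y) = 2 * Y ^ 3 + Y ^ 2 by rewrite !expnS expn0; lia.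
have hn : kap * nrounds k J <= Y * (6 * Y ^ 2 * Y).
  apply: leq_mul; first exact: ltnW.
  by apply: leq_trans nrounds_le _; rewrite !leq_mul // leq_exp2r.
have en : Y * (6 * Y ^ 2 * Y) = 6 * Y ^ 4 by rewrite !expnS expn0; lia.
have hT : size (lens k J J) <= 2 * Y * Y.
  have := size_lens J J; rewrite -/Y => h; apply: leq_trans (leq_addr 2 _) _.
  by rewrite h leq_mul2r; lia.
have hs : sumn (lens k J J) <= 2 * Y * Y * (5 * Y).
  apply: leq_trans (sumn_le (@lens_max J J)) _; apply: leq_mul => //.
  by rewrite -/Y; lia.
have es : 2 * Y * Y * (5 * Y) = 10 * Y ^ 3 by rewrite !expnS expn0; lia.
by rewrite eu in hu; rewrite en in hn; rewrite es in hs; lia.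
Qed.

Lemma reach_rev n : 2 ^ (2 ^ (56 * k)) <= n ->
  exists s, [/\ pairwise ltn s, size s = n & reach ltn k s (rev s)].
Proof.
move=> nbig; set Y := 2 ^ J.
have Y2 : 2 <= Y by rewrite /Y -{1}(expn1 2) leq_exp2l // /depth muln_gt0 expn_gt0.
have hY : 2 * (32 * Y ^ 4) + 1 <= n.
  (* [2 * 32 * Y ^ 4 + 1] is at most [2 ^ 7 * Y ^ 4], hence at most [Y ^ 11]; and [11 * J] is at
     most [2 ^ 4 * 2 ^ (52 * k)], which gives the exponent [56 * k]. *)
  apply: leq_trans nbig; apply: (@leq_trans (Y ^ 11)).
    have := leq_exp2r 2 Y (isT : 0 < 7); rewrite Y2 => h.
    rewrite (_ : 11 = 7 + 4) // expnD; apply: leq_trans (leq_mul h (leqnn _)).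
    rewrite [2 ^ 7](_ : _ = 128) //; have : 0 < Y ^ 4 by rewrite expn_gt0; lia.
    by lia.
  rewrite /Y -expnM leq_exp2l //; apply: (@leq_trans (2 ^ (52 * k) * 2 ^ 4)).
    by rewrite leq_mul // depth_le.
  by rewrite -expnD leq_exp2l //; lia.
have sb := size_bound; rewrite -/Y in sb.
pose L := n./2; have en := odd_double_half n.
have hL : 32 * Y ^ 4 <= L by rewrite /L; lia.
pose rem := L - (kap + sumn (lens k J J)) - (B + b).
pose M := L.+1 + (kap + J + B + b + 2 ^ J).
have [||||||s [is_ ss rs]] := @main_reach k L J M (odd n) rem k_gt0.
- by rewrite /M leq_addl.
- by rewrite /M addSn ltnS leq_addr.
- by case: (odd n).
- by rewrite /rem; move: sb hL; clear; lia.
- by move: sb hL; clear; lia.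
- exact: chain_size_large.
exists s; split=> //; rewrite ss /L -{3}en -addnn; lia.
Qed.

End Numerics.

(** * Realisation by curves *)

Section Runs.
Variable k : nat.

Definition move := (seq nat * seq nat * seq nat)%type.
Definition legal (m : move) : bool :=
  [&& sorted ltn m.1.2, 2 <= size m.1.2 &
   (k + size m.1.1 <= size m.2) || (k + size m.2 <= size m.1.1)].

Fixpoint run (s : seq nat) (ms : seq move) (t : seq nat) : Prop :=
  if ms is (u, R, v) :: ms' then
    [/\ s = u ++ R ++ v, legal (u, R, v) & run (u ++ rev R ++ v) ms' t]
  else s = t.

Lemma reach_run s t : reach ltn k s t -> exists ms, run s ms t.
Proof.
elim=> {s t} [s|s t w [u [R [v [-> -> sR R2 uv]]]] _ [ms h]]; first by exists [::].
by exists ((u, R, v) :: ms); split=> //; apply/and3P.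
Qed.

Lemma reach_map (f : nat -> nat) s t : {in s &, {homo f : x y / x < y}} ->
  reach ltn k s t -> reach ltn k (map f s) (map f t).
Proof.
move=> + h; elim: h => {s t} [s|s t w st _ IH] hf; first exact: reach_refl.
have pst := reach_perm (reach1 st).
case: st => [u [R [v [es et sR R2 uv]]]]; subst s t.
apply: reach_step (IH _); last first.
  by move=> x y xs ys; apply: hf; rewrite (perm_mem pst).
exists (map f u), (map f R), (map f v); rewrite !map_cat map_rev !size_map; split=> //.
move: sR; rewrite !sorted_pairwise; try exact: ltn_trans.
rewrite pairwise_map; apply: (sub_in_pairwise (P := mem R)); last by apply/allP.
by move=> x y xR yR; apply: hf; rewrite !mem_cat ?xR ?yR ?orbT.
Qed.

(** Labels are replaced by ranks, which will be the horizontal positions of the points. *)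
Lemma reach_iota s n : pairwise ltn s -> size s = n -> reach ltn k s (rev s) ->
  reach ltn k (iota 0 n) (rev (iota 0 n)).
Proof.
move=> is_ sn r; have u : uniq s by apply: pairwise_uniq is_; apply: ltnn.
have e : map (index^~ s) s = iota 0 n.
  apply: (@eq_from_nth _ 0); rewrite size_map ?size_iota // => i si.
  by rewrite (nth_map 0) // nth_iota -?sn // index_uniq.
rewrite -e -map_rev; apply: reach_map r => x y xs ys xy.
have st : sorted ltn s by rewrite sorted_pairwise //; apply: ltn_trans.
rewrite ltnNge leq_eqVlt; apply/norP; split.
  by apply/eqP => /(congr1 (nth 0 s)); rewrite !nth_index // => exy; rewrite exy ltnn in xy.
apply/negP => h; have := sorted_ltn_index ltn_trans st y x ys xs h.
by rewrite /= ltnNge ltnW.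
Qed.

(* The class of a point with respect to a move: [1] and [-1] for the two sides of
   the corresponding pseudoline, [0] for the points on it. *)
Definition cls (m : move) (i : nat) : int :=
  if i \in m.1.1 then Posz 1 else if i \in m.1.2 then Posz 0 else Negz 0.

Definition before (s : seq nat) i j := index i s < index j s.

Lemma sorted_before R i j : sorted ltn R -> i \in R -> j \in R -> i < j -> before R i j.
Proof.
move=> st iR jR ij; rewrite /before ltnNge leq_eqVlt; apply/norP; split.
  by apply/eqP => /(congr1 (nth 0 R)); rewrite !nth_index // => e; rewrite e ltnn in ij.
apply/negP => h; have := sorted_ltn_index ltn_trans st j i jR iR h.
by rewrite /= ltnNge ltnW.
Qed.

Lemma sorted_before_rev R i j : sorted ltn R -> i \in R -> j \in R -> i < j ->
  before (rev R) j i.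
Proof.
move=> st iR jR ij; rewrite /before ltnNge leq_eqVlt; apply/norP; split.
  apply/eqP => /(congr1 (nth 0 (rev R))); rewrite !nth_index ?mem_rev // => e.
  by rewrite e ltnn in ij.
have st' : sorted (fun x y => y < x) (rev R) by rewrite rev_sorted.
have tr : transitive (fun x y : nat => y < x) by move=> y x z h1 h2; apply: ltn_trans h2 h1.
apply/negP => h; have := sorted_ltn_index tr st' i j _ _ h; rewrite !mem_rev => /(_ iR jR).
by rewrite ltnNge ltnW.
Qed.

Definition after_move (m : move) := m.1.1 ++ rev m.1.2 ++ m.2.
Definition before_move (m : move) := m.1.1 ++ m.1.2 ++ m.2.

Lemma before_cls m i j : uniq (before_move m) -> legal m -> i < j ->
  i \in before_move m -> j \in before_move m -> before (before_move m) i j ->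
  (cls m j <= cls m i)%R /\
  (if (cls m i == 0)%R && (cls m j == 0)%R then before (after_move m) j i
   else before (after_move m) i j).
Proof.
case: m => [[u R] v]; rewrite /before_move /after_move /cls /=.
move=> un /and3P[/= sR _ _] ij ; rewrite !mem_cat /before !index_cat !mem_rev size_rev.
move: un; rewrite cat_uniq => /and3P[_ /hasPn n1]; rewrite cat_uniq => /and3P[_ /hasPn n2 _].
have := sorted_before_rev sR; rewrite /before => /(_ i j).
have := index_mem i u; have := index_mem j u; have := index_mem i R; have := index_mem j R.
have := index_mem i (rev R); have := index_mem j (rev R); rewrite !mem_rev size_rev.
case: (i \in u); case: (j \in u); case: (i \in R); case: (j \in R) => //= *; split; lia.
Qed.

Lemma before_cls_rev m i j : uniq (before_move m) -> legal m -> i < j ->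
  i \in before_move m -> j \in before_move m -> before (before_move m) j i ->
  [/\ (cls m i <= cls m j)%R, ~~ ((cls m i == 0)%R && (cls m j == 0)%R) &
   before (after_move m) j i].
Proof.
case: m => [[u R] v]; rewrite /before_move /after_move /cls /=.
move=> un /and3P[/= sR _ _] ij ; rewrite !mem_cat /before !index_cat !mem_rev size_rev.
have := sorted_before sR; rewrite /before => /(_ i j).
have := index_mem i u; have := index_mem j u; have := index_mem i R; have := index_mem j R.
have := index_mem i (rev R); have := index_mem j (rev R); rewrite !mem_rev size_rev.
case: (i \in u); case: (j \in u); case: (i \in R); case: (j \in R) => //= *; split; lia.
Qed.

Lemma run_legal s ms t m : run s ms t -> m \in ms -> legal m /\ perm_eq s (before_move m).
Proof.
elim: ms s => //= -[[u R] v] ms IH s [-> lm /IH {}IH]; rewrite inE => /predU1P[-> //|/IH [h1 h2]].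
split=> //; apply: perm_trans h2.
by rewrite perm_cat2l perm_cat2r perm_sym perm_rev.
Qed.

Lemma perm_after m : perm_eq (before_move m) (after_move m).
Proof. by rewrite perm_cat2l perm_cat2r perm_sym perm_rev. Qed.

(** Runs are increasing, so an inverted pair never shares a run again and stays inverted through all
    later moves. *)
Lemma run_reversed s ms t i j m : run s ms t -> uniq s -> i < j -> i \in s -> j \in s ->
  before s j i -> m \in ms ->
  (cls m i <= cls m j)%R /\ ~~ ((cls m i == 0)%R && (cls m j == 0)%R).
Proof.
elim: ms s => //= -[[u R] v] ms IH s [-> lm r] us ij si sj bji.
have [c1 c2 b2] := before_cls_rev (m := (u, R, v)) us lm ij si sj bji.
have pa := perm_after (u, R, v).
rewrite inE => /predU1P[-> //|]; apply: IH r _ ij _ _ b2.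
- by rewrite -(perm_uniq pa).
- by rewrite -(perm_mem pa).
- by rewrite -(perm_mem pa).
Qed.

Definition up (m m' : move) i : bool :=
  ((cls m i < cls m' i) || ((cls m i == 0) && (cls m' i == 0)))%R.

Lemma cls_cases m i : [\/ cls m i = 0%R, cls m i = 1%R | cls m i = (-1)%R].
Proof. by rewrite /cls; case: ifP => _; [|case: ifP => _]; constructor. Qed.

(* Each pair is reversed by exactly one move, which fixes the possible changes of classes
   of two points between two moves. *)
Lemma run_up s ms t a b' i j : run s ms t -> uniq s -> a < b' < size ms -> i < j ->
  i \in s -> j \in s ->
  let m := nth ([::], [::], [::]) ms a in let m' := nth ([::], [::], [::]) ms b' in
  up m m' i -> (cls m j <= cls m' j)%R && ~~ ((cls m j == 0)%R && (cls m' j == 0)%R).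
Proof.
move=> + + + ij; elim: ms s a b' => [|m0 ms IH] s a b'; first by rewrite ltn0 andbF.
move=> r us ab si sj /=; case: a ab => [|a] ab; last first.
  case: b' ab => // b'; rewrite !ltnS => ab /=.
  case: m0 r => [[u R] v] [es lm r]; have pa := perm_after (u, R, v); subst s.
  apply: (IH _ _ _ r _ ab).
  - by rewrite -(perm_uniq pa).
  - by rewrite -(perm_mem pa).
  - by rewrite -(perm_mem pa).
case: b' ab => // b'; rewrite ltnS => /= bs.
set m' := nth _ ms b'; have m'ms : m' \in ms by apply: mem_nth.
have r' := r; case: m0 r' r => [[u R] v] [es lm r'] r; set m := (u, R, v).
have pa := perm_after m.
have b3 : before s j i \/ before s i j.
  rewrite /before; case: ltngtP => [||e]; [by left|by right|].
  by have := congr1 (nth 0 s) e; rewrite !nth_index // => e2; rewrite e2 ltnn in ij.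
case: b3 => b3.
  have := run_reversed r us ij si sj b3 (mem_head _ _).
  have := run_reversed r us ij si sj b3 (_ : m' \in _); rewrite inE m'ms orbT => /(_ isT).
  move=> [h1 h2] [h3 h4]; move: h1 h2 h3 h4.
  rewrite /up -/m; case: (cls_cases m i) => ->; case: (cls_cases m j) => ->;
  by case: (cls_cases m' i) => ->; case: (cls_cases m' j) => ->.
subst s; have [c1] := before_cls (m := m) us lm ij si sj b3.
case: ifP => [/andP[/eqP ci /eqP cj] b4|nc _].
  have := run_reversed r' _ ij _ _ b4 m'ms; rewrite -(perm_uniq pa) -!(perm_mem pa).
  move=> /(_ us si sj) [h1 h2]; move: h1 h2; rewrite /up ci cj.
  by case: (cls_cases m' i) => ->; case: (cls_cases m' j) => ->.
move: c1 nc; rewrite /up; case: (cls_cases m i) => ->; case: (cls_cases m j) => ->;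
by case: (cls_cases m' i) => ->; case: (cls_cases m' j) => ->.
Qed.

(** Only a run containing both elements can change their order; this yields the pseudoline through
    two given points. *)
Lemma run_through s ms t i j : run s ms t -> uniq s -> i < j -> i \in s -> j \in s ->
  before s i j -> before t j i -> exists2 m, m \in ms & (cls m i == 0)%R && (cls m j == 0)%R.
Proof.
elim: ms s => [|[[u R] v] ms IH] s /=; first by move=> -> _ _ _ _; rewrite /before; lia.
move=> [-> lm r] us ij si sj bij bji; have pa := perm_after (u, R, v).
have [c1] := before_cls (m := (u, R, v)) us lm ij si sj bij.
case: ifP => [h _|_ b4]; first by exists (u, R, v) => //; apply: mem_head.
have [||||||m mms h] := IH _ r; rewrite -?(perm_uniq pa) -?(perm_mem pa) //.
by exists m => //; rewrite inE mms orbT.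
Qed.

End Runs.

Local Open Scope classical_set_scope.
Local Open Scope ring_scope.

(** * Heights of the curves at the points *)

Section Heights.
Variables (K n : nat).

(** [gap] at [v] is at most [scale v] in size, so a jump of [3 * scale v] fixes the sign at point
    [v], and the sum stays within [4 * scale v = scale v.+1]. *)
Definition scale (v : nat) : int := (K * 4 ^ v)%N.

(* [gap c m v] orders the curves between the vertical lines of the points [v.-1] and [v];
   curves meeting at a point swap, all others keep their order. *)
Fixpoint gap (c : nat -> int) (m v : nat) : int := if v is v'.+1 then
  if c v' == 0 then m%:Z else c v' * (3 * scale v') + gap c m v' else - m%:Z.

(** Point [v] sits at node [v.+1]; nodes [0] and [n.+1] record the order at the two ends. On the far
    left later moves run lower, so every pair of curves starts in the same order. *)
Definition height (c : nat -> int) (m j : nat) : int := if j is v.+1 then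
  if (v < n)%N then (if c v == 0 then 0 else c v * (3 * scale v) + gap c m v)
  else gap c m n else - m%:Z.

Definition signs (c : nat -> int) := forall v, [\/ c v = 0, c v = 1 | c v = -1].

Lemma scaleS v : scale v.+1 = 4 * scale v.
Proof. by rewrite /scale expnS; lia. Qed.

Lemma scale_ge v : K%:Z <= scale v.
Proof. by rewrite /scale lez_nat leq_pmulr // expn_gt0. Qed.

Lemma gap_bound c m v : signs c -> (m < K)%N -> `|gap c m v| <= scale v.
Proof.
move=> sc mK; elim: v => [|v IH] /=; first by rewrite /scale muln1; lia.
rewrite scaleS; have := scale_ge v; have := IH; move: (scale v) (gap c m v) => x y.
by case: (sc v) => ->; rewrite ?mul1r ?mulN1r /=; lia.
Qed.

Section Two.
Variables (c c' : nat -> int) (m m' : nat).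
Hypotheses (sc : signs c) (sc' : signs c') (mm : (m < m' < K)%N).
Definition rises i := (c i < c' i) || ((c i == 0) && (c' i == 0)).
Hypothesis rises_stay : forall i j, (i < j < n)%N -> rises i ->
  (c j <= c' j) && ~~ ((c j == 0) && (c' j == 0)).

Definition dh j := height c' m' j - height c m j.

(** The heights alone do not carry the induction: at a common point [dh] vanishes and only [gap]
    knows the order afterwards. Before the crossing [gap] and all [dh] are negative for the later
    curve; a crossing leaves a rise behind, and [rises_stay] then forbids a return. *)
Lemma dh_gap v : (v <= n)%N -> [/\ forall i j, (i < j <= v)%N -> 0 <= dh i -> 0 < dh j,
  gap c' m' v != gap c m v,
  gap c m v < gap c' m' v -> exists2 i, (i < v)%N & rises i &
  gap c' m' v < gap c m v -> forall j, (j <= v)%N -> dh j < 0].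
Proof.
elim: v => [|v IH] vn.
  have /andP[m1 m2] := mm; rewrite /=; split.
  - by move=> i j /andP[]; case: j.
  - by rewrite eqr_opp eqz_nat gtn_eqF.
  - by rewrite ltrN2 ltz_nat => h; have := ltn_trans h m1; rewrite ltnn.
  - by move=> _ [|j] // _; rewrite /dh /= opprK; lia.
have [h1 h2 h3 h4] := IH (ltnW vn).
have bg := gap_bound v sc (leq_ltn_trans (ltnW (proj1 (andP mm))) (proj2 (andP mm))).
have bg' := gap_bound v sc' (proj2 (andP mm)).
have dv : dh v.+1 = (if c' v == 0 then 0 else c' v * (3 * scale v) + gap c' m' v)
   - (if c v == 0 then 0 else c v * (3 * scale v) + gap c m v) by rewrite /dh /= vn.
have sK := scale_ge v.
have key : (c v <= c' v) && ~~ ((c v == 0) && (c' v == 0)) \/ gap c' m' v < gap c m v.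
  case: (ltgtP (gap c' m' v) (gap c m v)) => e; [by right| |by rewrite e eqxx in h2].
  by left; have [i iv ri] := h3 e; apply: rises_stay ri; rewrite iv.
have ext (P : forall j, (j <= v)%N -> dh j < 0) : dh v.+1 < 0 ->
    forall j, (j <= v.+1)%N -> dh j < 0.
  by move=> d j; rewrite leq_eqVlt => /predU1P[-> //|]; apply: P.
have ext1 : 0 < dh v.+1 -> forall i j, (i < j <= v.+1)%N -> 0 <= dh i -> 0 < dh j.
  move=> d i j /andP[ij]; rewrite leq_eqVlt => /predU1P[-> //|jv].
  by apply: h1; rewrite ij.
have ext2 : gap c' m' v < gap c m v -> forall i j, (i < j <= v.+1)%N -> 0 <= dh i -> 0 < dh j.
  move=> /h4 d i j /andP[ij jv] di; have := d i (leq_trans ij jv); lia.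
have rv : rises v -> exists2 i, (i < v.+1)%N & rises i by exists v.
have h3' : gap c m v < gap c' m' v -> exists2 i, (i < v.+1)%N & rises i.
  by move=> /h3 [i iv ri]; exists i => //; apply: ltnW.
(* The goal is named so that the nine cases for the classes at [v] share three endings: above after
   [v] ([clp]), still below ([cln]), crossing at the point [v] itself ([clz]). *)
match goal with |- ?G => pose Q : Prop := G; change Q end.
have clp : 0 < dh v.+1 -> gap c m v.+1 < gap c' m' v.+1 ->
    (exists2 i, (i < v.+1)%N & rises i) -> Q.
  move=> d g e; rewrite /Q; split=> //; [exact: ext1|by rewrite gt_eqF|by rewrite ltNge ltW].
have cln : dh v.+1 < 0 -> gap c' m' v.+1 < gap c m v.+1 -> gap c' m' v < gap c m v -> Q.
  move=> d g e; rewrite /Q; split=> //; [exact: ext2|by rewrite lt_eqF|by rewrite ltNge ltW|].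
  by move=> _; apply: (ext (h4 e)).
have clz : gap c m v.+1 < gap c' m' v.+1 -> rises v -> gap c' m' v < gap c m v -> Q.
  move=> g /rv e /ext2 e2; rewrite /Q; split=> //; first by rewrite gt_eqF.
  by rewrite ltNge ltW.
move: clp cln clz; rewrite [gap c m v.+1]/= [gap c' m' v.+1]/=; clearbody Q.
have /andP[m1 m2] := mm; clear ext ext1 ext2 h1 h3 h4 IH.
move: dv key rv bg bg' sK h2 h3'; rewrite /rises.
case: (sc v) => ->; case: (sc' v) => -> /=; rewrite ?mul1r ?mulN1r =>
  dv key rv bg bg' sK h2 h3' clp cln clz.
- by case: key => // key; apply: clz.
- by apply: clp; [lia|lia|apply: rv].
- by case: key => // key; apply: cln => //; lia.
- by case: key => // key; apply: cln => //; lia.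
- move: h2; rewrite neq_lt => /orP[h2|h2]; first by apply: cln => //; lia.
  by apply: clp; [lia|lia|apply: h3'].
- by case: key => // key; apply: cln => //; lia.
- by apply: clp; [lia|lia|apply: rv].
- by apply: clp; [lia|lia|apply: rv].
- move: h2; rewrite neq_lt => /orP[h2|h2]; first by apply: cln => //; lia.
  by apply: clp; [lia|lia|apply: h3'].
Qed.

Lemma dh_first : dh 0 < 0.
Proof. by have /andP[m1 _] := mm; rewrite /dh /= opprK; lia. Qed.

Lemma dh_last : dh n.+1 != 0.
Proof. by have [_ h _ _] := dh_gap (leqnn n); rewrite /dh /= ltnn subr_eq0. Qed.

Lemma dh_cross i j : (i < j <= n.+1)%N -> 0 <= dh i -> 0 < dh j.
Proof.
have [h1 h2 h3 h4] := dh_gap (leqnn n).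
move=> /andP[ij]; rewrite leq_eqVlt => /predU1P[ej|jn]; last by apply: h1; rewrite ij.
subst j; move=> di; have e : dh n.+1 = gap c' m' n - gap c m n by rewrite /dh /= ltnn.
rewrite e subr_gt0; move: h2; rewrite neq_lt => /orP[h2|//].
by have := h4 h2 i ij; rewrite ltNge di.
Qed.

End Two.
End Heights.

(** * Piecewise linear interpolation *)

Section PiecewiseLinear.
Variable R : realType.
Implicit Types h d : nat -> R.

Definition clamp (t : R) : R := Num.max 0 (Num.min 1 t).

(** Interpolation with nodes at the integers up to [N], constant outside them. It is linear in [h],
    so the difference of two curves is again of this form. *)
Fixpoint pl h N (x : R) : R := if N is N'.+1 then
  pl h N' x + (h N - h N') * clamp (x - N'%:R) else h 0%N.

Lemma clamp_le0 t : t <= 0 -> clamp t = 0.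
Proof. by rewrite /clamp => t0; rewrite minElt maxElt; do 2 case: ifP => //; lra. Qed.

Lemma clamp_ge1 t : 1 <= t -> clamp t = 1.
Proof. by rewrite /clamp => t0; rewrite minElt maxElt; do 2 case: ifP => //; lra. Qed.

Lemma clamp_mid t : 0 <= t <= 1 -> clamp t = t.
Proof. by rewrite /clamp => t0; rewrite minElt maxElt; do 2 case: ifP => //; lra. Qed.

Lemma pl_last h N x : N%:R <= x -> pl h N x = h N.
Proof.
elim: N => // N IH Nx /=; rewrite IH; last by apply: le_trans Nx; rewrite ler_nat.
by rewrite clamp_ge1 ?mulr1 ?subrKC ?subrK // ?lerBrDl -?natr1 //; lra.
Qed.

Lemma pl_low h N x : x <= N%:R -> pl h N.+1 x = pl h N x.
Proof. by move=> xN /=; rewrite clamp_le0 ?mulr0 ?addr0 // subr_le0. Qed.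

Lemma pl_node h N j : (j <= N)%N -> pl h N j%:R = h j.
Proof.
elim: N => [|N IH]; first by rewrite leqn0 => /eqP ->.
rewrite leq_eqVlt => /predU1P[->|]; first by rewrite pl_last.
by rewrite ltnS => jN; rewrite pl_low ?ler_nat // IH.
Qed.

Lemma plB h d N x : pl (fun j => d j - h j) N x = pl d N x - pl h N x.
Proof. by elim: N => //= N ->; ring. Qed.

Lemma clamp_continuous : continuous clamp.
Proof.
move=> x; apply: (@continuous_max R R (cst 0) (fun t => Num.min 1 t)); first exact: cvg_cst.
by apply: (@continuous_min R R (cst 1) id); [exact: cvg_cst|exact: cvg_id].
Qed.

Lemma pl_continuous h N : continuous (pl h N).
Proof.
elim: N => [|N IH] x /=; first exact: cvg_cst.
apply: cvgD; first exact: IH.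
apply: cvgM; first exact: cvg_cst.
apply: (@continuous_comp _ _ _ (fun x : R => x - N%:R) clamp); last exact: clamp_continuous.
by apply: cvgB; [exact: cvg_id|exact: cvg_cst].
Qed.

(** On a unit interval the function is affine between consecutive nodes, so a single sign change at
    the nodes forces a single one everywhere. *)
Lemma pl_cross_le d N : d 0%N < 0 ->
  (forall i j, (i < j <= N)%N -> 0 <= d i -> 0 < d j) ->
  forall x y, x < y <= N%:R -> 0 <= pl d N x -> 0 < pl d N y.
Proof.
move=> d0; elim: N => [|N IH] dN x y /andP[xy yN] /=; first lra.
have {}IH : forall x y, x < y <= N%:R -> 0 <= pl d N x -> 0 < pl d N y.
  by apply: IH => i j /andP[ij jN]; apply: dN; rewrite ij ltnW.
have dNN : 0 <= d N -> 0 < d N.+1 by apply: dN; rewrite leqnn.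
case: (leP y N%:R) => yN'.
  have xN' : x <= N%:R by lra.
  rewrite !clamp_le0 ?subr_le0 // !mulr0 !addr0; apply: IH; lra.
rewrite -natr1 in yN.
rewrite (pl_last _ (ltW yN')) (@clamp_mid (y - N%:R)); last by lra.
case: (leP x N%:R) => xN'.
  rewrite clamp_le0 ?subr_le0 // mulr0 addr0 => px.
  have dN0 : 0 <= d N.
    move: xN'; rewrite le_eqVlt => /predU1P[ex|xN']; first by rewrite ex pl_last in px.
    by have := IH x N%:R; rewrite xN' lexx (@pl_last d N N%:R) // => /(_ isT px) /ltW.
  by have := dNN dN0; nra.
rewrite (pl_last _ (ltW xN')) (@clamp_mid (x - N%:R)); last by lra.
case: (leP 0 (d N)) => [dN0 _|dN0 px]; first by have := dNN dN0; nra.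
nra.
Qed.

Lemma pl_cross d N : d 0%N < 0 -> d N != 0 ->
  (forall i j, (i < j <= N)%N -> 0 <= d i -> 0 < d j) ->
  forall x y, x < y -> 0 <= pl d N x -> 0 < pl d N y.
Proof.
move=> d0 dN dc x y xy px; have pc := pl_cross_le d0 dc.
case: (leP y N%:R) => yN; first by apply: pc px; rewrite xy.
rewrite pl_last; last exact: ltW.
case: (ltP x N%:R) => xN; last by rewrite pl_last // le_eqVlt eq_sym (negbTE dN) in px.
by have := pc x N%:R; rewrite (@pl_last d N N%:R) // xN lexx; apply.
Qed.

End PiecewiseLinear.

(** * Graphs of continuous functions as pseudolines *)

Section Graphs.
Variables (R : realType) (f : R -> R).
Hypothesis f_cont : continuous f.

Definition graph : set (R * R) := range (fun x => (x, f x)).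
Definition side (e : R) : set (R * R) := [set p | 0 < e * (p.2 - f p.1)].

Lemma graphE p : graph p <-> p.2 = f p.1.
Proof.
by split=> [[x _ <-]|e] //; exists p.1 => //; rewrite -e -surjective_pairing.
Qed.

Lemma pair_continuous (T : topologicalType) (u v : T -> R) :
  continuous u -> continuous v -> continuous (fun x => (u x, v x)).
Proof. by move=> cu cv x; exact: (cvg_pair (cu x) (cv x)). Qed.

Lemma graph_pseudoline : pseudoline graph.
Proof.
exists (fun x => (x, f x)); split=> //.
- by apply: pair_continuous => // x; exact: cvg_id.
- by move=> x y [].
- move=> K cK; have cl : closed ((fun x => (x, f x)) @^-1` K).
    apply: (closed_comp (f := fun x => (x, f x))); last exact: compact_closed.
    by move=> x _; apply: pair_continuous => // z; exact: cvg_id.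
  apply: (subclosed_compact cl (B := fst @` K)).
    apply: continuous_compact => //; apply: continuous_subspaceT => z; exact: cvg_fst.
  by move=> x Kx; exists (x, f x).
Qed.

(** A side is the union of vertical open rays, each meeting one common vertical translate of the
    graph. *)
Lemma side_connected e : e * e = 1 -> connected (side e).
Proof.
move=> ee.
pose G := range (fun x => (x, f x + e)).
pose V x := (fun t => (x, f x + e * t)) @` [set t | 0 < t].
have -> : side e = \bigcup_(x in setT) (G `|` V x).
  apply/seteqP; split=> [[x y] /= h|p [x _ [[z _ <-]|[t /= t0 <-]]]].
  - exists x => //; right; exists (e * (y - f x)) => //=.
    by rewrite mulrA ee mul1r subrKC.
  - by rewrite /side /= addrC addKr ee.
  - by rewrite /side /= addrC addKr mulrA ee mul1r.
have GV x : (G `&` V x) (x, f x + e) by split; [exists x|exists 1; rewrite /= ?mulr1].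
apply: bigcup_connected => [|x _].
  by exists (0, f 0 + e) => x _; left; exists 0.
apply: connectedU; first by exists (x, f x + e).
  apply: connected_continuous_connected; first by apply/connected_intervalP.
  apply: continuous_subspaceT; apply: pair_continuous => z; first exact: cvg_id.
  by apply: cvgD; [exact: f_cont|exact: cvg_cst].
apply: connected_continuous_connected.
  by apply/connected_intervalP => a b /= a0 b0 c /andP[ac cb]; apply: lt_le_trans ac.
apply: continuous_subspaceT; apply: pair_continuous => z; first exact: cvg_cst.
by apply: cvgD; [exact: cvg_cst|apply: cvgM; [exact: cvg_cst|exact: cvg_id]].
Qed.

Lemma side_open e : open (side e).
Proof.
apply: (open_comp (f := fun p : R * R => e * (p.2 - f p.1)) (D := [set t | 0 < t])) => //.
move=> p _; apply: cvgM; first exact: cvg_cst.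
apply: cvgB; first exact: cvg_snd.
by apply: (@continuous_comp _ _ _ fst f); [exact: cvg_fst|exact: f_cont].
Qed.

Lemma graph_compl : ~` graph = side 1 `|` side (-1).
Proof.
apply/seteqP; split=> p; rewrite /side /=.
  move=> /graphE/eqP; rewrite -subr_eq0 neq_lt mul1r mulN1r oppr_gt0.
  by case/orP; [right|left].
by move=> h /graphE e; move: h; rewrite e subrr !mulr0 ltxx => -[].
Qed.

Lemma side_separated e : separated (side e) (side (- e)).
Proof.
have H e' : closure (side e') `&` side (- e') = set0.
  apply/seteqP; split=> // p [cp sp].
  have [q []] := cp _ (open_nbhs_nbhs (conj (@side_open (- e')) sp)).
  by rewrite /side /=; lra.
by split; rewrite ?H // setIC -{2}(opprK e) H.
Qed.

Lemma side_component e p : e = 1 \/ e = -1 -> side e p ->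
  connected_component (~` graph) p = side e.
Proof.
move=> e1 sp; have ee : e * e = 1 by case: e1 => ->; rewrite ?mulrNN mulr1.
have gE : ~` graph = side e `|` side (- e).
  by rewrite graph_compl; case: e1 => ->; rewrite ?opprK // setUC.
apply/seteqP; split; last first.
  apply: connected_component_max => //; last exact: side_connected.
  by rewrite gE; left.
have := @connected_subset _ _ _ _ (side_separated e) _
  (component_connected (A := ~` graph) (x := p)).
case=> //; first by rewrite -gE; exact: connected_component_sub.
move=> /(_ p) h; have := h (connected_component_refl _).
by rewrite gE => /(_ (or_introl sp)); move: sp; rewrite /side /=; lra.
Qed.

Lemma graph_sides : sides graph (side 1) (side (-1)).
Proof.
have s1 : side 1 (0, f 0 + 1) by rewrite /side /=; lra.
have s2 : side (-1) (0, f 0 - 1) by rewrite /side /=; lra.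
split.
  by move=> e; move: s1; rewrite e /side /=; lra.
apply/seteqP; split=> S.
  move=> [p gp <-]; move: (gp); rewrite {1}graph_compl => -[sp|sp].
    by left; exact: side_component (or_introl erefl) sp.
  by right; exact: side_component (or_intror erefl) sp.
case=> ->.
  exists (0, f 0 + 1); last by apply: side_component => //; left.
  by rewrite graph_compl; left.
exists (0, f 0 - 1); last by apply: side_component => //; right.
by rewrite graph_compl; right.
Qed.

End Graphs.

(** * The configuration of a list of moves *)

Section Configuration.
Variables (R : realType) (k n : nat) (ms : seq move).
Hypothesis ms_run : run k (iota 0 n) ms (rev (iota 0 n)).

Definition nth_move m : move := nth ([::], [::], [::]) ms m.

Definition curve m : R -> R :=
  pl (fun j => (height (size ms) n (cls (nth_move m)) m j)%:~R) n.+1.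

Definition point i : R * R := (i.+1%:R, 0).

Definition points : {fset R * R} := [fset p in map point (iota 0 n)]%fset.

Lemma cls_signs m : signs (cls m).
Proof. exact: cls_cases. Qed.

Lemma curve_continuous m : continuous (curve m).
Proof. exact: pl_continuous. Qed.

Lemma curve_point m i : (i < n)%N -> (m < size ms)%N ->
  [/\ cls (nth_move m) i = 0 -> curve m i.+1%:R = 0,
      cls (nth_move m) i = 1 -> 0 < curve m i.+1%:R &
      cls (nth_move m) i = -1 -> curve m i.+1%:R < 0].
Proof.
move=> ni mms; rewrite /curve pl_node ?ltnS ?(ltnW ni) //= ni.
have gb := gap_bound i (cls_signs (nth_move m)) mms.
have sg := scale_ge (size ms) i.
have s0 : 0 < scale (size ms) i by lia.
by split=> -> /=; rewrite ?ltr0z ?ltrz0 ?mul1r ?mulN1r //; lia.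
Qed.

Lemma uniq_iota : uniq (iota 0 n). Proof. exact: iota_uniq. Qed.

Lemma curve_cross a b x y : (a < b < size ms)%N -> x < y ->
  curve a x <= curve b x -> curve a y < curve b y.
Proof.
move=> ab xy; have sc := cls_signs; have abK := ab; set K := size ms in abK.
have rs i j : (i < j < n)%N -> rises (cls (nth_move a)) (cls (nth_move b)) i ->
  (cls (nth_move a) j <= cls (nth_move b) j) &&
  ~~ ((cls (nth_move a) j == 0) && (cls (nth_move b) j == 0)).
  move=> /andP[ij jn] h; apply: (run_up ms_run uniq_iota ab ij _ _ h);
  by rewrite mem_iota //=; apply: ltn_trans jn.
have h0 := dh_first n (cls (nth_move a)) (cls (nth_move b)) abK.
have h1 := dh_last (sc _) (sc _) abK rs.
have h2 := dh_cross (sc _) (sc _) abK rs.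
rewrite -subr_ge0 -[_ < curve b y]subr_gt0 /curve -!plB -/K; apply: pl_cross => //.
- by rewrite -intrB ltrz0.
- by rewrite -intrB intr_eq0.
- by move=> i j ij; rewrite -!intrB ler0z ltr0z; apply: h2.
Qed.

Lemma point_inj : injective point.
Proof. by move=> i j [] /eqP; rewrite eqr_nat eqSS => /eqP. Qed.

Lemma card_points : #|` points| = n.
Proof. by rewrite card_fseq undup_id ?size_map ?size_iota // map_inj_uniq ?iota_uniq //; apply: point_inj. Qed.

Lemma mem_points p : (p \in points) = (p \in map point (iota 0 n)).
Proof. by rewrite inE. Qed.

Lemma num_pointsE (S : set (R * R)) :
  num_points points S = count (fun i => point i \in S) (iota 0 n).
Proof.
rewrite /num_points.
have -> : [fset p in points | p \in S]%fset =
    [fset p in map point [seq i <- iota 0 n | point i \in S]]%fset.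
  apply/fsetP => p; rewrite !inE; apply/andP/mapP.
    by move=> [/mapP[i it ->] pS]; exists i; rewrite // mem_filter pS.
  by move=> [i]; rewrite mem_filter => /andP[pS it] ->; rewrite map_f.
rewrite card_fseq undup_id ?size_map ?size_filter // map_inj_uniq ?filter_uniq ?iota_uniq //.
exact: point_inj.
Qed.

Lemma mem_move m : (m < size ms)%N -> nth_move m \in ms.
Proof. exact: mem_nth. Qed.

(** Class [1] means that the curve passes above the point, so the front part of the move is counted
    on the lower side. *)
Lemma num_points_side m : (m < size ms)%N ->
  num_points points (side (curve m) 1) = size (nth_move m).2 /\
  num_points points (side (curve m) (-1)) = size (nth_move m).1.1.
Proof.
move=> mms; have [lm pm] := run_legal ms_run (mem_move mms).
rewrite !num_pointsE.
have cp i : i \in iota 0 n -> (point i \in side (curve m) 1) = (i \in (nth_move m).2) /\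
  (point i \in side (curve m) (-1)) = (i \in (nth_move m).1.1).
  move=> iin; have ni : (i < n)%N by move: iin; rewrite mem_iota.
  have [c0 c1 cn] := curve_point ni mms.
  have um : uniq (before_move (nth_move m)) by rewrite -(perm_uniq pm) iota_uniq.
  have im : i \in before_move (nth_move m) by rewrite -(perm_mem pm).
  have E (b : bool) (S : set (R * R)) : (S (point i) <-> b) -> (point i \in S) = b.
    by move=> [h1 h2]; apply/idP/idP => [/set_mem/h1|/h2/mem_set].
  move: c0 c1 cn um im; rewrite /cls /before_move !mem_cat cat_uniq (cat_uniq (nth_move m).1.2).
  case: ifP => [iu c0 c1 cn|iu].
    move=> /and3P[_ /hasPn nu _] _.
    have iv : i \in (nth_move m).2 = false.
      by apply/negbTE/negP => iv; have := nu i; rewrite mem_cat iv orbT iu => /(_ isT).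
    rewrite iv; split; apply: E; rewrite /side /=; have := c1 erefl; split=> //; lra.
  case: ifP => [iR c0 c1 cn|iR c0 c1 cn].
    move=> /and3P[_ _ /and3P[_ /hasPn nR _]] _.
    have iv : i \in (nth_move m).2 = false.
      by apply/negbTE/negP => iv; have := nR i iv; rewrite iR.
    rewrite iv; split; apply: E; rewrite /side /= (c0 erefl); split=> //; lra.
  move=> _ /= iv; rewrite iv; split; apply: E; rewrite /side /=; have := cn erefl; split=> //; lra.
have um : uniq (before_move (nth_move m)) by rewrite -(perm_uniq pm) iota_uniq.
have cnt (s s1 s2 : seq nat) : uniq (s1 ++ s ++ s2) -> count (mem s) (s1 ++ s ++ s2) = size s.
  rewrite cat_uniq has_cat => /and3P[_ /norP[/hasPn h1 _]]; rewrite cat_uniq => /and3P[_ /hasPn h2 _].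
  rewrite !count_cat (_ : count _ s = size s); last by apply/eqP; rewrite -all_count; apply/allP.
  rewrite (_ : count _ s1 = 0%N); last first.
    apply/eqP; rewrite -leqn0 leqNgt -has_count; apply/hasPn => x xs1; apply/negP => xs.
    by have := h1 x xs; rewrite xs1.
  rewrite (_ : count _ s2 = 0%N) ?addn0 //.
  by apply/eqP; rewrite -leqn0 leqNgt -has_count; apply/hasPn.
split.
- rewrite (eq_in_count (a2 := mem (nth_move m).2)); last by move=> i /cp[].
  rewrite (permP pm).
  have := @cnt (nth_move m).2 ((nth_move m).1.1 ++ (nth_move m).1.2) [::].
  by rewrite cats0 -catA; apply.
- rewrite (eq_in_count (a2 := mem (nth_move m).1.1)); last by move=> i /cp[].
  by rewrite (permP pm) /before_move; apply: (cnt _ [::]).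
Qed.

Definition curves : set (set (R * R)) :=
  [set graph (curve m) | m in [set m | (m < size ms)%N]].

Lemma curves_sides L : curves L -> exists S1 S2, sides L S1 S2 /\
  (k%:R : R) <= `|(num_points points S1)%:R - (num_points points S2)%:R|.
Proof.
move=> [m /= mms <-]; exists (side (curve m) 1), (side (curve m) (-1)).
split; first exact/graph_sides/curve_continuous.
have [-> ->] := num_points_side mms.
have [/and3P[_ _ h] _] := run_legal ms_run (mem_move mms).
by rewrite ler_normr; apply/orP; case/orP: h; rewrite -(ler_nat R) natrD => h; [left|right]; lra.
Qed.

Lemma curves_point m i : (i < n)%N -> (m < size ms)%N -> cls (nth_move m) i == 0 ->
  graph (curve m) (point i).
Proof. by move=> ni mms /eqP ci; apply/graphE; have [/(_ ci) -> _ _] := curve_point ni mms. Qed.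

Lemma curves_configuration : generalised_configuration points curves.
Proof.
split.
- split=> [L [m _ <-]|]; first exact/graph_pseudoline/curve_continuous.
  move=> L1 L2 [a /= ams <-] [b /= bms <-] neq.
  have H (i j : nat) (p q : R * R) : (i < j < size ms)%N -> graph (curve i) p -> graph (curve j) p ->
     graph (curve i) q -> graph (curve j) q -> ~ p.1 < q.1.
    move=> ab /graphE pa /graphE pb /graphE qa /graphE qb pq.
    have := curve_cross ab pq; rewrite -pa -pb lexx => /(_ isT).
    by rewrite -qa -qb ltxx.
  have H2 (i j : nat) (p q : R * R) : (i < j < size ms)%N -> graph (curve i) p -> graph (curve j) p ->
     graph (curve i) q -> graph (curve j) q -> p = q.
    move=> ab pa pb qa qb; have e : p.1 = q.1.
      case: (ltgtP p.1 q.1) => // h; first by case: (H _ _ _ _ ab pa pb qa qb).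
      by case: (H _ _ _ _ ab qa qb pa pb).
    by case: p q pa qa e {pb qb} => [p1 p2] [q1 q2] /graphE /= -> /graphE /= -> ->.
  move=> p q [pa pb] [qa qb]; case: (ltngtP a b) => [ab|ab|ab].
  + by apply: (H2 a b) => //; rewrite ab.
  + by apply: (H2 b a) => //; rewrite ab.
  + by rewrite ab in neq.
- move=> L [m /= mms <-]; have [/and3P[sR R2 _] pm] := run_legal ms_run (mem_move mms).
  have um : uniq (before_move (nth_move m)) by rewrite -(perm_uniq pm) iota_uniq.
  have zero i : i \in (nth_move m).1.2 -> (i < n)%N /\ cls (nth_move m) i == 0.
    move=> iR; have : i \in iota 0 n by rewrite (perm_mem pm) /before_move !mem_cat iR orbT.
    rewrite mem_iota => ni; split=> //; rewrite /cls iR.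
    move: um; rewrite /before_move cat_uniq has_cat => /and3P[_ /norP[/hasPn h _] _].
    by rewrite (negbTE (h i iR)).
  move: (nth_move m).1.2 (zero) R2 sR => [|i [|j s]] // zz _ /= /andP[ij _].
  have [ni ci] := zz i (mem_head _ _); have [|nj cj] := zz j; first by rewrite !inE eqxx orbT.
  exists (point i), (point j); rewrite !mem_points !map_f ?mem_iota //; split=> //.
  + by move=> /point_inj e; rewrite e ltnn in ij.
  + exact: curves_point.
  + exact: curves_point.
- move=> p q; rewrite !mem_points => /mapP[i]; rewrite mem_iota /= => ni -> /mapP[j].
  rewrite mem_iota /= => nj -> neq.
  have H (i' j' : nat) : (i' < n)%N -> (j' < n)%N -> (i' < j')%N ->
     exists L, [/\ curves L, L (point i') & L (point j')].
    move=> ni' nj' ij.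
    have it : i' \in iota 0 n by rewrite mem_iota.
    have jt : j' \in iota 0 n by rewrite mem_iota.
    have b1 : before (iota 0 n) i' j' by apply: sorted_before => //; apply: iota_ltn_sorted.
    have b2 : before (rev (iota 0 n)) j' i' by apply: sorted_before_rev => //; apply: iota_ltn_sorted.
    have [mv mvin /andP[ci cj]] := run_through ms_run uniq_iota ij it jt b1 b2.
    have e : nth_move (index mv ms) = mv by rewrite /nth_move nth_index.
    have mms : (index mv ms < size ms)%N by rewrite index_mem.
    exists (graph (curve (index mv ms))); split; first by exists (index mv ms).
      by apply: curves_point; rewrite // e.
    by apply: curves_point; rewrite // e.
  case: (ltngtP i j) => ij; first exact: H.
    by have [L [h1 h2 h3]] := H _ _ nj ni ij; exists L.
  by rewrite ij in neq.
Qed.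

End Configuration.

Theorem theorem1p2 (R : realType) :
  exists (c : R) (n0 : nat), 0 < c /\
    forall n : nat, (n0 <= n)%N ->
      exists (P : {fset R * R}) (A : set (set (R * R))),
        [/\ generalised_configuration P A,
            #|` P| = n &
            forall L, A L ->
              exists S1 S2 : set (R * R),
                sides L S1 S2 /\
                c * ln (ln n%:R) <=
                  `|(num_points P S1)%:R - (num_points P S2)%:R|].
Proof.
have [C [C0 HC]] : exists C, (0 < C)%N /\ forall k n, (0 < k)%N ->
    (2 ^ (2 ^ (C * k)) <= n)%N ->
    exists s, [/\ pairwise ltn s, size s = n & reach ltn k s (rev s)].
  by exists 56%N; split=> // k n k0; apply: reach_rev.
(* For [k] maximal with [2 ^ (2 ^ (C * k)) <= n], the iterated logarithm is at most [C * k.+1],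
   hence at most [2 * C * k]; the choice of [n0] makes [k] at least [1]. *)
exists (2 * C)%:R^-1, (2 ^ (2 ^ C))%N; split; first by rewrite invr_gt0 ltr0n muln_gt0.
move=> n nC.
have exP : exists k, (2 ^ (2 ^ (C * k)) <= n)%N by exists 1%N; rewrite muln1.
have boundP k : (2 ^ (2 ^ (C * k)) <= n)%N -> (k <= n)%N.
  apply: leq_trans; apply/ltnW/(leq_ltn_trans (leq_pmull k C0)).
  by apply: ltn_trans (ltn_expl _ _) (ltn_expl _ _).
have [k kn kmax] := ex_maxnP exP boundP.
have k0 : (0 < k)%N by apply: kmax; rewrite muln1.
have nk : (n < 2 ^ (2 ^ (C * k.+1)))%N.
  by rewrite ltnNge; apply/negP => /kmax; rewrite ltnn.
have [s [is_ ss rs]] := HC _ _ k0 kn.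
have [ms rms] := reach_run (reach_iota is_ ss rs).
exists (points R n), (@curves R n ms); split.
- exact: curves_configuration rms.
- exact: card_points.
move=> L /(curves_sides rms) [S1 [S2 [h1 h2]]]; exists S1, S2; split=> //.
apply: le_trans h2; rewrite mulrC ler_pdivrMr ?ltr0n ?muln_gt0 // -natrM.
have n2 : (2 <= n)%N.
  by apply: leq_trans nC; rewrite -{1}(expn1 2) leq_exp2l // expn_gt0.
have ln2 : ln 2 <= 1 :> R by have := @le_ln1Dx R 1 ltac:(lra); rewrite -[1 + 1]/(2%:R).
have ln_exp m : ln ((2 ^ m)%N%:R : R) <= m%:R.
  by rewrite natrX lnXn // -[ln _ *+ m]mulr_natr ler_piMl.
have h3 : ln (n%:R : R) <= (2 ^ (C * k.+1))%N%:R.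
  apply: le_trans (ln_exp _); rewrite ler_ln ?posrE ?ltr0n ?expn_gt0 //; last by lia.
  by rewrite ler_nat ltnW.
have h4 : 0 < ln (n%:R : R) by rewrite ln_gt0 // ltr1n.
have h5 : ln (ln (n%:R : R)) <= (C * k.+1)%N%:R.
  by apply: le_trans (ln_exp _); rewrite ler_ln ?posrE // ltr0n expn_gt0.
apply: le_trans h5 _; rewrite ler_nat; nia.
Qed.
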